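(* Let $\mathcal H_\ell(V)_{\mathcal C}$ be the sheaf of conformal blocks on $S$ for the family of $N$-pointed projective lines $\mathbb P^1\times S\to S$ with representations $V_1,\dots,V_N$ placed at the points $z_1,\dots,z_N$. The natural map $V_1\otimes\cdots\otimes V_N\otimes_k\mathcal O_S\to\mathcal H_\ell(V)_{\mathcal C}$ is surjective, and the WZW-connection is induced via this map by the connection on $V_1\otimes\cdots\otimes V_N\otimes_k\mathcal O_S$ defined by the connection form $$\frac1{\ell+\check h}\sum_{i=1}^N\sum_{j\ne i}\frac{dz_i}{z_j-z_i}\,c^{(i,j)}=-\frac1{\ell+\check h}\sum_{1\le i<j\le N}\frac{d(z_i-z_j)}{z_i-z_j}\,c^{(i,j)}.$$ This lift of the WZW-connection is known as the Knizhnik–Zamolodchikov connection; it is still flat.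
   Context: $k=\mathbb C$, $\mathfrak g$ is a finite dimensional simple Lie algebra over $k$, $(\cdot|\cdot)$ the invariant form with value $2$ on the small coroots, $\{X_\kappa\}$ an orthonormal basis, $c=\sum_\kappa X_\kappa\otimes X_\kappa\in\mathfrak g\otimes\mathfrak g$ the Casimir element, $\check h$ given by $\sum_\kappa[X_\kappa,[X_\kappa,Y]]=2\check hY$. $\ell$ is a positive integer; $V_1,\dots,V_N$ are irreducible finite dimensional $\mathfrak g$-representations of level $\le\ell$ (i.e. for every nilpotent $X\in\mathfrak g$, $X^{\ell+1}=0$ on $V_i$). $c^{(i,j)}$ is the action of $c$ on $V_1\otimes\cdots\otimes V_N$ through the $i$th and $j$th factors. $S\subset\mathbb C^N$ is the open set of $N$-tuples $(z_1,\dots,z_N)$ of pairwise distinct numbers. Sheaf of conformal blocks: besides the sections $z=z_1,\dots,z=z_N$ of $\mathbb P^1\times S\to S$ (with affine coordinate $z$) use the section $z=\infty$ with the trivial representation. $\mathcal A=\mathcal O_S[z,(z-z_1)^{-1},\dots,(z-z_N)^{-1}]$ is the algebra of functions regular outside these sections, embedded in $\mathcal L=\oplus_{i=1}^N\mathcal O_S((t_i))\oplus\mathcal O_S((t_\infty))$, $t_i=z-z_i$, $t_\infty=z^{-1}$. $\widehat{\mathcal L\mathfrak g}=\mathfrak g\otimes\mathcal L\oplus\mathcal O_Sc$ (here $c$ also denotes the central generator) with $[Xf,Yg]=[X,Y]fg+c\operatorname{Res}(g\,df)(X|Y)$. $\mathcal H_\ell(V)$ is the tensor product over $\mathcal O_S$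 of the level-$\ell$ irreducible integrable highest weight modules with degree-zero parts $V_1,\dots,V_N$ and the trivial representation (so $c$ acts as $\ell$). $\mathcal H_\ell(V)_{\mathcal C}=\mathcal H_\ell(V)/(\mathfrak g\otimes\mathcal A)\mathcal H_\ell(V)$, and the natural map is induced by the inclusion of $V_1\otimes\cdots\otimes V_N$ tensored with the trivial representation at infinity. WZW-connection: to cover a vector field on $S$, lift it to a $k$-derivation $D$ of $\mathcal A$; in $\mathcal L$ write $D=D_{\rm vert}+D_{\rm hor}$ with $D_{\rm hor}(t_i)=0=D_{\rm hor}(t_\infty)$ and $D_{\rm vert}$ an $\mathcal O_S$-derivation of $\mathcal L$; the covariant derivative is induced by coefficientwise derivation by $D_{\rm hor}$ plus the Sugawara operator $T_{\mathfrak g}(D_{\rm vert})=-\frac1{2(\ell+\check h)}\sum_{p,\kappa,l}:X_\kappa\langle D_{\rm vert},t_p^{-l-1}dt_p\rangle\circ X_\kappa t_p^l:$ (sum over $p\in\{1,\dots,N,\infty\}$, highest power of $t_p$ placed on the right). It is a connection on the associated bundle of projective spaces. *)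

(* Defs.v *)
From HB Require Import structures.
From mathcomp Require Import all_boot all_order all_algebra.
From mathcomp Require Import generic_quotient ring_quotient.
From mathcomp Require Import finmap.
From mathcomp Require Import boolp classical_sets functions fsbigop reals.
From mathcomp Require Import complex.
From mathcomp Require mpoly.
From mathcomp Require Import monalg.

Set Implicit Arguments.
Unset Strict Implicit.
Unset Printing Implicit Defensive.

Import Order.TTheory GRing.Theory Num.Theory.
Local Open Scope ring_scope.
Local Open Scope quotient_scope.

Section SpanQuotient.
Variables (O : comNzRingType) (M : lmodType O) (P : M -> Prop).

Definition in_span (x : M) : Prop :=
  exists2 s : seq (O * M),
    (forall y, y \in s -> P y.2) & x = \sum_(y <- s) y.1 *: y.2.

Definition span_pred : {pred M} := fun x => `[< in_span x >].

Lemma span_predP x : reflect (in_span x) (x \in span_pred).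
Proof. exact: asboolP. Qed.

Lemma span_submod : submod_closed span_pred.
Proof.
split=> [|a x y /span_predP[s Ps ->] /span_predP[r Pr ->]]; apply/span_predP.
  by exists [::]; rewrite ?big_nil.
exists ([seq (a * u.1, u.2) | u <- s] ++ r).
  move=> u; rewrite mem_cat => /orP[/mapP[w ws ->]|/Pr//]; exact: (Ps w ws).
rewrite big_cat big_map scaler_sumr /=; congr (_ + _).
by apply: eq_bigr => u _; rewrite scalerA.
Qed.

HB.instance Definition _ :=
  GRing.isZmodClosed.Build M span_pred (GRing.submod_closedB span_submod).
HB.instance Definition _ :=
  GRing.isScaleClosed.Build O M span_pred
    (GRing.subsemimod_closedZ (GRing.submod_closed_semi span_submod)).

(* The quotient of M by the O-submodule generated by P. *)
Definition span_quot : Type := Quotient.quot span_pred.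
HB.instance Definition _ := GRing.Zmodule.on span_quot.
HB.instance Definition _ := EqQuotient.on span_quot.

Definition span_proj (x : M) : span_quot := \pi_span_quot x.

Lemma span_projE x y : (span_proj x = span_proj y) <-> in_span (x - y).
Proof.
rewrite /span_proj; split.
  by move=> /eqP; rewrite -Quotient.idealrBE => /span_predP.
by move=> ?; apply/eqP; rewrite -Quotient.idealrBE; apply/span_predP.
Qed.

Lemma span_projD : {morph span_proj : x y / x + y}.
Proof. by move=> x y; rewrite /span_proj !piE. Qed.

Lemma span_proj_repr (x : span_quot) : span_proj (repr x) = x.
Proof. exact: reprK. Qed.

Definition span_scale (a : O) (x : span_quot) : span_quot :=
  span_proj (a *: repr x).

Lemma span_projZ a x : span_proj (a *: x) = span_scale a (span_proj x).
Proof.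
apply/span_projE/span_predP; rewrite -scalerBr rpredZ//.
by apply/span_predP/span_projE; rewrite span_proj_repr.
Qed.

Fact span_scaleA a b x : span_scale a (span_scale b x) = span_scale (a * b) x.
Proof. by rewrite -[x]span_proj_repr -!span_projZ scalerA. Qed.
Fact span_scale1 : left_id 1 span_scale.
Proof. by move=> x; rewrite -[x]span_proj_repr -!span_projZ scale1r. Qed.
Fact span_scaleDr : right_distributive span_scale +%R.
Proof.
move=> a x y; rewrite -[x]span_proj_repr -[y]span_proj_repr.
by rewrite -!(span_projZ, span_projD) scalerDr.
Qed.
Fact span_scaleDl x : {morph span_scale^~ x : a b / a + b}.
Proof.
move=> a b; rewrite -[x]span_proj_repr.
by rewrite -!(span_projZ, span_projD) scalerDl.
Qed.

HB.instance Definition _ := GRing.Zmodule_isLmodule.Build O span_quot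
  span_scaleA span_scale1 span_scaleDr span_scaleDl.

Fact span_proj_linear : linear span_proj.
Proof. by move=> a x y; rewrite span_projD span_projZ. Qed.
HB.instance Definition _ :=
  GRing.isLinear.Build O M span_quot *:%R span_proj span_proj_linear.

End SpanQuotient.

Section Tensor.
Variables (k : fieldType) (O : comAlgType k) (I : finType).
Variable E : I -> lmodType k.
Local Notation family := (forall p, E p).

Inductive multilin_rel : {malg O[family]} -> Prop :=
  MultilinRel (v : family) (p : I) (a : k) (x y : E p) :
    multilin_rel (<< (dfwith v (a *: x + y) : family) >>
      - a%:A *: << (dfwith v x : family) >> - << (dfwith v y : family) >>).

(* O (x)_k (E_1 (x)_k ... (x)_k E_n), or equally the tensor product over O of
   the O-modules O (x)_k E_p. *)
Definition tensor : Type := span_quot multilin_rel.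
HB.instance Definition _ := GRing.Lmodule.on tensor.

Definition pure (v : family) : tensor := span_proj multilin_rel << v >>.

(* A formal sum of pure tensors representing t. *)
Definition formal (t : tensor) : {malg O[family]} := repr (t : span_quot _).

(* The O-linear map sending pure v to phi v; it is used for multilinear phi
   only, for which it is well defined by tlift_linear and tlift_pure. *)
Definition tlift (W : lmodType O) (phi : family -> W) (t : tensor) : W :=
  \sum_(v <- msupp (formal t)) (formal t)@_v *: phi v.

Definition multilinear (W : lmodType O) (phi : family -> W) : Prop :=
  forall (v : family) p (a : k) (x y : E p),
    phi (dfwith v (a *: x + y)) =
      a%:A *: phi (dfwith v x) + phi (dfwith v y).

Definition derivation (X : O -> O) : Prop :=
  [/\ forall a b, X (a + b) = X a + X b,
      forall (c : k) a, X (c *: a) = c *: X a &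
      forall a b, X (a * b) = X a * b + a * X b].

(* Coefficientwise derivation, X (x) id; it is used for k-derivations X only,
   for which it is well defined by tderivD and tderiv_pure. *)
Definition tderiv (X : O -> O) (t : tensor) : tensor :=
  \sum_(v <- msupp (formal t)) X (formal t)@_v *: pure v.

(* f acting on the p-th tensor factor. *)
Definition factor (p : I) (f : E p -> E p) : tensor -> tensor :=
  tlift (fun v => pure (dfwith v (f (v p)))).

Section CoefSum.
Variables (W : lmodType O) (G : O -> family -> W).
Hypothesis GD : forall v, {morph G^~ v : a b / a + b}.

Let coefsum (m : {malg O[family]}) := \sum_(v <- msupp m) G m@_v v.

Let G0 v : G 0 v = 0.
Proof. by apply: (addrI (G 0 v)); rewrite -GD !addr0. Qed.

Let coefsumw (m : {malg O[family]}) (d : {fset family}) :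
  (msupp m `<=` d)%fset -> coefsum m = \sum_(v <- d) G m@_v v.
Proof.
move=> md; rewrite /coefsum; apply: big_fset_incl => // v _ vm.
by rewrite mcoeff_outdom// G0.
Qed.

Let coefsumD m1 m2 : coefsum (m1 + m2) = coefsum m1 + coefsum m2.
Proof.
set d := (msupp m1 `|` msupp m2)%fset.
rewrite (coefsumw (msuppD_le m1 m2)) (@coefsumw m1 d) ?fsubsetUl//.
rewrite (@coefsumw m2 d) ?fsubsetUr// -big_split/=.
by apply: eq_bigr => v _; rewrite mcoeffD GD.
Qed.

Let coefsumU a v : coefsum << a *g v >> = G a v.
Proof.
rewrite (@coefsumw _ [fset v]%fset) ?msuppU_le// big_seq_fset1 mcoeffUU//.
Qed.

Lemma coefsum_props :
  [/\ {morph coefsum : x y / x + y} & forall a v, coefsum << a *g v >> = G a v].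
Proof. by split. Qed.
End CoefSum.

Let malgZU (a b : O) (v : family) :
  a *: << b *g v >> = << a * b *g v >> :> {malg O[family]}.
Proof. by apply/malgP => w; rewrite mcoeffZ !mcoeffU mulrnAr. Qed.

Let formalP t : span_proj multilin_rel (formal t) = t.
Proof. exact: span_proj_repr. Qed.

Let projU a v : span_proj multilin_rel << a *g v >> = a *: pure v.
Proof. by rewrite /pure -linearZ/= malgZU mulr1. Qed.

Let projrel m : multilin_rel m -> span_proj multilin_rel m = 0.
Proof.
move=> Pm; rewrite -[RHS](raddf0 (span_proj multilin_rel)).
apply/span_projE; rewrite subr0; exists [:: (1, m)].
  by move=> y; rewrite inE => /eqP ->.
by rewrite big_seq1 scale1r.
Qed.

Lemma pure_multilinear : multilinear (fun v => pure v : tensor).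
Proof.
move=> v p a x y; apply/eqP; rewrite -subr_eq0 opprD addrA; apply/eqP.
have := projrel (MultilinRel v a x y).
by rewrite 2!raddfB/= linearZ.
Qed.

Section Lift.
Variables (W : lmodType O) (phi : family -> W).
Hypothesis phi_ml : multilinear phi.

Let F (m : {malg O[family]}) := \sum_(v <- msupp m) m@_v *: phi v.

Let FD : {morph F : x y / x + y}.
Proof. by have [] := @coefsum_props W (fun a v => a *: phi v) (fun v a b => scalerDl _ a b). Qed.

Let FU a v : F << a *g v >> = a *: phi v.
Proof. by have [_] := @coefsum_props W (fun a v => a *: phi v) (fun v a b => scalerDl _ a b); apply. Qed.

Let F0 : F 0 = 0. Proof. by rewrite /F msupp0 big_nil. Qed.

Let Fsum (J : Type) (r : seq J) (f : J -> {malg O[family]}) :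
  F (\sum_(j <- r) f j) = \sum_(j <- r) F (f j).
Proof. by elim/big_ind2 : _ => // _ ? _ ? <- <-; rewrite FD. Qed.

Let FZ a m : F (a *: m) = a *: F m.
Proof.
rewrite {1}[m]monalgE scaler_sumr Fsum /F scaler_sumr.
by apply: eq_bigr => v _; rewrite malgZU -/(F _) FU scalerA.
Qed.

Let Frel m : multilin_rel m -> F m = 0.
Proof.
case=> v p a x y; rewrite -[- (_ *: _)]scaleN1r -[- << _ >>]scaleN1r.
by rewrite !FD !FZ !FU !scale1r phi_ml !scaleN1r addrAC addrK subrr.
Qed.

Let Fproj m1 m2 : span_proj multilin_rel m1 = span_proj multilin_rel m2 ->
  F m1 = F m2.
Proof.
move=> /span_projE[s Ps /eqP]; rewrite subr_eq => /eqP ->.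
rewrite FD Fsum big1_seq ?add0r// => u /andP[_ us].
by rewrite FZ Frel ?scaler0//; exact: Ps.
Qed.

Lemma tlift_linear : linear (tlift phi).
Proof.
move=> a x y; rewrite /tlift -!/(F _) -FZ -FD; apply: Fproj.
by rewrite [RHS]linearP /= !formalP.
Qed.

Lemma tlift_pure v : tlift phi (pure v) = phi v.
Proof.
by rewrite /tlift -/(F _) -[RHS]scale1r -FU; apply: Fproj; rewrite formalP.
Qed.
End Lift.

Section Deriv.
Variable X : O -> O.
Hypothesis derX : derivation X.

Let XD a b : X (a + b) = X a + X b. Proof. by case: derX. Qed.
Let XM a b : X (a * b) = X a * b + a * X b. Proof. by case: derX. Qed.
Let X1 : X 1 = 0.
Proof. by apply: (addrI (X 1)); rewrite addr0 -{3}[1]mulr1 XM mulr1 mul1r. Qed.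
Let XC c : X c%:A = 0.
Proof. by case: derX => _ -> _; rewrite X1 scaler0. Qed.

Let F (m : {malg O[family]}) : tensor := \sum_(v <- msupp m) X m@_v *: pure v.

Let GD (v : family) : {morph (fun a => X a *: pure v) : a b / a + b}.
Proof. by move=> a b; rewrite XD scalerDl. Qed.

Let FD : {morph F : x y / x + y}.
Proof. by have [] := @coefsum_props tensor (fun a v => X a *: pure v) GD. Qed.

Let FU a v : F << a *g v >> = X a *: pure v.
Proof. by have [_] := @coefsum_props tensor (fun a v => X a *: pure v) GD; apply. Qed.

Let F0 : F 0 = 0. Proof. by rewrite /F msupp0 big_nil. Qed.

Let Fsum (J : Type) (r : seq J) (f : J -> {malg O[family]}) :
  F (\sum_(j <- r) f j) = \sum_(j <- r) F (f j).
Proof. by elim/big_ind2 : _ => // _ ? _ ? <- <-; rewrite FD. Qed.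

Let FZ a m : F (a *: m) = X a *: span_proj multilin_rel m + a *: F m.
Proof.
rewrite [m in LHS]monalgE [m in _ *: span_proj _ m]monalgE.
rewrite scaler_sumr Fsum linear_sum /F !scaler_sumr -big_split/=.
apply: eq_bigr => v _; rewrite malgZU -/(F _) FU projU XM scalerDl !scalerA.
by [].
Qed.

Let Frel m : multilin_rel m -> F m = 0.
Proof.
case=> v p a x y; rewrite -[- (_ *: _)]scaleN1r -[- << _ >>]scaleN1r.
have XN1 : X (- 1) = 0 by rewrite -(scaleN1r 1) XC.
by rewrite !FD !FZ !FU !X1 !XC XN1 !(scale0r, scaler0, addr0).
Qed.

Let Fproj m1 m2 : span_proj multilin_rel m1 = span_proj multilin_rel m2 ->
  F m1 = F m2.
Proof.
move=> /span_projE[s Ps /eqP]; rewrite subr_eq => /eqP ->.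
rewrite FD Fsum big1_seq ?add0r// => u /andP[_ us].
by rewrite FZ Frel ?projrel ?scaler0 ?addr0//; exact: Ps.
Qed.

Lemma tderivD : {morph tderiv X : x y / x + y}.
Proof.
move=> x y; rewrite /tderiv -!/(F _) -FD; apply: Fproj.
by rewrite [RHS]linearD /= !formalP.
Qed.

Lemma tderiv_pure a v : tderiv X (a *: pure v) = X a *: pure v.
Proof.
by rewrite /tderiv -/(F _) -FU; apply: Fproj; rewrite formalP projU.
Qed.
End Deriv.

Section Factor.
Variables (p : I) (f : E p -> E p).
Hypothesis f_lin : linear f.

Let phi (v : family) : tensor := pure (dfwith v (f (v p))).

Let phi_ml : multilinear phi.
Proof.
move=> v q a x y; rewrite /phi.
have [epq|npq] := eqVneq p q.
  case: _ / epq x y => x y.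
  have E2 (w : E p) : dfwith (dfwith v w) (f (dfwith v w p)) = dfwith v (f w).
    rewrite dfwith_in; apply: functional_extensionality_dep => r.
    have [->|nr] := eqVneq r p; first by rewrite !dfwith_in.
    by rewrite !dfwith_out// eq_sym.
  by rewrite !E2 f_lin pure_multilinear.
have E2 (w : E q) :
    dfwith (dfwith v w) (f (dfwith v w p)) = dfwith (dfwith v (f (v p))) w.
  rewrite dfwith_out 1?eq_sym//; apply: functional_extensionality_dep => r.
  have [->|nr] := eqVneq r p.
    by rewrite dfwith_in dfwith_out ?dfwith_in// eq_sym.
  have [->|nrq] := eqVneq r q.
    by rewrite dfwith_in dfwith_out ?dfwith_in.
  by rewrite !dfwith_out// eq_sym.
by rewrite !E2 pure_multilinear.
Qed.

Lemma factor_linear : linear (factor f).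
Proof. exact: tlift_linear phi_ml. Qed.

Lemma factor_pure v : factor f (pure v) = pure (dfwith v (f (v p))).
Proof. exact: tlift_pure phi_ml v. Qed.
End Factor.

End Tensor.
Arguments pure {k} O {I E} v.
Arguments factor {k O I E} p f t.

Section RegularFunctions.
Import mpoly.
Variables (k : fieldType) (n : nat).

Implicit Types (p q : mpoly n k).

(* The nonempty Zariski open subsets of the space of n-tuples of pairwise
   distinct elements of k.  Quasi-coherent O_S-modules are given by their sections
   over these, and statements about them are made over each U. *)
Record conf_open := ConfOpen {
  conf_set :> ('I_n -> k) -> Prop;
  conf_distinct : forall u, conf_set u -> injective u;
  conf_zariski : forall u, conf_set u -> exists2 p,
    mpoly.meval u p != 0 & forall w, mpoly.meval w p != 0 -> conf_set w;
  conf_nonempty : exists u, conf_set u }.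

Variable U : conf_open.

Definition point : Type := {u | U u}.

Definition regular (f : point -> k) : Prop := forall u : point,
  exists p q, mpoly.meval (sval u) q != 0 /\
    forall w : point, mpoly.meval (sval w) q != 0 ->
      f w = mpoly.meval (sval w) p / mpoly.meval (sval w) q.

Record regfun := RegFun { regval :> point -> k; _ : `[< regular regval >] }.

HB.instance Definition _ := [isSub for regval].
HB.instance Definition _ := [Choice of regfun by <:].

Lemma regvalP (f : regfun) : regular f.
Proof. by case: f => f rf; exact: asboolW rf. Qed.

Lemma regfunP (f g : regfun) : (forall u, f u = g u) -> f = g.
Proof. by move=> fg; apply/val_inj/functional_extensionality_dep. Qed.

Definition mkreg f (rf : regular f) : regfun := RegFun (asboolT rf).

Fact regular_poly p : regular (fun u => mpoly.meval (sval u) p).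
Proof.
move=> u; exists p, 1; rewrite rmorph1 oner_eq0; split=> // w _.
by rewrite rmorph1 divr1.
Qed.
Fact regularD (f g : regfun) : regular (fun u => f u + g u).
Proof.
move=> u; have [p [q [q0 E]]] := regvalP f u.
have [p' [q' [q'0 E']]] := regvalP g u.
exists (p * q' + p' * q), (q * q'); rewrite rmorphM mulf_neq0//; split=> // w.
rewrite rmorphM mulf_eq0 negb_or => /andP[wq wq'].
by rewrite E// E'// rmorphD !rmorphM addf_div.
Qed.
Fact regularN (f : regfun) : regular (fun u => - f u).
Proof.
move=> u; have [p [q [q0 E]]] := regvalP f u.
by exists (- p), q; split=> // w /E ->; rewrite rmorphN mulNr.
Qed.
Fact regularM (f g : regfun) : regular (fun u => f u * g u).
Proof.
move=> u; have [p [q [q0 E]]] := regvalP f u.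
have [p' [q' [q'0 E']]] := regvalP g u.
exists (p * p'), (q * q'); rewrite rmorphM mulf_neq0//; split=> // w.
rewrite rmorphM mulf_eq0 negb_or => /andP[wq wq'].
by rewrite E// E'// !rmorphM mulf_div.
Qed.
Fact regularC (c : k) : regular (fun=> c).
Proof.
move=> u; exists (mpoly.mpolyC n c), 1; rewrite rmorph1 oner_eq0; split=> // w _.
by rewrite rmorph1 divr1 mpoly.mevalC.
Qed.

Definition regunit (f : regfun) : bool := `[< forall u, f u != 0 >].

Fact regularV (f : regfun) : regunit f -> regular (fun u => (f u)^-1).
Proof.
move=> /asboolP f0 u; have [p [q [q0 E]]] := regvalP f u.
have p0 : mpoly.meval (sval u) p != 0.
  by apply: contraNneq (f0 u) => p0; rewrite E// p0 mul0r.
exists (q * q), (p * q); rewrite !rmorphM mulf_neq0//; split=> // w.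
rewrite !rmorphM mulf_eq0 negb_or => /andP[wp wq]; rewrite E// invf_div.
by rewrite -mulf_div divff// mulr1.
Qed.

Definition regadd f g := mkreg (regularD f g).
Definition regopp f := mkreg (regularN f).
Definition regmul f g := mkreg (regularM f g).
Definition regcst c := mkreg (regularC c).
Definition regscale c f := regmul (regcst c) f.
Definition reginv (f : regfun) : regfun :=
  if @idP (regunit f) is ReflectT uf then mkreg (regularV uf) else f.

Fact regaddA : associative regadd.
Proof. by move=> f g h; apply: regfunP => u; apply: addrA. Qed.
Fact regaddC : commutative regadd.
Proof. by move=> f g; apply: regfunP => u; apply: addrC. Qed.
Fact regadd0 : left_id (regcst 0) regadd.
Proof. by move=> f; apply: regfunP => u; apply: add0r. Qed.
Fact regaddN : left_inverse (regcst 0) regopp regadd.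
Proof. by move=> f; apply: regfunP => u; apply: addNr. Qed.
HB.instance Definition _ :=
  GRing.isZmodule.Build regfun regaddA regaddC regadd0 regaddN.

Fact regmulA : associative regmul.
Proof. by move=> f g h; apply: regfunP => u; apply: mulrA. Qed.
Fact regmulC : commutative regmul.
Proof. by move=> f g; apply: regfunP => u; apply: mulrC. Qed.
Fact regmul1 : left_id (regcst 1) regmul.
Proof. by move=> f; apply: regfunP => u; apply: mul1r. Qed.
Fact regmulD : left_distributive regmul +%R.
Proof. by move=> f g h; apply: regfunP => u; apply: mulrDl. Qed.
Fact reg1_neq0 : regcst 1 != 0.
Proof.
have [u Uu] := conf_nonempty U.
apply/eqP => /(congr1 (fun f : regfun => f (exist _ u Uu)))/eqP.
by rewrite oner_eq0.
Qed.
HB.instance Definition _ := GRing.Zmodule_isComNzRing.Build regfun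
  regmulA regmulC regmul1 regmulD reg1_neq0.

Fact regscaleA a b f : regscale a (regscale b f) = regscale (a * b) f.
Proof. by apply: regfunP => u; apply: mulrA. Qed.
Fact regscale1 : left_id 1 regscale.
Proof. by move=> f; apply: regfunP => u; apply: mul1r. Qed.
Fact regscaleDr : right_distributive regscale +%R.
Proof. by move=> a f g; apply: regfunP => u; apply: mulrDr. Qed.
Fact regscaleDl f : {morph regscale^~ f : a b / a + b}.
Proof. by move=> a b; apply: regfunP => u; apply: mulrDl. Qed.
Fact regscale0 f : regscale 0 f = 0.
Proof. by apply: regfunP => u; apply: mul0r. Qed.
HB.instance Definition _ := GRing.Nmodule_isLSemiModule.Build k regfun
  regscaleA regscale0 regscale1 regscaleDr regscaleDl.

Fact regscaleAl (a : k) (f g : regfun) : a *: (f * g) = a *: f * g.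
Proof. by apply: regfunP => u; apply: mulrA. Qed.
HB.instance Definition _ := GRing.Lmodule_isLalgebra.Build k regfun regscaleAl.
HB.instance Definition _ := GRing.Lalgebra_isComAlgebra.Build k regfun.

Fact regmulV : {in regunit, left_inverse 1 reginv *%R}.
Proof.
move=> f uf; rewrite /reginv; case: {-}_ / idP => // uf'.
by apply: regfunP => u /=; apply: mulVf; exact: (asboolP _ uf').
Qed.
Fact regunitP f g : g * f = 1 -> regunit f.
Proof.
move=> gf; apply/asboolP => u; apply/eqP => fu0.
move: (congr1 (fun h : regfun => h u) gf) => /= /eqP.
by rewrite fu0 mulr0 eq_sym oner_eq0.
Qed.
Fact reginv_out : {in [predC regunit], reginv =1 id}.
Proof.
move=> f; rewrite inE /= => nuf; rewrite /reginv.
by case: {-}_ / idP => // uf; case/negP: nuf.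
Qed.
HB.instance Definition _ := GRing.ComNzRing_hasMulInverse.Build regfun
  regmulV regunitP reginv_out.

Definition zcoord (i : 'I_n) : regfun := mkreg (regular_poly 'X_i).

Lemma zcoordE i (u : point) : zcoord i u = sval u i.
Proof. exact: mpoly.mevalXU. Qed.

Lemma zcoordB_unit i j : i != j -> zcoord i - zcoord j \is a GRing.unit.
Proof.
move=> nij; apply/asboolP => -[u Uu].
have -> : (zcoord i - zcoord j) (exist _ u Uu) = u i - u j.
  by congr (_ - _); apply: (zcoordE _ (exist _ u Uu)).
by rewrite subr_eq0; apply: contraNneq nij => /(conf_distinct Uu) ->.
Qed.

End RegularFunctions.

Section LieAlgebras.

Record lieAlgebra (k : fieldType) := LieAlgebra {
  lie_vect :> vectType k;
  lie : lie_vect -> lie_vect -> lie_vect;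
  lieDl : forall a x y z, lie (a *: x + y) z = a *: lie x z + lie y z;
  liexx : forall x, lie x x = 0;
  lieJ : forall x y z, lie x (lie y z) + lie y (lie z x) + lie z (lie x y) = 0 }.

Record gmodule (k : fieldType) (g : lieAlgebra k) := GModule {
  gmod_vect :> vectType k;
  gact : g -> gmod_vect -> gmod_vect;
  gactDl : forall a x y v, gact (a *: x + y) v = a *: gact x v + gact y v;
  gactDr : forall a x v w, gact x (a *: v + w) = a *: gact x v + gact x w;
  gactJ : forall x y v,
    gact (lie x y) v = gact x (gact y v) - gact y (gact x v) }.

Variables (k : numClosedFieldType) (g : lieAlgebra k).

Definition simple_lie : Prop :=
  (exists x y : g, lie x y != 0) /\
  forall J : {vspace g},
    (forall x y, y \in J -> lie x y \in J) -> J = 0%VS \/ J = fullv.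

Definition ad_nilpotent (x : g) : Prop :=
  exists m, forall y, iter m (lie x) y = 0.

Definition ad_diagonalizable (x : g) : Prop :=
  exists2 b : seq g, basis_of fullv b &
    forall y, y \in b -> exists a : k, lie x y = a *: y.

Definition toral (h : {vspace g}) : Prop :=
  (forall x y, x \in h -> y \in h -> lie x y = 0) /\
  (forall x, x \in h -> ad_diagonalizable x).

(* Over an algebraically closed field of characteristic 0 the Cartan subalgebras
   of a semisimple Lie algebra are its maximal toral subalgebras. *)
Definition cartan (h : {vspace g}) : Prop :=
  toral h /\ forall h' : {vspace g}, toral h' -> (h <= h')%VS -> h' = h.

Definition in_root_space (h : {vspace g}) (alpha : g -> k) (x : g) : Prop :=
  forall t, t \in h -> lie t x = alpha t *: x.

(* Only the values of alpha on h matter. *)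
Definition is_root (h : {vspace g}) (alpha : g -> k) : Prop :=
  (exists2 t, t \in h & alpha t != 0) /\
  (exists2 x, x != 0 & in_root_space h alpha x).

Definition is_coroot (h : {vspace g}) (c : g) : Prop :=
  exists alpha : g -> k,
    [/\ is_root h alpha, c \in h, alpha c = 2 &
        exists x y, [/\ in_root_space h alpha x,
                        in_root_space h (fun t => - alpha t) y & c = lie x y]].

Variable B : g -> g -> k.

Definition invariant_form : Prop :=
  [/\ forall a x y z, B (a *: x + y) z = a * B x z + B y z,
      forall x y, B x y = B y x &
      forall x y z, B (lie x y) z = B x (lie y z)].

(* The absolute values make smallness independent of the scaling of B. *)
Definition small_coroot (h : {vspace g}) (c : g) : Prop :=
  is_coroot h c /\ forall c', is_coroot h c' -> `|B c c| <= `|B c' c'|.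

Definition normalized_form : Prop :=
  invariant_form /\
  forall h c, cartan h -> small_coroot h c -> B c c = 2.

Definition orthonormal_basis (X : (\dim {:g}).-tuple g) : Prop :=
  basis_of fullv X /\
  forall i j, B (tnth X i) (tnth X j) = (i == j)%:R.

Definition dual_coxeter (X : (\dim {:g}).-tuple g) (hc : k) : Prop :=
  forall y : g, \sum_i lie (tnth X i) (lie (tnth X i) y) = (2 * hc) *: y.

Definition irreducible (V : gmodule g) : Prop :=
  \dim {:V} != 0 /\
  forall W : {vspace V},
    (forall x v, v \in W -> gact x v \in W) -> W = 0%VS \/ W = fullv.

Definition level_le (l : nat) (V : gmodule g) : Prop :=
  forall x, ad_nilpotent x -> forall v : V, iter l.+1 (gact x) v = 0.

Definition trivial_gmodule : gmodule g.
Proof.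
refine (@GModule k g k^o (fun _ _ => 0) _ _ _) => *.
- by rewrite scaler0 addr0.
- by rewrite scaler0 addr0.
- by rewrite subr0.
Defined.

(* Level l modules over the affine Lie algebra g((t)) + k c, through the action
   mode x m of x t^m.  Since t^m annihilates a given vector for m >> 0, the
   action of x f, f a Laurent series, is a finite sum on each vector. *)
Record affModule (l : nat) := AffModule {
  aff_space :> lmodType k;
  mode : g -> int -> aff_space -> aff_space;
  modeDl : forall a x y m v,
    mode (a *: x + y) m v = a *: mode x m v + mode y m v;
  modeDr : forall a x m v w,
    mode x m (a *: v + w) = a *: mode x m v + mode x m w;
  modeJ : forall x y m p v,
    mode x m (mode y p v) - mode y p (mode x m v) =
      mode (lie x y) (m + p) v + (m%:~R * (m + p == 0)%:R * B x y * l%:R) *: v;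
  mode_smooth : forall v, exists m0, forall x m, m0 <= m -> mode x m v = 0 }.

(* The irreducible integrable highest weight module of level l with degree
   zero part V; the degree zero part is the space annihilated by g t k[[t]]. *)
Record hwModule (l : nat) (V : gmodule g) := HwModule {
  hw_aff :> affModule l;
  hw_emb : V -> hw_aff;
  hw_emb_linear : forall a v w, hw_emb (a *: v + w) = a *: hw_emb v + hw_emb w;
  hw_emb_inj : injective hw_emb;
  hw_emb_act : forall x v, hw_emb (gact x v) = mode x 0 (hw_emb v);
  hw_emb_im : forall w : hw_aff,
    (exists v, w = hw_emb v) <-> (forall x m, 0 < m -> mode x m w = 0);
  hw_irreducible : forall P : hw_aff -> Prop,
    P 0 -> (forall a v w, P v -> P w -> P (a *: v + w)) ->
    (forall x m v, P v -> P (mode x m v)) ->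
    (forall v, P v -> v = 0) \/ (forall v, P v);
  hw_integrable : forall x m (v : hw_aff), ad_nilpotent x ->
    exists r, iter r (mode x m) v = 0 }.

End LieAlgebras.

Section LaurentExpansions.
Variables (k : fieldType) (O : comUnitAlgType k) (n : nat).
Variable z : 'I_n -> O.

(* The points are Some i (for z_i) and None (for infinity).  An element of the
   direct sum of the O((t_p)) is encoded by its coefficients, f p m being that
   of t_p^m; elements are bounded below in m. *)
Definition family_coef : Type := option 'I_n -> int -> O.

Definition laurent (f : family_coef) : Prop :=
  forall p, exists m0, forall m, m < m0 -> f p m = 0.

Definition mul_coef (f g : int -> O) : int -> O :=
  fun m => \sum_(r \in [set: int]) f r * g (m - r).

Definition der_coef (f : int -> O) : int -> O :=
  fun m => (m + 1)%:~R * f (m + 1).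

Definition cst_fun (a : O) : family_coef :=
  fun _ m => if m == 0 then a else 0.

(* z = z_i + t_i = t_oo^-1 *)
Definition z_fun : family_coef := fun p m =>
  match p with
  | Some i => if m == 0 then z i else (m == 1)%:R
  | None => (m == -1)%:R
  end.

(* (z - z_j)^-1, expanded as t_j^-1 at z_j, as the geometric series
   \sum_r (-1)^r (z_i - z_j)^-(r+1) t_i^r at z_i, i <> j, and as
   \sum_r z_j^r t_oo^(r+1) at infinity. *)
Definition pole_fun (j : 'I_n) : family_coef := fun p m =>
  match p with
  | Some i =>
      if i == j then (m == -1)%:R
      else if m is Posz r then (-1) ^+ r * (z i - z j)^-1 ^+ r.+1 else 0
  | None => if m is Posz r.+1 then z j ^+ r else 0
  end.

(* A = O[z, (z - z_1)^-1, ..., (z - z_n)^-1] inside the sum of the O((t_p)). *)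
Inductive in_A : family_coef -> Prop :=
| A_cst a : in_A (cst_fun a)
| A_z : in_A z_fun
| A_pole j : in_A (pole_fun j)
| A_add f g : in_A f -> in_A g -> in_A (fun p m => f p m + g p m)
| A_mul f g : in_A f -> in_A g -> in_A (fun p => mul_coef (f p) (g p)).

(* D is a k-derivation of A that restricts to X on O; its k-linearity is
   implied, as X is k-linear. *)
Record lifts (X : O -> O) (D : family_coef -> family_coef) : Prop := Lifts {
  lifts_stable : forall f, in_A f -> in_A (D f);
  lifts_cst : forall a, D (cst_fun a) = cst_fun (X a);
  lifts_add : forall f g, in_A f -> in_A g ->
    D (fun p m => f p m + g p m) = fun p m => D f p m + D g p m;
  lifts_mul : forall f g, in_A f -> in_A g ->
    D (fun p => mul_coef (f p) (g p)) =
    fun p m => mul_coef (D f p) (g p) m + mul_coef (f p) (D g p) m }.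

(* d = (d_p)_p is the vertical part \sum_p d_p d/dt_p of D; the horizontal part
   acts by X on the coefficients and kills all t_p. *)
Definition vertical_part (X : O -> O) (D : family_coef -> family_coef)
    (d : family_coef) : Prop :=
  laurent d /\ forall f, in_A f ->
    D f = fun p m => X (f p m) + mul_coef (d p) (der_coef (f p)) m.

End LaurentExpansions.

Section ConformalBlocks.
Variables (k : numClosedFieldType) (g : lieAlgebra k) (B : g -> g -> k).
Variables (X : (\dim {:g}).-tuple g) (hc : k) (l n : nat).
Variable V : 'I_n -> gmodule g.

Definition pointed_reps (p : option 'I_n) : gmodule g :=
  if p is Some i then V i else trivial_gmodule g.

Definition ext_vec (v : forall i, V i) (p : option 'I_n) : pointed_reps p :=
  match p with Some i => v i | None => (1 : k^o) end.

Variable H : forall p, hwModule B l (pointed_reps p).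
Variables (O : comUnitAlgType k) (z : 'I_n -> O).

Definition VO : Type := tensor O (fun i => V i : lmodType k).
HB.instance Definition _ := GRing.Lmodule.on VO.
Definition HO : Type := tensor O (fun p => H p : lmodType k).
HB.instance Definition _ := GRing.Lmodule.on HO.

(* x t_p^m acting through the p-th factor *)
Definition mode_at (p : option 'I_n) (x : g) (m : int) : HO -> HO :=
  factor p (mode x m : H p -> H p).

Definition loop_act (x : g) (f : family_coef O n) (u : HO) : HO :=
  \sum_p \sum_(m \in [set: int]) f p m *: mode_at p x m u.

(* These elements span (g (x) A) H. *)
Inductive coinv_rel : HO -> Prop :=
  CoinvRel (x : g) (f : family_coef O n) (u : HO) :
    in_A z f -> coinv_rel (loop_act x f u).

Definition conf_blocks : Type := span_quot coinv_rel.
HB.instance Definition _ := GRing.Lmodule.on conf_blocks.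

Definition block (u : HO) : conf_blocks := span_proj coinv_rel u.

Definition incl : VO -> HO :=
  tlift (fun v => pure O (fun p => hw_emb (H p) (ext_vec v p)) : HO).

Definition natural_map (u : VO) : conf_blocks := block (incl u).

Definition normal_ordered (p : option 'I_n) (x y : g) (a b : int) (u : HO) : HO :=
  if a <= b then mode_at p x a (mode_at p y b u)
  else mode_at p y b (mode_at p x a u).

(* The operator T_g(d), d = \sum_p d_p d/dt_p: as
   <d_p d/dt_p, t_p^(-r-1) dt_p> = \sum_m d_(p,m) t_p^(m-r-1),
   the sum over p, kappa and r is expanded over m as well. *)
Definition sugawara (d : family_coef O n) (u : HO) : HO :=
  (- (2 * (l%:R + hc))^-1 : k)%:A *:
  \sum_p \sum_(m \in [set: int]) d p m *:
    \sum_(r \in [set: int]) \sum_(i < \dim {:g})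
      normal_ordered p (tnth X i) (tnth X i) (m - r - 1) r u.

(* nabla is the covariant derivative on conformal blocks induced by the lift
   D = (derY on coefficients) + d of the vector field derY. *)
Definition wzw_covariant (Y : O -> O) (d : family_coef O n)
    (nabla : conf_blocks -> conf_blocks) : Prop :=
  forall u : HO, nabla (block u) = block (tderiv Y u + sugawara d u).

Definition casimir (i j : 'I_n) (u : VO) : VO :=
  \sum_(r < \dim {:g})
    factor i (@gact _ _ (V i) (tnth X r))
      (factor j (@gact _ _ (V j) (tnth X r)) u).

(* The two expressions for the connection form, contracted with the vector
   field Y, so that dz_i becomes Y (z_i). *)
Definition kz_form (Y : O -> O) (u : VO) : VO :=
  ((l%:R + hc)^-1 : k)%:A *:
  \sum_(i < n) \sum_(j < n | j != i) (Y (z i) / (z j - z i)) *: casimir i j u.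

Definition kz_form' (Y : O -> O) (u : VO) : VO :=
  - (((l%:R + hc)^-1 : k)%:A *:
  \sum_(i < n) \sum_(j < n | (i < j)%N)
    (Y (z i - z j) / (z i - z j)) *: casimir i j u).

(* The connection with connection form w is d - w, so that its flat sections
   are the solutions of ds = w s.  This sign is forced by the Sugawara operator:
   for the lift of d/dz_i fixing z it acts on V_1 (x) ... (x) V_n through
   (l + hc)^-1 \sum_r (X_r t_i^-1) X_r at z_i, and as X_r (z - z_i)^-1 kills
   conformal blocks, X_r t_i^-1 at z_i acts there as
   - \sum_(j != i) (z_j - z_i)^-1 X_r at z_j. *)
Definition kz (Y : O -> O) (u : VO) : VO := tderiv Y u - kz_form Y u.

End ConformalBlocks.

(* Main.v *)
Require Import Defs.
From mathcomp Require Import all_boot all_order all_algebra.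
From mathcomp Require finmap monalg.
From mathcomp Require Import boolp classical_sets functions fsbigop.
From mathcomp Require Import reals complex.
From mathcomp Require Import spectral mxred.
From mathcomp Require Import zify ring.

Set Implicit Arguments.
Unset Strict Implicit.
Unset Printing Implicit Defensive.

Import Order.TTheory GRing.Theory Num.Theory.
Local Open Scope ring_scope.

(** The Segal-Sugawara operators T(d) satisfy [T(d), x f] = x (d f) on every
    smooth representation of level l, so that Y + T(d) preserves the relations
    defining the conformal blocks as soon as l + hc is invertible and f |-> Y f + d f
    preserves the algebra of functions.  If l + hc were 0, a strictly positive s
    would satisfy l B(e, f) = s for an sl2-like triple (e, h, f) with e ad-nilpotent,
    because e(-1) is nilpotent on the vacuum; then tr(ad h)^2 = -2 l B(h, h) < 0,
    although the eigenvalues of ad h are integers.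

    For surjectivity, a creation operator x(-m) at a point p is traded, on the
    blocks, for operators x(r), r >= 0, at the other points by means of the function
    (z - z_p)^-m, respectively z^m, which lowers the depth.

    On blocks of vectors killed by all x(m), m > 0, and by x(0) at infinity, the
    operator T(a d/dz) vanishes for a in the algebra of functions (expand a in partial
    fractions).  Hence all lifts of Y act alike, and for the lift with D z = 0 only
    the modes of degree -1 and 0 at z_i contribute, which gives the
    Knizhnik-Zamolodchikov form.  Flatness follows from the infinitesimal braid
    relations and Arnold's identity. *)

(** Sums over all integers are [fsbig] sums, which are 0 when the support is infinite. Every
    rearrangement therefore carries a proof of finite support, from two opposite bounds:
    coefficients of series vanish in low degrees, modes kill a given vector in high degrees.

    The hypotheses fix [hc] only as a Casimir eigenvalue, without a sign. The module at infinity has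
    a vacuum killed by all x(m), m >= 0, and its integrability is what excludes l + hc = 0.

    The vanishing of T(a d/dz) is a symmetry argument. On blocks it becomes a sum of A_ij c_ij,
    where c_ij is the Casimir element acting at z_i and z_j. As c_ij = c_ji, only A_ij + A_ji
    matters; it is 0 or of the form h_i + h_j, and the latter is absorbed by the relations sum_i
    c_ij = 0, which come from the constant function 1 and the trivial representation at infinity.
    All lifts thus give the same operator on blocks, and the scalar allowed by projectivity is 0. *)

(* [ring] does not apply to bare abelian groups; [zmod] compares the integer
   coefficients of the atoms, which [zmod_unify] identifies up to conversion. *)
Section AbelianGroupIdentities.

Inductive zexpr := ZVar of nat | ZZero | ZAdd of zexpr & zexpr | ZOpp of zexpr.

Fixpoint zeval (W : zmodType) (e : seq W) (t : zexpr) : W :=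
  match t with
  | ZVar i => nth 0 e i
  | ZZero => 0
  | ZAdd t1 t2 => zeval e t1 + zeval e t2
  | ZOpp t1 => - zeval e t1
  end.

Fixpoint zcoef (t : zexpr) (i : nat) : int :=
  match t with
  | ZVar j => (i == j)%:R
  | ZZero => 0
  | ZAdd t1 t2 => zcoef t1 i + zcoef t2 i
  | ZOpp t1 => - zcoef t1 i
  end.

Lemma zeval_coef (W : zmodType) (e : seq W) t :
  zeval e t = \sum_(i < size e) nth 0 e i *~ zcoef t i.
Proof.
elim: t => [j||t1 IH1 t2 IH2|t1 IH1] /=.
- have [je|ej] := ltnP j (size e).
    rewrite (bigD1 (Ordinal je))//= eqxx big1 ?addr0// => i.
    by rewrite -val_eqE/= => /negPf ->.
  rewrite nth_default// big1// => i _.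
  by rewrite ltn_eqF// (leq_trans (ltn_ord i)).
- by rewrite big1.
- by rewrite IH1 IH2 -big_split; apply: eq_bigr => i _; rewrite mulrzDr.
- by rewrite IH1 -sumrN; apply: eq_bigr => i _; rewrite mulrNz.
Qed.

Lemma zeval_eq (W : zmodType) (e : seq W) t1 t2 :
  all (fun i => zcoef t1 i == zcoef t2 i) (iota 0 (size e)) ->
  zeval e t1 = zeval e t2.
Proof.
move=> /allP E; rewrite !zeval_coef; apply: eq_bigr => i _.
by rewrite (eqP (E i _))// mem_iota/= ltn_ord.
Qed.

End AbelianGroupIdentities.

Ltac zmod_index same x e :=
  lazymatch e with
  | ?y :: ?e' =>
    match constr:(Set) with
    | _ => let _ := match constr:(Set) with _ => same x y end in constr:(0%N)
    | _ => let n := zmod_index same x e' in constr:(n.+1)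
    end
  end.

Ltac zmod_vars same t e :=
  lazymatch t with
  | @GRing.add _ ?a ?b => let e' := zmod_vars same a e in zmod_vars same b e'
  | @GRing.opp _ ?a => zmod_vars same a e
  | @GRing.zero _ => e
  | _ => match constr:(Set) with
         | _ => let _ := zmod_index same t e in e
         | _ => constr:(t :: e)
         end
  end.

Ltac zmod_expr same t e :=
  lazymatch t with
  | @GRing.add _ ?a ?b =>
    let a' := zmod_expr same a e in let b' := zmod_expr same b e in constr:(ZAdd a' b')
  | @GRing.opp _ ?a => let a' := zmod_expr same a e in constr:(ZOpp a')
  | @GRing.zero _ => constr:(ZZero)
  | _ => let n := zmod_index same t e in constr:(ZVar n)
  end.

Ltac zmod_with same :=
  lazymatch goal with
  | |- @eq ?T ?a ?b =>
    let e0 := zmod_vars same a (@nil T) in let e := zmod_vars same b e0 in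
    let a' := zmod_expr same a e in let b' := zmod_expr same b e in
    change (zeval e a' = zeval e b'); apply: zeval_eq; vm_compute; reflexivity
  end.

Tactic Notation "zmod" := zmod_with ltac:(fun x y => constr_eq x y).
Tactic Notation "zmod_unify" := zmod_with ltac:(fun x y => unify x y).

(** * Sums over the integers and their supports *)

Notation isum F := (\sum_(r \in [set: int]) F r).

Section IntegerSums.
Variable W : zmodType.
Implicit Types F G : int -> W.

Definition fin_supp F := exists r : seq int, forall m, m \notin r -> F m = 0.
Definition fin_supp2 (F : int -> int -> W) :=
  exists r : seq int, forall m s, (m \notin r) || (s \notin r) -> F m s = 0.

Lemma isumE (r : seq int) F : (forall m, m \notin r -> F m = 0) ->
  isum F = \sum_(m <- undup r) F m.
Proof.
move=> Fr; rewrite (fsbigE (undup r)) ?undup_uniq//.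
  by apply: eq_bigl => i; rewrite in_setT.
by move=> i _; rewrite mem_undup => /Fr.
Qed.

Lemma isum0 F : (forall m, F m = 0) -> isum F = 0.
Proof. by move=> F0; apply: fsbig1 => i _. Qed.

Lemma eq_isum F G : F =1 G -> isum F = isum G.
Proof. by move=> FG; apply: eq_fsbigr => i _. Qed.

Lemma isum1 m0 F : (forall m, m != m0 -> F m = 0) -> isum F = F m0.
Proof.
move=> F0; rewrite (@isumE [:: m0]) ?big_seq1//.
by move=> m; rewrite inE; apply: F0.
Qed.

Lemma isumD F G : fin_supp F -> fin_supp G ->
  isum (fun m => F m + G m) = isum F + isum G.
Proof.
move=> [r Fr] [r' Gr].
have Fr' m : m \notin r ++ r' -> F m = 0.
  by rewrite mem_cat negb_or => /andP[/Fr].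
have Gr' m : m \notin r ++ r' -> G m = 0.
  by rewrite mem_cat negb_or => /andP[_ /Gr].
rewrite (isumE Fr') (isumE Gr') -big_split/= -isumE// => m mr.
by rewrite Fr' ?Gr' ?addr0.
Qed.

Lemma isum_exchange (F : int -> int -> W) : fin_supp2 F ->
  isum (fun m => isum (F m)) = isum (fun s => isum (fun m => F m s)).
Proof.
move=> [r Fr].
have E m : isum (F m) = \sum_(s <- undup r) F m s.
  by apply: isumE => s sr; rewrite Fr// sr orbT.
have E' s : isum (F^~ s) = \sum_(m <- undup r) F m s.
  by apply: isumE => m mr; rewrite Fr// mr.
rewrite (eq_isum E) (eq_isum E') (@isumE r) => [|m mr]; last first.
  by rewrite big1// => s _; rewrite Fr// mr.
rewrite exchange_big (@isumE r)// => m mr.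
by rewrite big1// => s _; rewrite Fr// mr orbT.
Qed.

Lemma isum_shift c F : isum (fun m => F (m + c)) = isum F.
Proof.
rewrite [RHS](reindex_fsbigT (fun m => m + c))//.
by exists (fun m => m - c) => m; rewrite ?addrK ?subrK.
Qed.

Lemma isum_opp c F : isum (fun m => F (c - m)) = isum F.
Proof.
rewrite [RHS](reindex_fsbigT (fun m => c - m))//.
by exists (fun m => c - m) => m; rewrite opprB addrC subrK.
Qed.

Definition window (K : nat) : seq int := [seq i%:Z - K%:Z | i <- iota 0 K.*2].

Lemma notin_window K m : m \notin window K -> (m < - K%:Z) \/ (K%:Z <= m).
Proof.
move=> mK; have [|lo] := ltP m (- K%:Z); first by left.
right; rewrite leNgt; apply: contra mK => hi.
apply/mapP; exists (absz (m + K%:Z)); last by lia.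
by rewrite mem_iota; lia.
Qed.

Lemma fin_supp_bound a b F : (forall m, m < a -> F m = 0) ->
  (forall m, b <= m -> F m = 0) -> fin_supp F.
Proof.
move=> Fa Fb; exists (window (absz a + absz b)) => m /notin_window[] h.
  by apply: Fa; lia.
by apply: Fb; lia.
Qed.

Lemma fin_supp2_bound a b c e (F : int -> int -> W) :
  (forall m s, m < a -> F m s = 0) -> (forall m s, b <= m -> F m s = 0) ->
  (forall m s, s < c -> F m s = 0) -> (forall m s, e <= s -> F m s = 0) ->
  fin_supp2 F.
Proof.
move=> Fa Fb Fc Fe.
exists (window (absz a + absz b + (absz c + absz e))) => m s.
move=> /orP[] /notin_window[] h.
- by apply: Fa; lia.
- by apply: Fb; lia.
- by apply: Fc; lia.
- by apply: Fe; lia.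
Qed.

Lemma fin_suppD F G : fin_supp F -> fin_supp G -> fin_supp (fun m => F m + G m).
Proof.
move=> [r Fr] [r' Gr]; exists (r ++ r') => m.
by rewrite mem_cat negb_or => /andP[/Fr -> /Gr ->]; rewrite addr0.
Qed.

End IntegerSums.

Lemma isum_morph (W W' : zmodType) (f : W -> W') F : {morph f : x y / x + y} ->
  fin_supp F -> f (isum F) = isum (fun m => f (F m)).
Proof.
move=> fD [r Fr]; have f0 : f 0 = 0 by apply: (addrI (f 0)); rewrite -fD !addr0.
rewrite (isumE Fr) (big_morph f fD f0) (isumE (r := r))// => m /Fr ->//.
Qed.

Lemma fin_supp_morph (W W' : zmodType) (f : W -> W') F : f 0 = 0 ->
  fin_supp F -> fin_supp (fun m => f (F m)).
Proof. by move=> f0 [r Fr]; exists r => m /Fr ->. Qed.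

(** * Laurent series over a commutative algebra *)

Section LaurentAlgebra.
Variables (k : fieldType) (O : comUnitAlgType k).
Implicit Types f g h : int -> O.

Definition lbounded f := exists m0 : int, forall m, m < m0 -> f m = 0.

Lemma mul_coef_bound a b f g : (forall m, m < a -> f m = 0) ->
  (forall m, m < b -> g m = 0) -> forall m, m < a + b -> mul_coef f g m = 0.
Proof.
move=> fa gb m mab; apply: isum0 => r.
have [ra|ra] := ltP r a; first by rewrite fa ?mul0r.
by rewrite gb ?mulr0//; lia.
Qed.

Lemma mul_coef_fin f g m : lbounded f -> lbounded g ->
  fin_supp (fun r => f r * g (m - r)).
Proof.
move=> [a fa] [b gb]; apply: (@fin_supp_bound _ a (m - b + 1)) => r rb.
  by rewrite fa ?mul0r.
by rewrite gb ?mulr0//; lia.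
Qed.

Lemma lboundedM f g : lbounded f -> lbounded g -> lbounded (mul_coef f g).
Proof. by move=> [a fa] [b gb]; exists (a + b); apply: mul_coef_bound. Qed.

Lemma lboundedD f g : lbounded f -> lbounded g -> lbounded (fun m => f m + g m).
Proof.
move=> [a fa] [b gb]; exists (Order.min a b) => m; rewrite lt_min => /andP[? ?].
by rewrite fa ?gb ?addr0.
Qed.

Lemma lbounded_map (F : O -> O) f : F 0 = 0 -> lbounded f ->
  lbounded (fun m => F (f m)).
Proof. by move=> F0 [a fa]; exists a => m /fa ->. Qed.

Lemma lbounded_der f : lbounded f -> lbounded (der_coef f).
Proof.
by move=> [a fa]; exists (a - 1) => m ma; rewrite /der_coef fa ?mulr0//; lia.
Qed.

Lemma mul_coefC f g : mul_coef f g = mul_coef g f.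
Proof.
apply/funext => m; rewrite /mul_coef -(isum_opp m); apply: eq_isum => r.
by rewrite mulrC; congr (g _ * _); rewrite opprB addrC subrK.
Qed.

Lemma mul_coefDl f g h : lbounded f -> lbounded g -> lbounded h ->
  mul_coef (fun m => f m + g m) h = fun m => mul_coef f h m + mul_coef g h m.
Proof.
move=> bf bg bh; apply/funext => m; rewrite /mul_coef -isumD; last first.
- exact: mul_coef_fin.
- exact: mul_coef_fin.
by apply: eq_isum => r; rewrite mulrDl.
Qed.

Lemma mul_coefDr f g h : lbounded f -> lbounded g -> lbounded h ->
  mul_coef h (fun m => f m + g m) = fun m => mul_coef h f m + mul_coef h g m.
Proof. by move=> *; rewrite mul_coefC mul_coefDl// !(mul_coefC h). Qed.

Lemma mul_coefA f g h : lbounded f -> lbounded g -> lbounded h ->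
  mul_coef (mul_coef f g) h = mul_coef f (mul_coef g h).
Proof.
move=> bf bg bh; have [a fa] := bf; have [b gb] := bg; have [c hc] := bh.
apply/funext => m; transitivity
  (isum (fun r => isum (fun q => f q * g (r - q) * h (m - r)))).
  apply: eq_isum => r; rewrite (isum_morph (f := fun x => x * h (m - r)))//.
    by move=> x y; rewrite mulrDl.
  exact: mul_coef_fin.
rewrite isum_exchange.
  apply: eq_isum => q; rewrite (isum_morph (f := fun x => f q * x)).
  - rewrite -[LHS](isum_shift q); apply: eq_isum => r.
    by rewrite addrK mulrA; congr (_ * h _); rewrite opprD addrA addrAC.
  - by move=> x y; rewrite mulrDr.
  - exact: mul_coef_fin.
(* The three lower bounds confine q to a <= q <= m - c - b and r to a + b <= r <= m - c. *)
apply: (@fin_supp2_bound _ (a + b) (m - c + 1) a (m - c - b + 1)) => r q H.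
- by have [/fa ->|?] := ltP q a; rewrite ?mul0r// [g _]gb ?(mulr0, mul0r)//; lia.
- by rewrite hc ?mulr0//; lia.
- by rewrite fa ?mul0r.
- have [?|?] := ltP (r - q) b; first by rewrite gb ?(mulr0, mul0r).
  by rewrite hc ?mulr0//; lia.
Qed.

Lemma mul_coef_delta a (c : O) f :
  mul_coef (fun m => if m == a then c else 0) f = fun m => c * f (m - a).
Proof.
apply/funext => m; rewrite /mul_coef (@isum1 _ a) ?eqxx// => r /negPf ->.
by rewrite mul0r.
Qed.

(** The factor m + 1 is the sum of the exponents r and m + 1 - r of the two factors. *)
Lemma der_coefM f g : lbounded f -> lbounded g ->
  der_coef (mul_coef f g) =
  fun m => mul_coef (der_coef f) g m + mul_coef f (der_coef g) m.
Proof.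
move=> bf bg; apply/funext => m; rewrite /der_coef.
rewrite [X in _ = X + _](_ : _ = isum (fun r => r%:~R * f r * g (m + 1 - r))); last first.
  rewrite -[RHS](isum_shift 1); apply: eq_isum => r.
  by congr (_ * g _); lia.
rewrite {1}/mul_coef (isum_morph (f := fun x => (m + 1)%:~R * x)); last first.
- exact: mul_coef_fin.
- by move=> x y; rewrite mulrDr.
rewrite /mul_coef -isumD; last first.
- case: (@mul_coef_fin f (der_coef g) m) => //; first exact: lbounded_der.
  by move=> r hr; exists r.
- case: (@mul_coef_fin f g (m + 1)) => // r hr; exists r => s /hr e.
  by rewrite -mulrA e mulr0.
apply: eq_isum => r; have -> : m - r + 1 = m + 1 - r by lia.
have -> : (m + 1)%:~R = r%:~R + (m + 1 - r)%:~R :> O.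
  by rewrite -intrD; congr (_%:~R); lia.
by rewrite mulrDl !mulrA mulrAC; congr (_ + _); rewrite [LHS]mulrAC [in LHS]mulrC mulrA.
Qed.

End LaurentAlgebra.

(** * Invariant forms *)

Section InvariantForm.
Variables (k : numClosedFieldType) (g : lieAlgebra k).
Variables (B : g -> g -> k) (X : (\dim {:g}).-tuple g).
Hypotheses (invB : invariant_form B) (orthX : orthonormal_basis B X).

Lemma form_linl a x y z : B (a *: x + y) z = a * B x z + B y z.
Proof. by case: invB. Qed.

Lemma formC x y : B x y = B y x.
Proof. by case: invB. Qed.

Lemma form_lie x y z : B (lie x y) z = B x (lie y z).
Proof. by case: invB. Qed.

Lemma form_linr a x y z : B z (a *: x + y) = a * B z x + B z y.
Proof. by rewrite formC form_linl !(formC z). Qed.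

Lemma form0l x : B 0 x = 0.
Proof.
by have := form_linl (-1) 0 0 x; rewrite scaler0 addr0 mulN1r addNr.
Qed.

Lemma form_addl x y z : B (x + y) z = B x z + B y z.
Proof. by rewrite -{1}[x]scale1r form_linl mul1r. Qed.

Lemma form_scalel a x z : B (a *: x) z = a * B x z.
Proof. by rewrite -[a *: x]addr0 form_linl form0l addr0. Qed.

Lemma form_scaler a x z : B z (a *: x) = a * B z x.
Proof. by rewrite formC form_scalel formC. Qed.

Lemma form_oppl x z : B (- x) z = - B x z.
Proof. by rewrite -scaleN1r form_scalel mulN1r. Qed.

Lemma form_suml (I : finType) (f : I -> g) z :
  B (\sum_i f i) z = \sum_i B (f i) z.
Proof. by apply: (big_morph (B^~ z)) => [x y|]; rewrite ?form_addl ?form0l. Qed.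

Lemma form_coord y i : B y (tnth X i) = coord X i y.
Proof.
have [bX oX] := orthX.
rewrite {1}(coord_basis bX (memvf y)) form_suml (bigD1 i)//= form_scalel.
rewrite -tnth_nth oX eqxx mulr1 big1 ?addr0// => j ji.
by rewrite form_scalel -tnth_nth oX (negPf ji) mulr0.
Qed.

Lemma orthonormal_sum y : y = \sum_i B y (tnth X i) *: tnth X i.
Proof.
have [bX _] := orthX; rewrite {1}(coord_basis bX (memvf y)).
by apply: eq_bigr => i _; rewrite form_coord -tnth_nth.
Qed.

Lemma form_nondegenerate x y : (forall z, B z x = B z y) -> x = y.
Proof.
move=> xy; rewrite (orthonormal_sum x) (orthonormal_sum y).
by apply: eq_bigr => i _; rewrite formC xy formC.
Qed.

(* [lieDl] and [liexx] alone do not make the bracket linear on the right. *)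
Lemma lieDr a (x y z : g) : lie z (a *: x + y) = a *: lie z x + lie z y.
Proof.
by apply: form_nondegenerate => w; rewrite form_linr -!form_lie form_linr.
Qed.

Lemma lie_addl (x y z : g) : lie (x + y) z = lie x z + lie y z.
Proof. by rewrite -[x]scale1r lieDl !scale1r. Qed.

Lemma lie_addr (x y z : g) : lie z (x + y) = lie z x + lie z y.
Proof. by rewrite -[x]scale1r lieDr !scale1r. Qed.

Lemma lie0l (x : g) : lie 0 x = 0.
Proof. by have := lieDl (-1) 0 0 x; rewrite scaler0 addr0 scaleN1r addNr. Qed.

Lemma lie0r (x : g) : lie x 0 = 0.
Proof. by have := lieDr (-1) 0 0 x; rewrite scaler0 addr0 scaleN1r addNr. Qed.

Lemma lie_scalel a (x y : g) : lie (a *: x) y = a *: lie x y.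
Proof. by rewrite -[a *: x]addr0 lieDl lie0l addr0. Qed.

Lemma lie_scaler a (x y : g) : lie x (a *: y) = a *: lie x y.
Proof. by rewrite -[a *: y]addr0 lieDr lie0r addr0. Qed.

Lemma lieC (x y : g) : lie x y = - lie y x.
Proof.
have := liexx (x + y); rewrite lie_addl !lie_addr !liexx addr0 add0r.
by move/eqP; rewrite addr_eq0 => /eqP.
Qed.

Lemma lie_oppr (x y : g) : lie x (- y) = - lie x y.
Proof. by rewrite -scaleN1r lie_scaler scaleN1r. Qed.

Lemma lie_jacobi (x y z : g) :
  lie (lie x y) z = lie x (lie y z) - lie y (lie x z).
Proof.
have := lieJ x y z; rewrite (lieC z (lie x y)) (lieC z x) lie_oppr.
by move/eqP; rewrite subr_eq0 => /eqP.
Qed.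

Section Invariance.
Variables (O : comAlgType k) (W : lmodType O) (Phi : g -> g -> W).
Hypothesis Phil :
  forall a x y z, Phi (a *: x + y) z = a%:A *: Phi x z + Phi y z.
Hypothesis Phir :
  forall a x y z, Phi z (a *: x + y) = a%:A *: Phi z x + Phi z y.

Let Phi_suml (I : finType) (c : I -> k) (f : I -> g) z :
  Phi (\sum_i c i *: f i) z = \sum_i (c i)%:A *: Phi (f i) z.
Proof.
have Phi0 : Phi 0 z = 0.
  by have := Phil (-1) 0 0 z; rewrite scaler0 addr0 scaleN1r scaleN1r addNr.
elim/big_rec2: _ => // i w1 w2 _ <-; exact: Phil.
Qed.

Let Phi_sumr (I : finType) (c : I -> k) (f : I -> g) z :
  Phi z (\sum_i c i *: f i) = \sum_i (c i)%:A *: Phi z (f i).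
Proof.
have Phi0 : Phi z 0 = 0.
  by have := Phir (-1) 0 0 z; rewrite scaler0 addr0 scaleN1r scaleN1r addNr.
elim/big_rec2: _ => // i w1 w2 _ <-; exact: Phir.
Qed.

(** The Casimir element is invariant because the coefficients B([X_i, y], X_j) are antisymmetric in
    i and j. An arbitrary bilinear [Phi] covers pairs of modes as well as pairs of tensor
    factors. *)
Lemma casimir_invariant y :
  \sum_i Phi (lie (tnth X i) y) (tnth X i) =
  - \sum_i Phi (tnth X i) (lie (tnth X i) y).
Proof.
under eq_bigr => i _ do rewrite (orthonormal_sum (lie _ y)) Phi_suml.
under [in RHS]eq_bigr => i _ do
  rewrite (orthonormal_sum (lie _ y)) Phi_sumr.
rewrite exchange_big -sumrN; apply: eq_bigr => i _.
rewrite -sumrN; apply: eq_bigr => j _.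
rewrite -scaleNr -scaleNr; congr (_ %:A *: _).
by rewrite form_lie lieC formC form_oppl.
Qed.

End Invariance.

End InvariantForm.

Lemma uniform_bound (P : int -> int -> Prop) (r : seq int) :
  (forall s, exists b, forall m, b <= m -> P s m) ->
  exists b, forall s m, s \in r -> b <= m -> P s m.
Proof.
move=> Pb; elim: r => [|s r [b IH]]; first by exists 0.
have [b' Hb'] := Pb s; exists (Order.max b b') => s' m.
by rewrite inE ge_max => /orP[/eqP -> /andP[_ /Hb']//|/IH h /andP[/h]].
Qed.

Lemma int_progression (W : zmodType) (f : int -> W) (K : W) :
  (forall j, f (j + 1) = f j + K) -> forall j, f j = f 0 + K *~ j.
Proof.
move=> fS; elim/int_rect => [|j IH|j IH]; first by rewrite mulr0z addr0.
  by rewrite -addn1 PoszD fS IH mulrzDr mulr1z addrA.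
apply: (addIr K); rewrite -fS -addn1 PoszD opprD subrK IH.
by rewrite mulrzBr mulr1z -addrA subrK.
Qed.

(** * Sugawara operators *)

Section AffineAction.
Variables (k : numClosedFieldType) (g : lieAlgebra k) (B : g -> g -> k).
Variables (l : nat) (O : comUnitAlgType k) (W : lmodType O).

(** The smooth representations of level l, linear over [O]. The Sugawara calculus is done for this
    abstract action; tensor products enter it through [mode_at_affine] and [mode_at_commute]. *)
Record affine_action (M : g -> int -> W -> W) : Prop := AffineAction {
  act_linl : forall a x y m u,
    M (a *: x + y) m u = a%:A *: M x m u + M y m u;
  act_linr : forall a x m u v, M x m (a *: u + v) = a *: M x m u + M x m v;
  act_comm : forall x y m p u,
    M x m (M y p u) - M y p (M x m u) =
    M (lie x y) (m + p) u + (m%:~R * (m + p == 0)%:R * B x y * l%:R)%:A *: u;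
  act_smooth : forall u, exists m0, forall x m, m0 <= m -> M x m u = 0 }.

Variable M : g -> int -> W -> W.
Hypothesis affM : affine_action M.

Let Ml := act_linl affM.
Let Mr := act_linr affM.

Lemma act0r x m : M x m 0 = 0.
Proof. by have := Mr (-1) x m 0 0; rewrite scaler0 addr0 scaleN1r addNr. Qed.

Lemma act0l m u : M 0 m u = 0.
Proof. by have := Ml (-1) 0 0 m u; rewrite scaler0 addr0 scaleN1r scaleN1r addNr. Qed.

Lemma actD x m u v : M x m (u + v) = M x m u + M x m v.
Proof. by rewrite -[u]scale1r Mr !scale1r. Qed.

Lemma actZ a x m u : M x m (a *: u) = a *: M x m u.
Proof. by rewrite -[a *: u]addr0 Mr act0r addr0. Qed.

Lemma act_scalel a x m u : M (a *: x) m u = a%:A *: M x m u.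
Proof. by rewrite -[a *: x]addr0 Ml act0l addr0. Qed.

Lemma act_addl x y m u : M (x + y) m u = M x m u + M y m u.
Proof. by rewrite -{1}[x]scale1r Ml scale1r scale1r. Qed.

Lemma act_sum (I : Type) (r : seq I) (P : pred I) (f : I -> W) x m :
  M x m (\sum_(i <- r | P i) f i) = \sum_(i <- r | P i) M x m (f i).
Proof. by apply: (big_morph (M x m)) => [u v|]; rewrite ?actD ?act0r. Qed.

Lemma act_suml (I : finType) (f : I -> g) m u :
  M (\sum_i f i) m u = \sum_i M (f i) m u.
Proof.
by apply: (big_morph (fun x => M x m u)) => [x y|]; rewrite ?act_addl ?act0l.
Qed.

Lemma act_commD x y m p u : M x m (M y p u) = M y p (M x m u) +
    M (lie x y) (m + p) u + (m%:~R * (m + p == 0)%:R * B x y * l%:R)%:A *: u.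
Proof. by rewrite -addrA -(act_comm affM) addrC subrK. Qed.

Definition loop (x : g) (f : int -> O) (u : W) : W :=
  isum (fun m => f m *: M x m u).

Lemma loop_fin x f u : lbounded f -> fin_supp (fun m => f m *: M x m u).
Proof.
move=> [a fa]; have [b ub] := act_smooth affM u.
apply: (@fin_supp_bound _ a b) => m h; first by rewrite fa ?scale0r.
by rewrite ub ?scaler0.
Qed.

Lemma loop_addr x f u v : lbounded f -> loop x f (u + v) = loop x f u + loop x f v.
Proof.
move=> fb; rewrite /loop -isumD; try exact: loop_fin.
by apply: eq_isum => m; rewrite actD scalerDr.
Qed.

Lemma loop_scaler a x f u : lbounded f -> loop x f (a *: u) = a *: loop x f u.
Proof.
move=> fb; rewrite /loop (isum_morph (f := fun v => a *: v)).
- by apply: eq_isum => m; rewrite actZ !scalerA mulrC.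
- by move=> v w; rewrite scalerDr.
- exact: loop_fin.
Qed.

Section Sugawara.
Variables (X : (\dim {:g}).-tuple g) (hc : k).
Hypotheses (invB : invariant_form B) (orthX : orthonormal_basis B X).
Hypothesis coxX : dual_coxeter X hc.

Definition normal_order (x y : g) (a b : int) (u : W) : W :=
  if a <= b then M x a (M y b u) else M y b (M x a u).

Definition nord (N r : int) (u : W) : W :=
  \sum_i normal_order (tnth X i) (tnth X i) (N - r - 1) r u.

(** This is 2 (l + hc) L_(N-1) for the Sugawara operators L_n of the Virasoro algebra, of degree N -
    1. *)
Definition quad (N : int) (u : W) : W := isum (fun r => nord N r u).

Lemma nordP a N r u v : nord N r (a *: u + v) = a *: nord N r u + nord N r v.
Proof.
rewrite /nord scaler_sumr -big_split; apply: eq_bigr => i _.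
by rewrite /normal_order; case: ifP => _; rewrite !Mr.
Qed.

Lemma nord0 N r : nord N r 0 = 0.
Proof. by have := nordP (-1) N r 0 0; rewrite scaler0 addr0 scaleN1r addNr. Qed.

Lemma nord_bound u (b : int) : (forall x m, b <= m -> M x m u = 0) ->
  forall N r, (b <= N - r - 1) || (b <= r) -> nord N r u = 0.
Proof.
move=> ub N r h; apply: big1 => i _; rewrite /normal_order.
have [le|lt] := leP (N - r - 1) r.
  by rewrite (ub _ r) ?act0r//; lia.
by rewrite (ub _ (N - r - 1)) ?act0r//; lia.
Qed.

Lemma nord_fin N u : fin_supp (fun r => nord N r u).
Proof.
have [b ub] := act_smooth affM u.
by apply: (@fin_supp_bound _ (N - 1 - b) b) => r h; apply: (nord_bound ub); lia.
Qed.

Lemma quadD N u v : quad N (u + v) = quad N u + quad N v.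
Proof.
rewrite /quad -isumD; try exact: nord_fin.
by apply: eq_isum => r; rewrite -{1}[u]scale1r nordP scale1r.
Qed.

Lemma quadZ N a u : quad N (a *: u) = a *: quad N u.
Proof.
rewrite /quad (isum_morph (f := fun v => a *: v)).
- by apply: eq_isum => r; rewrite -[a *: u]addr0 nordP nord0 addr0.
- by move=> v w; rewrite scalerDr.
- exact: nord_fin.
Qed.

Lemma quad0 N : quad N 0 = 0.
Proof. by apply: isum0 => r; rewrite nord0. Qed.

Lemma quad_bound u (b : int) : (forall x m, b <= m -> M x m u = 0) ->
  forall N, 2 * b <= N -> quad N u = 0.
Proof.
by move=> ub N h; apply: isum0 => r; apply: (nord_bound ub); lia.
Qed.

(* [psi] vanishes for large indices only, so that only its upper tails are finite
   sums: normal ordering turns the commutator into differences of such tails, and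
   [gap] compares the shifted ones. *)
Section Commutator.
Variables (N s : int) (y : g) (u : W).

Let Psi (a b : int) := \sum_i M (tnth X i) a (M (lie (tnth X i) y) b u).
Let psi (c : int) := Psi (N - 1 + s - c) c.

Let Psi_swap (a b : int) : \sum_i M (lie (tnth X i) y) a (M (tnth X i) b u) = - Psi a b.
Proof.
apply: (casimir_invariant invB orthX (Phi := fun x z => M x a (M z b u))).
  by move=> c x x' z; rewrite Ml.
by move=> c x x' z; rewrite Ml Mr.
Qed.

Let form_y : \sum_i (B (tnth X i) y) *: tnth X i = y.
Proof.
rewrite [RHS](orthonormal_sum invB orthX); apply: eq_bigr => i _.
by rewrite (formC invB).
Qed.

Let anom (a b : int) : W := (b%:~R * (b + s == 0)%:R * l%:R)%:A *: M y a u.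

(** When a + b = N - 1, the two [Psi] terms are the values of [psi] at b + s and at b, so that the
    sum over r telescopes. *)
Let pair_comm (a b : int) :
  \sum_i (M (tnth X i) a (M (tnth X i) b (M y s u)) -
          M y s (M (tnth X i) a (M (tnth X i) b u))) =
  Psi a (b + s) - Psi (a + s) b + (anom a b + anom b a).
Proof.
rewrite -[- Psi _ _]Psi_swap.
have -> : anom a b = \sum_i
    (b%:~R * (b + s == 0)%:R * B (tnth X i) y * l%:R)%:A *: M (tnth X i) a u.
  rewrite /anom -[in LHS]form_y act_suml scaler_sumr; apply: eq_bigr => i _.
  by rewrite act_scalel scalerA -scalerAl mul1r scalerA; congr (_ *: _); congr (_ *: _); ring.
have -> : anom b a = \sum_i
    (a%:~R * (a + s == 0)%:R * B (tnth X i) y * l%:R)%:A *: M (tnth X i) b u.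
  rewrite /anom -[in LHS]form_y act_suml scaler_sumr; apply: eq_bigr => i _.
  by rewrite act_scalel scalerA -scalerAl mul1r scalerA; congr (_ *: _); congr (_ *: _); ring.
rewrite -!big_split/=; apply: eq_bigr => i _; set x := tnth X i.
rewrite (act_commD x y b s u) !actD actZ (act_commD x y a s (M x b u)).
set A := M y s _; set P1 := M x a (M (lie x y) _ u); set P2 := M (lie x y) _ _.
set P3 := _ *: M x a u; set P4 := _ *: M x b u.
zmod.
Qed.

Let psi_bound : exists b : int, forall c, b <= c -> psi c = 0.
Proof.
have [b ub] := act_smooth affM u; exists b => c bc.
by apply: big1 => i _; rewrite ub ?act0r.
Qed.

Let tail_fin (d : int) : fin_supp (fun c => if d <= c then psi c else 0).
Proof.
have [b pb] := psi_bound; apply: (@fin_supp_bound _ d b) => c h.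
  by rewrite leNgt h.
by rewrite pb ?if_same.
Qed.

Let tail (d : int) := isum (fun c => if d <= c then psi c else 0).

Let tailS (d : int) : tail d = psi d + tail (d + 1).
Proof.
have -> : psi d = isum (fun c => if c == d then psi c else 0).
  by rewrite (@isum1 _ d) ?eqxx// => c /negPf ->.
rewrite /tail -isumD; last exact: tail_fin.
  apply: eq_isum => c; have -> : (d <= c) = (c == d) || (d + 1 <= c) by lia.
  by have [->|_] := eqVneq c d; rewrite ?add0r// ifF ?addr0//; lia.
by exists [:: d] => c; rewrite inE => /negPf ->.
Qed.

Let K := (2 * hc)%:A *: M y (N - 1 + s) u.

(** Here the dual Coxeter number enters. By [Psi_swap] the left side is the sum over i of the
    commutators of X_i(N-1+s-c) with [X_i, y](c), whose central terms vanish because B(X_i,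
    [X_i, y]) = B([X_i, X_i], y). *)
Let psi_sym (c : int) : psi c + psi (N - 1 + s - c) = K.
Proof.
have e : N - 1 + s - (N - 1 + s - c) = c by lia.
rewrite {2}/psi e -[Psi c _]opprK -Psi_swap -sumrN -big_split/=.
under eq_bigr => i _ do rewrite (act_comm affM).
rewrite big_split/= addrC big1 ?add0r => [|i _]; last first.
  by rewrite -(form_lie invB) liexx (form0l invB) mulr0 mul0r scale0r scale0r.
rewrite -act_suml coxX.
by rewrite subrK act_scalel.
Qed.

(** Raising j by one removes [psi (c0 + j)] from the first tail and adds its mirror value to the
    second, a change of -K by [psi_sym]. The progression runs over all integers, so that the sign of
    s makes no difference. *)
Let gap (j c0 : int) : tail (c0 + j) - tail (N - c0 + s - j) =
  tail c0 - tail (N - c0 + s) - K *~ j.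
Proof.
rewrite (@int_progression _ (fun j => tail (c0 + j) - tail (N - c0 + s - j)) (- K)).
  by rewrite addr0 subr0 mulNrz.
move=> i; rewrite [c0 + (i + 1)]addrA -(psi_sym (c0 + i)) [tail (c0 + i)]tailS.
rewrite [tail (N - c0 + s - (i + 1))]tailS.
rewrite (_ : N - c0 + s - (i + 1) + 1 = N - c0 + s - i); last by lia.
rewrite (_ : N - 1 + s - (c0 + i) = N - c0 + s - (i + 1)); last by lia.
zmod_unify.
Qed.

(** The thresholds are the two roundings of N / 2, downwards for [true] and upwards for [false];
    their sum is N. *)
Let halves (c : bool) : exists c0 : int, forall r : int,
  (c0 <= r) = (if c then N - r - 1 <= r else N - r - 1 < r).
Proof. by exists ((N + ~~ c) %/ 2)%Z => r; case: c; lia. Qed.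

(** The half of the sum where normal ordering exchanges the modes is reindexed by r -> N - 1 - r,
    which turns N - r - 1 > r into N - r - 1 < r. *)
Let sector (c : bool) (r : int) : W :=
  if (if c then N - r - 1 <= r else N - r - 1 < r) then psi (r + s) - psi r else 0.

Let sectorE (c : bool) (c0 : int) :
  (forall r : int, (c0 <= r) = (if c then N - r - 1 <= r else N - r - 1 < r)) ->
  isum (sector c) = tail (c0 + s) - tail c0 /\ fin_supp (sector c).
Proof.
move=> H; have [b pb] := psi_bound.
have F1 : fin_supp (fun r => if c0 + s <= r + s then psi (r + s) else 0).
  apply: (@fin_supp_bound _ c0 (b - s)) => r h; first by rewrite ifF//; lia.
  by rewrite pb ?if_same//; lia.
have F2 : fin_supp (fun r => - (if c0 <= r then psi r else 0)).
  by apply: fin_supp_morph (tail_fin c0); rewrite oppr0.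
have E r : sector c r = (if c0 + s <= r + s then psi (r + s) else 0) +
    - (if c0 <= r then psi r else 0).
  by rewrite /sector -H lerD2r; case: ifP => _; rewrite ?subr0.
split; last by case: (fin_suppD F1 F2) => q hq; exists q => m /hq; rewrite E.
rewrite (eq_isum E) isumD// (isum_shift s (fun r => if c0 + s <= r then psi r else 0)).
congr (_ + _); rewrite -(isum_morph (f := -%R))//.
by move=> ? ?; rewrite opprD.
Qed.

Let sector_sum : isum (sector true) + isum (sector false) = - (K *~ s).
Proof.
have [c0 H0] := halves true; have [c1 H1] := halves false.
have [-> _] := sectorE (c := true) H0; have [-> _] := sectorE (c := false) H1.
have := gap s c0; have c01 : N - c0 = c1.
  have := H0 c0; have := H1 c1; have := H0 (c0 - 1); have := H1 (c1 - 1); lia.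
rewrite c01 (_ : c1 + s - s = c1); last by lia.
move/(congr1 (fun w => w - tail c0 + tail (c1 + s))) => E.
transitivity (tail (c0 + s) - tail c1 - tail c0 + tail (c1 + s)); first by zmod.
by rewrite E; zmod.
Qed.

Let anom_sum :
  [/\ isum (fun r => anom (N - r - 1) r) = - ((l%:R%:A *: M y (N - 1 + s) u) *~ s),
      isum (fun r => anom r (N - r - 1)) = - ((l%:R%:A *: M y (N - 1 + s) u) *~ s),
      fin_supp (fun r => anom (N - r - 1) r) & fin_supp (fun r => anom r (N - r - 1))].
Proof.
have F1 r : r != - s -> anom (N - r - 1) r = 0.
  by move=> rs; rewrite /anom addr_eq0 (negPf rs) mulr0 mul0r scale0r scale0r.
have F2 r : r != N - 1 + s -> anom r (N - r - 1) = 0.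
  move=> rs; rewrite /anom (_ : _ == 0 = false); last by apply: contraNF rs; lia.
  by rewrite mulr0 mul0r scale0r scale0r.
have E b a : b = - s -> a = N - 1 + s ->
    anom a b = - ((l%:R%:A *: M y (N - 1 + s) u) *~ s).
  move=> -> ->; rewrite /anom addNr eqxx mulr1 mulrNz mulNr !scaleNr.
  by rewrite mulrzl !scalerMzl.
split.
- by rewrite (isum1 F1); apply: E => //; lia.
- by rewrite (isum1 F2); apply: E => //; lia.
- by exists [:: - s] => r; rewrite inE => /F1.
- by exists [:: N - 1 + s] => r; rewrite inE => /F2.
Qed.

(** The two sectors together give -s 2 hc y(N-1+s), and each of the two families of central terms
    gives -s l y(N-1+s). *)
Lemma quad_comm : quad N (M y s u) - M y s (quad N u) =
  - (((2 * (l%:R + hc))%:A *: M y (N - 1 + s) u) *~ s).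
Proof.
have [A1 A2 fA1 fA2] := anom_sum.
have [c0 H0] := halves true; have [_ fs0] := sectorE (c := true) H0.
have [c1 H1] := halves false; have [_ fs1] := sectorE (c := false) H1.
have bij : isum (sector false) = isum (fun r => sector false (N - 1 - r)) by rewrite isum_opp.
have fs1' : fin_supp (fun r => sector false (N - 1 - r)).
  case: fs1 => q hq; exists [seq N - 1 - r | r <- q] => r hr; apply: hq.
  by apply: contra hr => hr; apply/mapP; exists (N - 1 - r) => //; lia.
have -> : quad N (M y s u) - M y s (quad N u) =
    isum (sector true) + isum (sector false) +
    (isum (fun r => anom (N - r - 1) r) + isum (fun r => anom r (N - r - 1))).
  rewrite bij -!isumD//; try exact: fin_suppD.
  rewrite /quad (isum_morph (f := M y s)); first last.
  - exact: nord_fin.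
  - by move=> v w; rewrite actD.
  have fM : fin_supp (fun r => M y s (nord N r u)).
    by apply: fin_supp_morph (nord_fin N u); rewrite act0r.
  rewrite (isum_morph (f := -%R)) => [|v w|//]; last by rewrite opprD.
  rewrite -isumD; [|exact: nord_fin|by apply: fin_supp_morph fM; rewrite oppr0].
  apply: eq_isum => r; rewrite /nord act_sum -sumrB /sector.
  have Psi_ext a a' b b' : a = a' -> b = b' -> Psi a b = Psi a' b' by move=> -> ->.
  have [le|gt] := leP (N - r - 1) r.
    rewrite ifF ?addr0; last by lia.
    under eq_bigr => i _ do rewrite /normal_order le.
    rewrite pair_comm; congr (_ - _ + _); apply: Psi_ext; lia.
  rewrite ifT ?add0r; last by lia.
  under eq_bigr => i _ do rewrite /normal_order leNgt gt/=.
  rewrite pair_comm [anom _ _ + _]addrC; congr (_ - _ + _); apply: Psi_ext; lia.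
rewrite sector_sum A1 A2 /K -!opprD -!mulrzDl -!scalerDl.
by congr (- (_ %:A *: _ *~ _)); ring.
Qed.

End Commutator.

Definition sug (d : int -> O) (u : W) : W := isum (fun m => d m *: quad m u).

Lemma sug_fin d u : lbounded d -> fin_supp (fun m => d m *: quad m u).
Proof.
move=> [a da]; have [b ub] := act_smooth affM u.
apply: (@fin_supp_bound _ a (2 * b)) => m h; first by rewrite da ?scale0r.
by rewrite (quad_bound ub) ?scaler0.
Qed.

Lemma sugD d u v : lbounded d -> sug d (u + v) = sug d u + sug d v.
Proof.
move=> db; rewrite /sug -isumD; try exact: sug_fin.
by apply: eq_isum => m; rewrite quadD scalerDr.
Qed.

Lemma sugZ d a u : lbounded d -> sug d (a *: u) = a *: sug d u.
Proof.
move=> db; rewrite /sug (isum_morph (f := fun v => a *: v)).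
- by apply: eq_isum => m; rewrite quadZ !scalerA mulrC.
- by move=> v w; rewrite scalerDr.
- exact: sug_fin.
Qed.

(** This is [quad_comm] summed against the coefficients of d and f; exchanging the two sums requires
    supports that are bounded in both indices at once. *)
Lemma sug_loop d f y u : lbounded d -> lbounded f ->
  sug d (loop y f u) - loop y f (sug d u) =
  - ((2 * (l%:R + hc))%:A *: loop y (mul_coef d (der_coef f)) u).
Proof.
move=> db fb; have [a da] := db; have [c fc] := fb.
have [e ue] := act_smooth affM u.
(* Smoothness bounds m for each s separately. Only s in [c, e) can give nonzero terms, and the bound
   is made uniform over a window containing this interval. *)
have [b qb] : exists b : int, forall s m, s \in window (absz c + absz e) -> b <= m ->
    quad m (M y s u) = 0.
  apply: (uniform_bound (P := fun s m => quad m (M y s u) = 0)) => s.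
  have [b ub] := act_smooth affM (M y s u).
  by exists (2 * b) => m hm; apply: (quad_bound ub).
have [e' qe'] : exists e' : int, forall m s, m \in window (absz a + absz (2 * e)) -> e' <= s ->
    M y s (quad m u) = 0.
  apply: (uniform_bound (P := fun m s => M y s (quad m u) = 0)) => m.
  by have [b' ub'] := act_smooth affM (quad m u); exists b' => s; apply: ub'.
pose F m s := (d m * f s) *: quad m (M y s u).
pose G m s := (d m * f s) *: M y s (quad m u).
pose K s m := (d m * f s) *: ((2 * (l%:R + hc))%:A *: (M y (m - 1 + s) u *~ s)).
have F0 m s : m < a -> F m s = 0 by move=> h; rewrite /F da ?mul0r ?scale0r.
have F0' m s : s < c -> F m s = 0 by move=> h; rewrite /F fc ?mulr0 ?scale0r.
have G0 m s : m < a -> G m s = 0 by move=> h; rewrite /G da ?mul0r ?scale0r.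
have G0' m s : s < c -> G m s = 0 by move=> h; rewrite /G fc ?mulr0 ?scale0r.
have F1 m s : b <= m -> F m s = 0.
  move=> h; have [sw|/notin_window[h'|h']] := boolP (s \in window (absz c + absz e)).
  - by rewrite /F qb ?scaler0.
  - by apply: F0'; lia.
  - by rewrite /F ue ?quad0 ?scaler0//; lia.
have F1' m s : e <= s -> F m s = 0 by move=> h; rewrite /F ue// quad0 scaler0.
have G1' m s : e' <= s -> G m s = 0.
  move=> h; have [mw|/notin_window[h'|h']] := boolP (m \in window (absz a + absz (2 * e))).
  - by rewrite /G qe' ?scaler0.
  - by apply: G0; lia.
  - by rewrite /G (quad_bound ue) ?act0r ?scaler0//; lia.
have G1 m s : 2 * e <= m -> G m s = 0.
  by move=> h; rewrite /G (quad_bound ue)// act0r scaler0.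
have finF : fin_supp2 F by apply: (@fin_supp2_bound _ a b c e).
have finG : fin_supp2 G by apply: (@fin_supp2_bound _ a (2 * e) c e').
have sF m : fin_supp (F m) by case: finF => r hr; exists r => s sr; rewrite hr// sr orbT.
have sG m : fin_supp (G m) by case: finG => r hr; exists r => s sr; rewrite hr// sr orbT.
have sF' : fin_supp (fun m => isum (F m)).
  by case: finF => r hr; exists r => m mr; apply: isum0 => s; rewrite hr// mr.
have sG' : fin_supp (fun m => isum (G m)).
  by case: finG => r hr; exists r => m mr; apply: isum0 => s; rewrite hr// mr.
have -> : sug d (loop y f u) = isum (fun m => isum (F m)).
  apply: eq_isum => m; rewrite /loop (isum_morph (f := fun v => d m *: quad m v)).
  - by apply: eq_isum => s; rewrite quadZ scalerA.
  - by move=> v w; rewrite quadD scalerDr.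
  - exact: loop_fin.
have -> : loop y f (sug d u) = isum (fun m => isum (G m)).
  rewrite isum_exchange//; apply: eq_isum => s.
  rewrite /sug (isum_morph (f := fun v => f s *: M y s v)).
  - by apply: eq_isum => m; rewrite actZ scalerA mulrC.
  - by move=> v w; rewrite actD scalerDr.
  - exact: sug_fin.
have NG m : fin_supp (fun s => - G m s) by apply: fin_supp_morph (sG m); rewrite oppr0.
have NG' : fin_supp (fun m => - isum (G m)) by apply: fin_supp_morph sG'; rewrite oppr0.
rewrite (isum_morph (f := -%R)) => [|v w|//]; last by rewrite opprD.
rewrite -isumD//.
transitivity (- isum (fun m => isum (fun s => K s m))).
  have oppD : {morph (-%R : W -> W) : x y / x + y} by move=> v w; rewrite opprD.
  have E m s : F m s + - G m s = - K s m.
    rewrite /F /G /K -scalerBr quad_comm -scalerN; congr (_ *: _).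
    by rewrite scalerMzr.
  have fK m : fin_supp (fun s => K s m).
    have [r hr] := fin_suppD (sF m) (NG m); exists r => s /hr /eqP.
    by rewrite E oppr_eq0 => /eqP.
  rewrite [RHS](isum_morph (f := -%R))//; last first.
    have [r hr] := fin_suppD sF' NG'; exists r => m mr; apply: oppr_inj.
    rewrite oppr0 -[RHS](hr _ mr) (isum_morph (f := -%R))//.
    rewrite [in RHS](isum_morph (f := -%R))// -isumD//.
    by apply: eq_isum => s; rewrite -E.
  apply: eq_isum => m; rewrite [in LHS](isum_morph (f := -%R))// -isumD//.
  by rewrite [RHS](isum_morph (f := -%R))//; apply: eq_isum => s; rewrite E.
congr (- _).
have sJ : lbounded (mul_coef d (der_coef f)) by apply: lboundedM => //; exact: lbounded_der.
rewrite /loop (isum_morph (f := fun v => (2 * (l%:R + hc))%:A *: v)); first last.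
- exact: loop_fin.
- by move=> v w; rewrite scalerDr.
pose L m j : W := (d m * der_coef f (j - m)) *: ((2 * (l%:R + hc))%:A *: M y j u).
transitivity (isum (fun m => isum (L m))).
  (* With j = m - 1 + s, the product of s and [f s] is the coefficient of degree j - m of the
     derivative of f. *)
  apply: eq_isum => m; rewrite -(isum_shift (1 - m)); apply: eq_isum => j.
  rewrite /K /L /der_coef !scalerA -scalerMzr scalerMzl; congr (_ *: M y _ u); last by lia.
  have -> : j + (1 - m) = j - m + 1 by lia.
  by rewrite -mulrzr; ring.
rewrite isum_exchange; last first.
  apply: (@fin_supp2_bound _ a (e - c + 1) (a + c - 1) e) => m j h.
  - by rewrite /L da ?mul0r ?scale0r.
  - rewrite /L; have [ej|je] := leP e j; first by rewrite ue ?scaler0.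
    by rewrite /der_coef fc ?mulr0 ?scale0r//; lia.
  - rewrite /L; have [ma|am] := ltP m a; first by rewrite da ?mul0r ?scale0r.
    by rewrite /der_coef fc ?mulr0 ?scale0r//; lia.
  - by rewrite /L ue ?scaler0.
apply: eq_isum => j; rewrite /L [RHS]scalerA [(2 * _)%:A * _]mulrC -[RHS]scalerA /mul_coef.
rewrite (isum_morph (f := fun v => v *: ((2 * (l%:R + hc))%:A *: M y j u)))//.
- by move=> v w; rewrite scalerDl.
- by apply: mul_coef_fin => //; exact: lbounded_der.
Qed.

End Sugawara.
End AffineAction.

(** * Operators on tensor products *)

Section LinearMaps.
Variables (O : comNzRingType) (W1 W2 W3 : lmodType O).

Lemma linear_lincomb a (F G : W1 -> W2) : linear F -> linear G ->
  linear (fun u => a *: F u + G u).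
Proof.
move=> Fl Gl b u v; rewrite Fl Gl !scalerDr !scalerA [a * b]mulrC -!scalerA.
by rewrite addrACA.
Qed.

Lemma linear_compose (F : W2 -> W3) (G : W1 -> W2) : linear F -> linear G ->
  linear (fun u => F (G u)).
Proof. by move=> Fl Gl b u v; rewrite Gl Fl. Qed.

Lemma linear_map0 (F : W1 -> W2) : linear F -> F 0 = 0.
Proof. by move=> Fl; have := Fl (-1) 0 0; rewrite scaler0 addr0 scaleN1r addNr. Qed.

Lemma linear_mapD (F : W1 -> W2) : linear F -> {morph F : u v / u + v}.
Proof. by move=> Fl u v; rewrite -[u]scale1r Fl !scale1r. Qed.

Lemma linear_mapZ (F : W1 -> W2) : linear F -> forall a u, F (a *: u) = a *: F u.
Proof. by move=> Fl a u; rewrite -[a *: u]addr0 Fl linear_map0 ?addr0. Qed.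

Lemma linear_mapB (F : W1 -> W2) : linear F -> {morph F : u v / u - v}.
Proof.
by move=> Fl u v; rewrite addrC -scaleN1r Fl scaleN1r addrC.
Qed.

End LinearMaps.

Section TensorOperators.
Import finmap monalg.
Variables (k : fieldType) (O : comAlgType k) (I : finType).
Variable E : I -> lmodType k.
Local Notation T := (tensor O E).

Lemma tensor_ind (P : T -> Prop) : P 0 ->
  (forall a v t, P t -> P (a *: pure O v + t)) -> forall t, P t.
Proof.
move=> P0 PS t; rewrite -(span_proj_repr t) [repr t]monalgE raddf_sum/=.
elim/big_rec: _ => // v u _ Pu.
set c := (_)@_v; have -> : << c *g v >> = c *: << v >> :> {malg O[forall p, E p]}.
  by apply/malgP => w; rewrite mcoeffZ !mcoeffU mulrnAr mulr1.
by rewrite linearZ/=; exact: PS.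
Qed.
End TensorOperators.

Section TensorFactors.
Variables (k : fieldType) (O : comAlgType k) (I : finType).
Variable E : I -> lmodType k.
Local Notation T := (tensor O E).

Lemma tensor_linear_ext (W : lmodType O) (F G : T -> W) :
  linear F -> linear G -> (forall v, F (pure O v) = G (pure O v)) -> F =1 G.
Proof.
move=> Fl Gl FG; apply: tensor_ind => [|a v t IH]; last by rewrite Fl Gl FG IH.
have Z (h : T -> W) : linear h -> h 0 = 0.
  by move=> hl; have := hl (-1) 0 0; rewrite scaler0 addr0 scaleN1r addNr.
by rewrite !Z.
Qed.

Lemma dfwith_twice (v : forall p, E p) p (x y : E p) :
  dfwith (dfwith v x) y = dfwith v y.
Proof.
apply: functional_extensionality_dep => r.
have [->|nr] := eqVneq r p; first by rewrite !dfwith_in.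
by rewrite !dfwith_out// eq_sym.
Qed.

Lemma dfwithC (v : forall p, E p) p q (x : E p) (y : E q) : p != q ->
  dfwith (dfwith v x) y = dfwith (dfwith v y) x.
Proof.
move=> pq; apply: functional_extensionality_dep => r.
have [->|nrp] := eqVneq r p.
  by rewrite dfwith_in dfwith_out ?dfwith_in// eq_sym.
have [->|nrq] := eqVneq r q.
  by rewrite dfwith_in dfwith_out ?dfwith_in// eq_sym.
by rewrite !dfwith_out// eq_sym.
Qed.

Lemma dfwith_same (v : forall p, E p) p : dfwith v (v p) = v.
Proof.
apply: functional_extensionality_dep => r.
by have [->|nr] := eqVneq r p; rewrite ?dfwith_in// dfwith_out// eq_sym.
Qed.

Lemma factor_commute p q (f : E p -> E p) (h : E q -> E q) (t : T) :
  p != q -> linear f -> linear h ->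
  factor p f (factor q h t) = factor q h (factor p f t).
Proof.
move=> pq fl hl; apply: (tensor_linear_ext (F := factor p f \o factor q h)
  (G := factor q h \o factor p f)).
- by move=> a x y; rewrite /= (factor_linear hl) (factor_linear fl).
- by move=> a x y; rewrite /= (factor_linear fl) (factor_linear hl).
move=> v /=; rewrite !(factor_pure O fl, factor_pure O hl).
by rewrite !dfwith_out ?(eq_sym q)// dfwithC// eq_sym.
Qed.

Lemma factor_comp p (f h : E p -> E p) (v : forall p, E p) :
  linear f -> linear h ->
  factor p f (factor p h (pure O v)) = pure O (dfwith v (f (h (v p)))).
Proof.
by move=> fl hl; rewrite (factor_pure O hl) (factor_pure O fl) dfwith_in dfwith_twice.
Qed.

Section Derivation.
Variable Y : O -> O.
Hypothesis derY : derivation Y.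

Lemma deriv0 : Y 0 = 0.
Proof. by case: derY => D _ _; apply: (addrI (Y 0)); rewrite -D !addr0. Qed.

Lemma derivN a : Y (- a) = - Y a.
Proof.
by case: derY => D _ _; apply/eqP; rewrite -addr_eq0 -D addNr deriv0.
Qed.

Lemma derivB a b : Y (a - b) = Y a - Y b.
Proof. by case: derY => D _ _; rewrite D derivN. Qed.

Lemma deriv1 : Y 1 = 0.
Proof.
case: derY => _ _ M; have := M 1 1; rewrite !mulr1 mul1r => /eqP.
by rewrite -subr_eq0 opprD addrA subrr sub0r oppr_eq0 => /eqP.
Qed.

Lemma deriv_cst (c : k) : Y c%:A = 0.
Proof. by case: derY => _ Z _; rewrite Z deriv1 scaler0. Qed.

Lemma tderiv0 : tderiv Y (0 : T) = 0.
Proof. by apply: (addrI (tderiv Y (0 : T))); rewrite -(tderivD derY) !addr0. Qed.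

Lemma tderivZ a (t : T) : tderiv Y (a *: t) = Y a *: t + a *: tderiv Y t.
Proof.
elim/tensor_ind: t => [|b v t IH]; first by rewrite !scaler0 tderiv0 scaler0 addr0.
case: (derY) => _ _ M.
rewrite scalerDr !(tderivD derY) IH scalerA !(tderiv_pure derY) M.
rewrite 2!scalerDr scalerDl 2!scalerA; exact: addrACA.
Qed.

Lemma tderiv_factor p (f : E p -> E p) (t : T) : linear f ->
  tderiv Y (factor p f t) = factor p f (tderiv Y t).
Proof.
move=> fl; have fL := factor_linear (O := O) fl.
have f0 : factor p f 0 = 0 :> T.
  by have := fL (-1) 0 0; rewrite scaler0 addr0 scaleN1r addNr.
elim/tensor_ind: t => [|b v t IH]; first by rewrite tderiv0 f0 tderiv0.
rewrite fL !(tderivD derY) IH (factor_pure O fl) !(tderiv_pure derY).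
by rewrite fL (factor_pure O fl).
Qed.

End Derivation.
End TensorFactors.

Section FactorAlgebra.
Variables (k : fieldType) (O : comAlgType k) (I : finType).
Variables (E : I -> lmodType k) (p : I).
Local Notation T := (tensor O E).
Implicit Types f h : E p -> E p.

Lemma factor_lincomb a f h : linear f -> linear h -> forall t : T,
  factor p (fun v => a *: f v + h v) t = a%:A *: factor p f t + factor p h t.
Proof.
move=> fl hl; have cl := linear_lincomb a fl hl; apply: tensor_linear_ext.
- exact: (factor_linear cl).
- exact: (linear_lincomb _ (factor_linear fl) (factor_linear hl)).
move=> v; rewrite (factor_pure O cl) (factor_pure O fl) (factor_pure O hl).
exact: pure_multilinear.
Qed.

Lemma factor_compose f h : linear f -> linear h -> forall t : T,
  factor p (fun v => f (h v)) t = factor p f (factor p h t).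
Proof.
move=> fl hl; have cl := linear_compose fl hl; apply: tensor_linear_ext.
- exact: (factor_linear cl).
- exact: (linear_compose (factor_linear fl) (factor_linear hl)).
by move=> v; rewrite (factor_comp O v fl hl) (factor_pure O cl).
Qed.

Lemma factor_id (t : T) : factor p id t = t.
Proof.
have il : linear (id : E p -> E p) by [].
apply: (tensor_linear_ext (F := factor p id) (G := id)) => //.
  exact: (factor_linear il).
by move=> v; rewrite (factor_pure O il) dfwith_same.
Qed.

Lemma factor_ext f h (t : T) : f =1 h -> factor p f t = factor p h t.
Proof. by move=> /funext ->. Qed.

Lemma pure_zero (v : forall q, E q) : pure O (dfwith v (0 : E p)) = 0 :> T.
Proof.
have := @pure_multilinear k O I E v p (-1) 0 0.
by rewrite scaler0 addr0 scaleN1r scaleN1r addNr.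
Qed.

End FactorAlgebra.

Lemma derivation_bracket (k : fieldType) (O : comAlgType k) (Y Y' : O -> O) :
  derivation Y -> derivation Y' -> derivation (fun f => Y (Y' f) - Y' (Y f)).
Proof.
move=> [YD YZ YM] [YD' YZ' YM']; split.
- by move=> a b; rewrite YD' YD YD YD' opprD addrACA.
- by move=> a b; rewrite YZ' YZ YZ YZ' scalerBr.
- by move=> a b; rewrite YM' YM YD !YM YD' !YM'; ring.
Qed.

Lemma scaleB_addB (O : comNzRingType) (W : lmodType O) (a b : O) (p u v : W) :
  (a - b) *: p + (u - v) = a *: p + u - (b *: p + v).
Proof. by rewrite scalerBl opprD addrACA. Qed.

Lemma tderiv_bracket (k : fieldType) (O : comAlgType k) (I : finType)
    (E : I -> lmodType k) (Y Y' : O -> O) (u : tensor O E) :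
  derivation Y -> derivation Y' ->
  tderiv (fun f => Y (Y' f) - Y' (Y f)) u =
  tderiv Y (tderiv Y' u) - tderiv Y' (tderiv Y u).
Proof.
move=> dY dY'; have dZ := derivation_bracket dY dY'; set Z := fun f => _ in dZ *.
elim/tensor_ind: u => [|a v t IH].
  have E1 := etrans (congr1 (tderiv Y) (tderiv0 E dY')) (tderiv0 E dY).
  have E2 := etrans (congr1 (tderiv Y') (tderiv0 E dY)) (tderiv0 E dY').
  by rewrite E1 E2 subrr; exact: tderiv0.
have step (D : O -> O) (dD : derivation D) b w :
    tderiv D (b *: pure O v + w) = D b *: pure O v + tderiv D w.
  exact: etrans (tderivD dD _ _) (congr1 (+%R^~ _) (tderiv_pure dD b v)).
have step2 (D D' : O -> O) (dD : derivation D) (dD' : derivation D') :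
    tderiv D (tderiv D' (a *: pure O v + t)) =
    D (D' a) *: pure O v + tderiv D (tderiv D' t).
  exact: etrans (congr1 (tderiv D) (step D' dD' a t)) (step D dD _ _).
rewrite (step Z dZ) (step2 Y Y' dY dY') (step2 Y' Y dY' dY) IH.
exact: scaleB_addB.
Qed.
Section Commutants.
Variables (k : numClosedFieldType) (g : lieAlgebra k) (B : g -> g -> k).
Variables (l : nat) (O : comUnitAlgType k) (W : lmodType O).
Variable M : g -> int -> W -> W.
Hypothesis affM : affine_action B l M.
Variable T : W -> W.
Hypothesis TD : {morph T : u v / u + v}.
Hypothesis TZ : forall a u, T (a *: u) = a *: T u.
Hypothesis TM : forall x m u, T (M x m u) = M x m (T u).

Lemma loop_commutant x f u : lbounded f -> T (loop M x f u) = loop M x f (T u).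
Proof.
move=> fb; rewrite /loop (isum_morph TD (loop_fin affM x u fb)).
by apply: eq_isum => m; rewrite TZ TM.
Qed.

(** With T the action of a loop at another point, this is why Sugawara operators at p interact only
    with loops at p. *)
Lemma sug_commutant (X : (\dim {:g}).-tuple g) d u : lbounded d ->
  T (sug M X d u) = sug M X d (T u).
Proof.
move=> db; rewrite /sug (isum_morph TD (sug_fin affM X u db)).
apply: eq_isum => m; rewrite TZ; congr (_ *: _).
rewrite /quad (isum_morph TD (nord_fin affM X m u)); apply: eq_isum => r.
have T0 : T 0 = 0 by apply: (addrI (T 0)); rewrite -TD !addr0.
rewrite /nord (big_morph T TD T0); apply: eq_bigr => i _.
by rewrite /normal_order; case: ifP => _; rewrite !TM.
Qed.

End Commutants.

Section LoopCoefficients.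
Variables (k : numClosedFieldType) (g : lieAlgebra k) (B : g -> g -> k).
Variables (l : nat) (O : comUnitAlgType k) (W : lmodType O).
Variable M : g -> int -> W -> W.
Hypothesis affM : affine_action B l M.

Lemma loop_coefD x f h u : lbounded f -> lbounded h ->
  loop M x (fun m => f m + h m) u = loop M x f u + loop M x h u.
Proof.
move=> fb hb; rewrite /loop -isumD; try exact: (loop_fin affM).
by apply: eq_isum => m; rewrite scalerDl.
Qed.

Lemma sug_coefD (X : (\dim {:g}).-tuple g) f h u : lbounded f -> lbounded h ->
  sug M X (fun m => f m + h m) u = sug M X f u + sug M X h u.
Proof.
move=> fb hb; rewrite /sug -isumD; try exact: (sug_fin affM).
by apply: eq_isum => m; rewrite scalerDl.
Qed.

Lemma sug_coefZ (X : (\dim {:g}).-tuple g) a f u : lbounded f ->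
  sug M X (fun m => a * f m) u = a *: sug M X f u.
Proof.
move=> fb; rewrite /sug (isum_morph (f := fun v => a *: v)).
- by apply: eq_isum => m; rewrite scalerA.
- by move=> v w; rewrite scalerDr.
- exact: (sug_fin affM).
Qed.

End LoopCoefficients.

Section HO.
Variables (k : numClosedFieldType) (g : lieAlgebra k) (B : g -> g -> k).
Variables (X : (\dim {:g}).-tuple g) (hc : k) (l n : nat).
Variable V : 'I_n -> gmodule g.
Variable H : forall p, hwModule B l (pointed_reps V p).
Variables (O : comUnitAlgType k) (z : 'I_n -> O).
Local Notation HO := (HO H O).

Local Notation fam := (fun p => H p : lmodType k).

Lemma mode_linear p x m : linear (mode x m : H p -> H p).
Proof. by move=> a u v; exact: modeDr. Qed.

Lemma mode_at_linear p x m : linear (mode_at p x m : HO -> HO).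
Proof. exact: (factor_linear (E := fam) (mode_linear (p := p) x m)). Qed.

Lemma mode_at_pure p x m (v : forall p, fam p) :
  mode_at p x m (pure O v : HO) = pure O (dfwith v (mode x m (v p))).
Proof. exact: (factor_pure O (E := fam) (mode_linear (p := p) x m)). Qed.

Lemma factor_affine p :
  affine_action (O := O) (W := tensor O fam) B l
    (fun x m => factor p (mode x m : H p -> H p)).
Proof.
have ml x m := mode_linear (p := p) x m.
split.
- move=> a x y m u; rewrite -(factor_lincomb a (ml x m) (ml y m)).
  by apply: factor_ext => v; exact: modeDl.
- by move=> a x m; exact: (factor_linear (ml x m)).
- move=> x y m r u; set c := (_ * _ * _ * _)%R.
  have idl : linear (id : H p -> H p) by [].
  have l1 := linear_lincomb c idl (ml (lie x y) (m + r)).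
  have l2 := linear_compose (ml x m) (ml y r).
  have l3 := linear_compose (ml y r) (ml x m).
  rewrite -(factor_compose (ml x m) (ml y r)) -(factor_compose (ml y r) (ml x m)).
  have := factor_lincomb (-1) l3 l2 u.
  rewrite scaleN1r scaleN1r addrC => <-.
  transitivity (factor p (fun v : H p => c *: v + mode (lie x y) (m + r) v) u).
    by apply: factor_ext => v; rewrite scaleN1r addrC (modeJ x y m r v); exact: addrC.
  rewrite (factor_lincomb c idl (ml (lie x y) (m + r))) factor_id.
  exact: addrC.
- apply: tensor_ind.
    by exists 0 => x m _; exact: (linear_map0 (factor_linear (ml x m))).
  move=> a v t [b tb]; have [b' vb] := mode_smooth (v p).
  exists (Order.max b b') => x m; rewrite ge_max => /andP[h h'].
  rewrite (factor_linear (ml x m)) tb// (factor_pure O (ml x m)).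
  by rewrite (vb x m h') pure_zero scaler0 addr0.
Qed.

Lemma mode_at_affine p : affine_action (O := O) (W := HO) B l (mode_at p).
Proof. exact: factor_affine. Qed.

Lemma mode_at_commute p q x y m r (u : HO) : p != q ->
  mode_at p x m (mode_at q y r u) = mode_at q y r (mode_at p x m u).
Proof.
by move=> pq; apply: (factor_commute (E := fam)) => //; exact: mode_linear.
Qed.

End HO.

(** * Descent to coinvariants *)

Section ConformalModule.
Variables (k : numClosedFieldType) (g : lieAlgebra k) (B : g -> g -> k).
Variables (X : (\dim {:g}).-tuple g) (hc : k) (l n : nat).
Variables (O : comUnitAlgType k) (z : 'I_n -> O) (W : lmodType O).
Variable M : option 'I_n -> g -> int -> W -> W.
Hypothesis affM : forall p, affine_action B l (M p).
Hypothesis commM : forall p q x y m r u, p != q ->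
  M p x m (M q y r u) = M q y r (M p x m u).

Definition lact (x : g) (f : family_coef O n) (u : W) : W :=
  \sum_p loop (M p) x (f p) u.

Definition tsug (d : family_coef O n) (u : W) : W :=
  (- (2 * (l%:R + hc))^-1)%:A *: \sum_p sug (M p) X (d p) u.

Definition flbounded (f : family_coef O n) := forall p, lbounded (f p).

Lemma lactD x f u v : flbounded f -> lact x f (u + v) = lact x f u + lact x f v.
Proof.
by move=> fb; rewrite /lact -big_split; apply: eq_bigr => p _; rewrite (loop_addr (affM p)).
Qed.

Lemma lactZ x f a u : flbounded f -> lact x f (a *: u) = a *: lact x f u.
Proof.
by move=> fb; rewrite /lact scaler_sumr; apply: eq_bigr => p _; rewrite (loop_scaler (affM p)).
Qed.

Lemma lact_coefD x f h u : flbounded f -> flbounded h ->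
  lact x (fun p m => f p m + h p m) u = lact x f u + lact x h u.
Proof.
move=> fb hb; rewrite /lact -big_split; apply: eq_bigr => p _.
exact: (loop_coefD (affM p)).
Qed.

Lemma tsugD d u v : flbounded d -> tsug d (u + v) = tsug d u + tsug d v.
Proof.
move=> db; rewrite /tsug -scalerDr -big_split/=; congr (_ *: _).
by apply: eq_bigr => p _; rewrite (sugD (affM p)).
Qed.

Lemma tsugZ d a u : flbounded d -> tsug d (a *: u) = a *: tsug d u.
Proof.
move=> db; rewrite /tsug !scaler_sumr; apply: eq_bigr => p _.
by rewrite (sugZ (affM p))// !scalerA mulrC.
Qed.

Lemma tsug_coefD d e u : flbounded d -> flbounded e ->
  tsug (fun p m => d p m + e p m) u = tsug d u + tsug e u.
Proof.
move=> db eb; rewrite /tsug -scalerDr -big_split/=; congr (_ *: _).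
by apply: eq_bigr => p _; rewrite (sug_coefD (affM p)).
Qed.

Section Commutator.
Hypotheses (invB : invariant_form B) (orthX : orthonormal_basis B X).
Hypothesis coxX : dual_coxeter X hc.
Hypothesis levX : l%:R + hc != 0.

Lemma sug_loop_far p q d f y u : p != q -> lbounded d -> lbounded f ->
  sug (M p) X d (loop (M q) y f u) = loop (M q) y f (sug (M p) X d u).
Proof.
move=> pq db fb; apply: esym; apply: (sug_commutant (affM p)) => //.
- by move=> v w; rewrite (loop_addr (affM q)).
- by move=> a v; rewrite (loop_scaler (affM q)).
move=> x m v; apply: esym; apply: (loop_commutant (affM q)) => //.
- by move=> v' w; rewrite (actD (affM p)).
- by move=> a v'; rewrite (actZ (affM p)).
- by move=> x' m' v'; rewrite commM.
Qed.

(** The factor -1 / (2 (l + hc)) cancels the constant of [sug_loop], and by [sug_loop_far] the terms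
    at two different points commute. *)
Lemma tsug_lact d f y u : flbounded d -> flbounded f ->
  tsug d (lact y f u) = lact y f (tsug d u) +
    lact y (fun p => mul_coef (d p) (der_coef (f p))) u.
Proof.
move=> db fb; rewrite /tsug lactZ//.
set c := (- _)%:A; have c2 : c * (- (2 * (l%:R + hc))%:A) = 1.
  rewrite /c scaleNr mulrNN -scalerAl mul1r scalerA mulVf ?scale1r//.
  by rewrite mulf_neq0// pnatr_eq0.
have loop_sum q (F : option 'I_n -> W) :
    loop (M q) y (f q) (\sum_p F p) = \sum_p loop (M q) y (f q) (F p).
  apply: (big_morph (loop (M q) y (f q))) => [v w|].
    by rewrite (loop_addr (affM q)).
  by rewrite -(scale0r 0) (loop_scaler (affM q)) ?scale0r.
have sug_sum p (F : option 'I_n -> W) :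
    sug (M p) X (d p) (\sum_q F q) = \sum_q sug (M p) X (d p) (F q).
  apply: (big_morph (sug (M p) X (d p))) => [v w|].
    by rewrite (sugD (affM p)).
  by rewrite -(scale0r 0) (sugZ (affM p)) ?scale0r.
have -> : lact y (fun p => mul_coef (d p) (der_coef (f p))) u =
    c *: \sum_p - ((2 * (l%:R + hc))%:A *: loop (M p) y (mul_coef (d p) (der_coef (f p))) u).
  rewrite scaler_sumr /lact; apply: eq_bigr => p _.
  by rewrite -scaleNr scalerA c2 scale1r.
rewrite -scalerDr; congr (_ *: _).
rewrite [lact y f _]/lact.
under [X in _ = X + _]eq_bigr => q _ do rewrite loop_sum.
under [LHS]eq_bigr => p _ do rewrite ?/lact sug_sum.
rewrite exchange_big/= -big_split/=; apply: eq_bigr => q _.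
rewrite (bigD1 q)//= [in RHS](bigD1 q)//=.
rewrite -(sug_loop (affM q) invB orthX coxX y u (db q) (fb q)).
rewrite (eq_bigr (fun p => loop (M q) y (f q) (sug (M p) X (d p) u))); last first.
  by move=> p pq; rewrite sug_loop_far.
zmod.
Qed.

Variables (Y : O -> O) (Yop : W -> W).
Hypothesis derY : derivation Y.
Hypothesis YopD : {morph Yop : u v / u + v}.
Hypothesis YopZ : forall a u, Yop (a *: u) = Y a *: u + a *: Yop u.
Hypothesis YopM : forall p x m u, Yop (M p x m u) = M p x m (Yop u).

Lemma Yop_lact x f u : flbounded f ->
  Yop (lact x f u) = lact x (fun p m => Y (f p m)) u + lact x f (Yop u).
Proof.
have Yop0 : Yop 0 = 0 by apply: (addrI (Yop 0)); rewrite -YopD !addr0.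
move=> fb; rewrite /lact (big_morph Yop YopD Yop0) -big_split/=.
apply: eq_bigr => p _; rewrite /loop (isum_morph YopD (loop_fin (affM p) x u (fb p))) -isumD.
- by apply: eq_isum => m; rewrite YopZ YopM.
- by apply: (loop_fin (affM p)); apply: lbounded_map (fb p); exact: deriv0.
- exact: (loop_fin (affM p)).
Qed.

Variable d : family_coef O n.
Hypothesis db : flbounded d.

Definition nabla_op (u : W) : W := Yop u + tsug d u.

Lemma nabla_opD u v : nabla_op (u + v) = nabla_op u + nabla_op v.
Proof. by rewrite /nabla_op YopD tsugD// addrACA. Qed.

Lemma nabla_opZ a u : nabla_op (a *: u) = Y a *: u + a *: nabla_op u.
Proof. by rewrite /nabla_op YopZ tsugZ// scalerDr addrA. Qed.

Lemma nabla_op_lact x f u : flbounded f ->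
  nabla_op (lact x f u) = lact x f (nabla_op u) +
    lact x (fun p m => Y (f p m) + mul_coef (d p) (der_coef (f p)) m) u.
Proof.
move=> fb; rewrite /nabla_op Yop_lact// tsug_lact// lactD//.
rewrite (@lact_coefD x (fun p m => Y (f p m))
                     (fun p => mul_coef (d p) (der_coef (f p)))).
- zmod.
- by move=> p; apply: lbounded_map => //; exact: deriv0.
- by move=> p; apply: lboundedM => //; exact: lbounded_der.
Qed.

Variable P : W -> Prop.
Hypothesis PE : forall u, P u <-> exists x f v, in_A z f /\ u = lact x f v.
Hypothesis A_bounded : forall f, in_A z f -> flbounded f.
Hypothesis A_stable : forall f, in_A z f ->
  in_A z (fun p m => Y (f p m) + mul_coef (d p) (der_coef (f p)) m).

(** [nabla_op] is not linear over [O], but the extra term [Y a *: w] of the Leibniz rule stays in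
    the submodule. The relation for f and v goes to the relation for f and [nabla_op v] plus the one
    for the derivative of f and v, which is again a relation by [A_stable]. *)
Lemma nabla_op_span u : in_span P u -> in_span P (nabla_op u).
Proof.
have SP := span_submod P.
have inP v : P v -> v \in span_pred P.
  move=> Pv; apply/span_predP; exists [:: (1, v)].
    by move=> w; rewrite inE => /eqP ->.
  by rewrite big_seq1 scale1r.
move=> [s Ps ->]; apply/span_predP.
elim: s Ps => [|[a w] s IH] Ps.
  rewrite big_nil -(scale0r 0) nabla_opZ deriv0// !scale0r addr0.
  by case: SP.
rewrite big_cons nabla_opD; apply: rpredD; last first.
  by apply: IH => y ys; apply: Ps; rewrite inE ys orbT.
have Pw : P w by apply: (Ps (a, w)); rewrite inE eqxx.
rewrite nabla_opZ; apply: rpredD; apply: rpredZ; first exact: inP.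
have /PE[x [f [v [fA ->]]]] := Pw; rewrite nabla_op_lact; last exact: A_bounded.
apply: rpredD; apply: inP; apply/PE; first by exists x, f, (nabla_op v).
exists x, (fun p m => Y (f p m) + mul_coef (d p) (der_coef (f p)) m), v.
by split=> //; exact: A_stable.
Qed.

Lemma nabla_op_descends : exists nabla : span_quot P -> span_quot P,
  forall u, nabla (span_proj P u) = span_proj P (nabla_op u).
Proof.
exists (fun b => span_proj P (nabla_op (repr (b : Quotient.quot _)))) => u.
apply/span_projE; set v := repr _.
have -> : nabla_op v - nabla_op u = nabla_op (v - u).
  have N w : nabla_op (- w) = - nabla_op w.
    by apply/eqP; rewrite -addr_eq0 -nabla_opD addNr -(scale0r 0) nabla_opZ deriv0// !scale0r addr0.
  by rewrite nabla_opD N.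
by apply: nabla_op_span; apply/span_projE; rewrite /v span_proj_repr.
Qed.

End Commutator.
End ConformalModule.

(** * Functions on the punctured line and their derivations *)

Section FunctionAlgebra.
Variables (k : fieldType) (O : comUnitAlgType k) (n : nat) (z : 'I_n -> O).
Hypothesis zU : forall i j, i != j -> z i - z j \is a GRing.unit.
Implicit Types f h : family_coef O n.
Local Notation cst := (@cst_fun k O n).

Lemma in_A_laurent f : in_A z f -> laurent f.
Proof.
elim => [a p|p|j p|f1 f2 _ b1 _ b2 p|f1 f2 _ b1 _ b2 p].
- by exists 0 => m; rewrite /cst_fun; case: eqP => // ->.
- exists (-1) => m; case: p => [i|]/= h; last by rewrite lt_eqF.
  by rewrite !ifF ?lt_eqF//; lia.
- exists (-1) => m; case: p => [i|]/=; last by case: m.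
  by case: eqP => _ h; [rewrite lt_eqF|move: h; case: m => // -[]].
- exact: lboundedD.
- exact: lboundedM.
Qed.

Definition fmul f h : family_coef O n := fun p => mul_coef (f p) (h p).
Definition fadd f h : family_coef O n := fun p m => f p m + h p m.

Lemma fmulC f h : fmul f h = fmul h f.
Proof. by apply/funext => p; exact: mul_coefC. Qed.

Lemma fmulA f1 f2 f3 : laurent f1 -> laurent f2 -> laurent f3 ->
  fmul (fmul f1 f2) f3 = fmul f1 (fmul f2 f3).
Proof. by move=> b1 b2 b3; apply/funext => p; exact: mul_coefA. Qed.

Lemma fmul_cst a f : fmul (cst a) f = fun p m => a * f p m.
Proof.
apply/funext => p; rewrite /fmul /cst_fun mul_coef_delta.
by apply/funext => m; rewrite subr0.
Qed.

Lemma fmul1 f : fmul (cst 1) f = f.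
Proof.
by rewrite fmul_cst; apply/funext => p; apply/funext => m; rewrite mul1r.
Qed.

Lemma fmulDl f1 f2 f3 : laurent f1 -> laurent f2 -> laurent f3 ->
  fmul (fadd f1 f2) f3 = fadd (fmul f1 f3) (fmul f2 f3).
Proof. by move=> b1 b2 b3; apply/funext => p; exact: mul_coefDl. Qed.

Lemma fmulDr f1 f2 f3 : laurent f1 -> laurent f2 -> laurent f3 ->
  fmul f3 (fadd f1 f2) = fadd (fmul f3 f1) (fmul f3 f2).
Proof. by move=> *; rewrite fmulC fmulDl// !(fmulC f3). Qed.

Lemma laurentM f h : laurent f -> laurent h -> laurent (fmul f h).
Proof. by move=> b1 b2 p; apply: lboundedM. Qed.

Lemma laurentD f h : laurent f -> laurent h -> laurent (fadd f h).
Proof. by move=> b1 b2 p; apply: lboundedD. Qed.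

Lemma laurent_cst a : laurent (cst a).
Proof. by move=> p; exists 0 => m; rewrite /cst_fun; case: eqP => // ->. Qed.

Lemma laurent_z : laurent (z_fun z). Proof. by apply: in_A_laurent; constructor. Qed.
Lemma laurent_pole j : laurent (pole_fun z j).
Proof. by apply: in_A_laurent; constructor. Qed.

Definition zeta j : family_coef O n := fadd (z_fun z) (cst (- z j)).

Lemma in_A_zeta j : in_A z (zeta j).
Proof. by apply: A_add; [exact: A_z|exact: A_cst]. Qed.

(** This certifies the expansions in [pole_fun]: at every point they invert z - z_j. *)
Lemma zeta_pole j : fmul (zeta j) (pole_fun z j) = cst 1.
Proof.
apply/funext => p; apply/funext => m; rewrite /fmul.
(* The expansion of z - z_j is t_i + (z_i - z_j) at z_i and t_oo^-1 - z_j at infinity. *)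
rewrite (_ : zeta j p = fun r =>
    (if r == (if p is Some _ then 1 else -1) then 1 else 0) +
    (if r == 0 then (if p is Some i then z i - z j else - z j) else 0)); last first.
  apply/funext => r; rewrite /zeta /fadd /cst_fun; case: p => [i|] /=.
    by case: (r =P 0) => [->|_]; case: (_ =P 1) => //= _; rewrite ?add0r ?addr0.
  by case: (r =P 0) => [->|_]; case: (_ =P -1) => //= _; rewrite ?add0r ?addr0.
rewrite mul_coefDl; last 3 first.
- exists (-1) => r h; rewrite ifF//; case: p h => [i|] h; apply/eqP; lia.
- by exists 0 => r h; rewrite lt_eqF.
- exact: laurent_pole.
rewrite !mul_coef_delta subr0 mul1r /cst_fun; case: p => [i|] /=.
  have [->|ij] := eqVneq i j.
    rewrite subrr mul0r addr0 (_ : (m - 1 == -1) = (m == 0)) ?(fun_if GRing.natmul 1)//;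
      by [case: eqP|apply/eqP/eqP; lia].
  have u := zU ij; case: m => [[|r]|r] /=.
  - by rewrite add0r expr0 mul1r expr1 divrr.
  - rewrite subn1 /= [(-1) ^+ r.+1]exprS [_ ^+ r.+2]exprS.
    have := divrr u; set v := _^-1; set w := z i - z j => wv.
    have -> : w * (-1 * (-1) ^+ r * (v * v ^+ r.+1)) =
      - ((w * v) * ((-1) ^+ r * v ^+ r.+1)) by ring.
    by rewrite wv mul1r subrr.
  - by rewrite mulr0 addr0.
case: m => [[|r]|[|r]] /=.
- by rewrite mulr0 addr0 expr0.
- by rewrite addn1 /= exprS mulNr subrr.
- by rewrite mulr0 addr0.
- by rewrite mulr0 addr0.
Qed.

Lemma zeta_inj j f h : laurent f -> laurent h ->
  fmul (zeta j) f = fmul (zeta j) h -> f = h.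
Proof.
have zb : laurent (zeta j) := in_A_laurent (in_A_zeta j).
have pb := laurent_pole j.
move=> fb hb /(congr1 (fmul (pole_fun z j))).
by rewrite -!fmulA// [fmul (pole_fun z j) _]fmulC zeta_pole !fmul1.
Qed.

Section VerticalHorizontal.
Variables (Y : O -> O) (d : family_coef O n).
Hypotheses (derY : derivation Y) (db : laurent d).

Definition vder f : family_coef O n :=
  fun p m => Y (f p m) + mul_coef (d p) (der_coef (f p)) m.

Lemma laurent_vder f : laurent f -> laurent (vder f).
Proof.
move=> fb p; apply: (lboundedD (f := fun m => Y (f p m))).
  by apply: lbounded_map (fb p); exact: deriv0.
by apply: lboundedM => //; exact: lbounded_der.
Qed.

Lemma vder_cst a : vder (cst a) = cst (Y a).
Proof.
apply/funext => p; apply/funext => m; rewrite /vder /cst_fun.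
rewrite [mul_coef _ _ _](isum0 (F := fun r => _)) => [|r]; last first.
  by rewrite /der_coef; case: eqP => [->|]; rewrite ?mul0r mulr0 ?mulr0.
by rewrite addr0; case: eqP => // _; rewrite deriv0.
Qed.

Lemma vderD f h : laurent f -> laurent h -> vder (fadd f h) = fadd (vder f) (vder h).
Proof.
case: (derY) => YD _ _ fb hb; apply/funext => p; apply/funext => m.
rewrite /vder /fadd YD addrACA; congr (_ + _).
rewrite (_ : der_coef _ = fun m => der_coef (f p) m + der_coef (h p) m).
  by rewrite mul_coefDr//; exact: lbounded_der.
by apply/funext => r; rewrite /der_coef mulrDr.
Qed.

Lemma vderM f h : laurent f -> laurent h ->
  vder (fmul f h) = fadd (fmul (vder f) h) (fmul f (vder h)).
Proof.
case: (derY) => YD _ YM fb hb; apply/funext => p; apply/funext => m.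
have fY : lbounded (fun m => Y (f p m)) by apply: lbounded_map (fb p); exact: deriv0.
have hY : lbounded (fun m => Y (h p m)) by apply: lbounded_map (hb p); exact: deriv0.
have fd := lbounded_der (fb p); have hd := lbounded_der (hb p).
have dp := db p; have fp := fb p; have hp := hb p.
have fdh := lboundedM fd hp; have fhd := lboundedM fp hd.
have ddf := lboundedM dp fd; have ddh := lboundedM dp hd.
rewrite /vder /fadd /fmul (der_coefM fp hp) (mul_coefDr fdh fhd dp).
rewrite (mul_coefDl fY ddf hp) (mul_coefDr hY ddh fp).
rewrite -mul_coefA// -[mul_coef (f p) (mul_coef (d p) _)]mul_coefA//.
rewrite [mul_coef (f p) (d p)]mul_coefC mul_coefA//.
rewrite addrACA; congr (_ + _); last by rewrite [in RHS]mul_coefA.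
rewrite {1}/mul_coef (isum_morph YD); last exact: mul_coef_fin.
rewrite /mul_coef -isumD; [|exact: (mul_coef_fin m fY hp)|exact: (mul_coef_fin m fp hY)].
by apply: eq_isum => r; rewrite YM.
Qed.

End VerticalHorizontal.

Section Lift.
Variables (Y : O -> O) (derY : derivation Y).

(* The vertical part of the lift of Y that annihilates z. *)
Definition lift0_field : family_coef O n :=
  fun p m => if p is Some i then (if m == 0 then - Y (z i) else 0) else 0.

Lemma laurent_lift0 : laurent lift0_field.
Proof. by move=> [i|]; exists 0 => m h //=; rewrite lt_eqF. Qed.

Lemma vder0_z : vder Y lift0_field (z_fun z) = cst 0.
Proof.
have Yn (b : bool) : Y b%:R = 0.
  by case: b; [exact: (deriv1 derY)|exact: (deriv0 derY)].
apply/funext => p; apply/funext => m; rewrite /vder /lift0_field /cst_fun if_same.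
case: p => [i|] /=; last first.
  by rewrite Yn add0r; apply: isum0 => r; rewrite mul0r.
rewrite mul_coef_delta subr0 /der_coef.
case: (m =P 0) => [->|m0]/=; first by rewrite mulr1 mulr1 subrr.
rewrite Yn add0r; have [->|m1] := eqVneq (m + 1) 0; first by rewrite mul0r mulr0.
by rewrite (_ : m + 1 == 1 = false) ?mulr0//; apply/eqP; lia.
Qed.

(** Differentiating (z - z_j) (z - z_j)^-1 = 1 gives (Y z_j - D z) (z - z_j)^-2; the identity is
    checked after multiplication by z - z_j, which can be cancelled. *)
Lemma vder_pole d j : laurent d ->
  vder Y d (pole_fun z j) =
  fmul (fmul (fadd (cst (Y (z j))) (fmul (cst (-1)) (vder Y d (z_fun z))))
     (pole_fun z j)) (pole_fun z j).
Proof.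
move=> db; have pb := laurent_pole j.
have zb : laurent (zeta j) := in_A_laurent (in_A_zeta j).
have vb f : laurent f -> laurent (vder Y d f) by move=> ?; exact: laurent_vder.
have cb a := laurent_cst a; have zzb := laurent_z.
apply: (@zeta_inj j); first exact: vb.
  do !apply: laurentM => //; apply: laurentD => //; apply: laurentM => //; exact: vb.
have := vderM derY db zb pb; rewrite zeta_pole vder_cst// (deriv1 derY).
rewrite /zeta vderD// vder_cst// -/(zeta j) (derivN derY).
set A := vder Y d (z_fun z); have Ab : laurent A by exact: vb.
set C := fadd (cst (Y (z j))) _.
have Cb : laurent C by apply: laurentD => //; apply: laurentM.
have -> : fadd A (cst (- Y (z j))) = fmul (cst (-1)) C.
  rewrite /C fmul_cst fmul_cst; apply/funext => p; apply/funext => m.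
  by rewrite /fadd /cst_fun; case: ifP => _; rewrite ?oppr0; ring.
move=> E; have Cp : laurent (fmul C (pole_fun z j)) by exact: laurentM.
have -> : fmul (zeta j) (fmul (fmul C (pole_fun z j)) (pole_fun z j)) =
    fmul C (pole_fun z j).
  by rewrite fmulC (fmulA Cp pb zb) [fmul (pole_fun z j) _]fmulC zeta_pole fmulC fmul1.
apply/funext => p; apply/funext => m.
have := congr1 (fun F => F p m) E; rewrite fmulA// fmul_cst /fadd.
rewrite /cst_fun if_same => /eqP; rewrite eq_sym addrC mulN1r subr_eq0 => /eqP.
by [].
Qed.

Lemma lift0_stable f : in_A z f -> in_A z (vder Y lift0_field f).
Proof.
have db := laurent_lift0.
elim => [a||j|f1 f2 A1 B1 A2 B2|f1 f2 A1 B1 A2 B2].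
- by rewrite vder_cst//; constructor.
- by rewrite vder0_z; constructor.
- rewrite vder_pole// vder0_z.
  apply: A_mul; last exact: A_pole.
  apply: A_mul; last exact: A_pole.
  by apply: A_add; [exact: A_cst|apply: A_mul; exact: A_cst].
- have := vderD derY db (in_A_laurent A1) (in_A_laurent A2); rewrite /fadd => ->.
  exact: A_add.
- have := vderM derY db (in_A_laurent A1) (in_A_laurent A2); rewrite /fmul => ->.
  by apply: A_add; apply: A_mul.
Qed.

Lemma lifts0 : lifts z Y (vder Y lift0_field).
Proof.
have db := laurent_lift0; split.
- exact: lift0_stable.
- by move=> a; exact: vder_cst.
- by move=> f h fA hA; exact: (vderD derY db (in_A_laurent fA) (in_A_laurent hA)).
- by move=> f h fA hA; exact: (vderM derY db (in_A_laurent fA) (in_A_laurent hA)).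
Qed.

Variable D : family_coef O n -> family_coef O n.
Hypothesis liftD : lifts z Y D.

(** The vertical part sends t_p to D t_p, and D t_i = D z - Y z_i, while D t_oo = - t_oo^2 D z
    because t_oo = z^-1; hence the shift by 2. *)
Definition lift_field : family_coef O n :=
  fun p m => if p is Some i then D (z_fun z) p m + (if m == 0 then - Y (z i) else 0)
             else - D (z_fun z) p (m - 2).

Lemma laurent_lift : laurent lift_field.
Proof.
have Db := in_A_laurent (lifts_stable liftD (A_z z)).
move=> [i|].
  by apply: lboundedD; [exact: Db|exists 0 => m h; rewrite lt_eqF].
by have [b H] := Db None; exists (b + 2) => m h /=; rewrite H ?oppr0//; lia.
Qed.

(** A derivation of the function algebra is determined by its values on [O] and on z: each pole is
    the inverse of some z - z_j, so its derivative is forced. *)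
Lemma vder_lift f : in_A z f -> D f = vder Y lift_field f.
Proof.
have db := laurent_lift; have Yn (b : bool) : Y b%:R = 0.
  by case: b; [exact: (deriv1 derY)|exact: (deriv0 derY)].
have Ez : D (z_fun z) = vder Y lift_field (z_fun z).
  apply/funext => p; apply/funext => m; rewrite /vder mul_coefC; case: p => [i|] /=.
    rewrite (_ : der_coef _ = fun r => if r == 0 then 1 else 0).
      rewrite mul_coef_delta subr0 mul1r /lift_field; case: (m =P 0) => [_|_].
        by rewrite addrC subrK.
      by rewrite Yn add0r addr0.
    apply/funext => r; rewrite /der_coef/=; case: (r =P 0) => [->|r0]/=; first by rewrite mulr1.
    have [->|r1] := eqVneq (r + 1) 0; first by rewrite mul0r.
    by rewrite (_ : r + 1 == 1 = false) ?mulr0//; apply/eqP; lia.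
  rewrite (_ : der_coef _ = fun r => if r == -2 then -1 else 0).
    rewrite mul_coef_delta Yn add0r mulN1r opprK; congr (D _ _ _); lia.
  apply/funext => r; rewrite /der_coef/=; case: (r =P -2) => [->|r0]/=; first by rewrite mulr1.
  by rewrite (_ : r + 1 == -1 = false) ?mulr0//; apply/eqP; lia.
elim => [a||j|f1 f2 A1 B1 A2 B2|f1 f2 A1 B1 A2 B2].
- by rewrite vder_cst// (lifts_cst liftD).
- exact: Ez.
- have zA := in_A_zeta j; have pA := A_pole z j.
  have zb := in_A_laurent zA; have pb := laurent_pole j.
  have Dzeta : D (zeta j) = vder Y lift_field (zeta j).
    rewrite (lifts_add liftD (A_z z) (A_cst z _)) vderD//; last 2 first.
    + exact: laurent_z.
    + exact: laurent_cst.
    by rewrite Ez (lifts_cst liftD) vder_cst.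
  apply: (@zeta_inj j).
  + exact: in_A_laurent (lifts_stable liftD pA).
  + exact: laurent_vder.
  have E1 : D (fmul (zeta j) (pole_fun z j)) =
      fadd (fmul (D (zeta j)) (pole_fun z j)) (fmul (zeta j) (D (pole_fun z j))).
    by move: (lifts_mul liftD zA pA); rewrite /fadd /fmul => ->.
  have := vderM derY db zb pb; rewrite -Dzeta zeta_pole vder_cst// -(lifts_cst liftD).
  rewrite -(zeta_pole j) E1 => E.
  apply/funext => p; apply/funext => m.
  by have /(congr1 (fun F => F p m)) /addrI -> := E.
- by have := vderD derY db (in_A_laurent A1) (in_A_laurent A2); rewrite /fadd => ->;
    rewrite (lifts_add liftD A1 A2) B1 B2.
- by have := vderM derY db (in_A_laurent A1) (in_A_laurent A2); rewrite /fmul => ->;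
    rewrite (lifts_mul liftD A1 A2) B1 B2.
Qed.

End Lift.
End FunctionAlgebra.

(** * Partial fractions on the punctured line *)

Section PartialFractions.
Variables (k : fieldType) (O : comUnitAlgType k) (n : nat) (z : 'I_n -> O).
Hypothesis zU : forall i j, i != j -> z i - z j \is a GRing.unit.
Implicit Types f h : family_coef O n.
Local Notation cst := (@cst_fun k O n).

Definition fpow f (s : nat) : family_coef O n := iter s (fmul f) (cst 1).
Definition fscale a f : family_coef O n := fun p m => a * f p m.

(* phi p has a simple pole at p with principal part t_p^-1 and no other pole. *)
Definition phi (p : option 'I_n) : family_coef O n :=
  if p is Some j then pole_fun z j else z_fun z.

Lemma in_A_phi p : in_A z (phi p).
Proof. by case: p => [j|]; [exact: A_pole|exact: A_z]. Qed.

Lemma in_A_fpow f s : in_A z f -> in_A z (fpow f s).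
Proof. by move=> fA; elim: s => [|s IH]; [exact: A_cst|exact: A_mul]. Qed.

Lemma in_A_phi_pow p s : in_A z (fpow (phi p) s).
Proof. exact: in_A_fpow (in_A_phi p). Qed.

Lemma laurent_phi_pow p s : laurent (fpow (phi p) s).
Proof. exact: in_A_laurent (in_A_phi_pow p s). Qed.

Lemma laurent_phi p : laurent (phi p).
Proof. exact: in_A_laurent (in_A_phi p). Qed.

(** At its own point [phi p] is exactly t_p^-1, so its s-th power has a single term there and
    isolates the mode -s at p. *)
Lemma phi_self p s m : fpow (phi p) s p m = if m == - s%:Z then 1 else 0.
Proof.
elim: s m => [|s IH] m; first by rewrite /= /cst_fun oppr0.
rewrite /= {1}/fmul (_ : phi p p = fun r => if r == -1 then 1 else 0).
  by rewrite mul_coef_delta IH mul1r; congr (if _ then _ else _); apply/eqP/eqP; lia.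
by apply/funext => r; case: p {IH} => [j|] /=; rewrite ?eqxx; case: eqP.
Qed.

Definition fregular f q := forall m : int, m < 0 -> f q m = 0.

Lemma phi_regular p q : p != q -> fregular (phi p) q.
Proof.
case: p q => [j|] [i|] //= pq m m0 /=.
- rewrite ifF; last by apply: contraNF pq => /eqP ->.
  by case: m m0.
- by case: m m0.
- by rewrite !ifF// ?lt_eqF//; lia.
Qed.

Lemma mul_coef_regular (a b : int -> O) :
  (forall m, m < 0 -> a m = 0) -> (forall m, m < 0 -> b m = 0) ->
  [/\ forall m, m < 0 -> mul_coef a b m = 0,
      mul_coef a b 0 = a 0 * b 0 &
      mul_coef a b 1 = a 0 * b 1 + a 1 * b 0].
Proof.
move=> a0 b0; split.
- by move=> m m0; apply: (mul_coef_bound a0 b0); lia.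
- rewrite /mul_coef (@isum1 _ 0) ?subrr// => r r0.
  have [h|h] := ltP r 0; first by rewrite a0 ?mul0r.
  by rewrite [b _]b0 ?mulr0//; lia.
- rewrite /mul_coef (@isumE _ [:: 0; 1]) => [|r].
    by rewrite /= big_cons big_seq1 subr0 subrr.
  rewrite !inE negb_or => /andP[r0 r1].
  have [h|h] := ltP r 0; first by rewrite a0 ?mul0r.
  by rewrite [b _]b0 ?mulr0//; lia.
Qed.

(** The 1-jet is enough for what follows: [quad N] kills primary vectors for N >= 2. *)
Lemma phi_pow_jet p q s : p != q ->
  [/\ fregular (fpow (phi p) s) q,
      fpow (phi p) s q 0 = phi p q 0 ^+ s &
      fpow (phi p) s q 1 = s%:R * phi p q 0 ^+ s.-1 * phi p q 1].
Proof.
move=> pq; elim: s => [|s [IH1 IH2 IH3]].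
  split=> [m m0||]; rewrite /= /cst_fun.
  - by rewrite lt_eqF.
  - by rewrite eqxx.
  - by rewrite mul0r mul0r.
have [F1 F2 F3] := mul_coef_regular (phi_regular pq) IH1.
split; first exact: F1.
  by rewrite /= {1}/fmul F2 IH2 exprS.
rewrite /= {1}/fmul F3 IH2 IH3; case: s {IH1 IH2 IH3 F1 F2 F3} => [|s] /=.
  by rewrite expr0; ring.
by rewrite exprS -[in RHS]addn1 natrD; ring.
Qed.

Inductive pfrac : family_coef O n -> Prop :=
| Pfrac_pow p s : pfrac (fpow (phi p) s)
| Pfrac_add f h : pfrac f -> pfrac h -> pfrac (fadd f h)
| Pfrac_scale a f : pfrac f -> pfrac (fscale a f).

Lemma fscaleE a f : fscale a f = fmul (cst a) f.
Proof. by rewrite fmul_cst. Qed.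

Lemma pfrac_laurent f : pfrac f -> laurent f.
Proof.
elim=> [p s|f1 f2 _ b1 _ b2|a f' _ b]; first exact: laurent_phi_pow.
  exact: laurentD.
by rewrite fscaleE; apply: laurentM => //; exact: laurent_cst.
Qed.

Lemma fmul_scaler a f h : laurent f -> laurent h ->
  fmul f (fscale a h) = fscale a (fmul f h).
Proof.
move=> fb hb; have cb := laurent_cst (n := n) a.
by rewrite !fscaleE -(fmulA fb cb hb) [fmul f _]fmulC fmulA.
Qed.

Lemma zeta_poleE j h : laurent h -> fmul (zeta z j) (fmul (pole_fun z j) h) = h.
Proof.
move=> hb; rewrite -fmulA//; last first.
- exact: (laurent_phi (Some j)).
- exact: in_A_laurent (in_A_zeta z j).
by rewrite zeta_pole// fmul1.
Qed.

Lemma z_pole j : fmul (z_fun z) (pole_fun z j) = fadd (cst 1) (fscale (z j) (pole_fun z j)).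
Proof.
rewrite -(zeta_pole zU j) /zeta fmulDl; last 3 first.
- exact: laurent_z.
- exact: laurent_cst.
- exact: laurent_pole.
apply/funext => p; apply/funext => m; rewrite /fadd fmul_cst /fscale mulNr.
by rewrite subrK.
Qed.

Lemma pole_pole i j : i != j -> fmul (pole_fun z i) (pole_fun z j) =
  fscale (z i - z j)^-1 (fadd (pole_fun z i) (fscale (-1) (pole_fun z j))).
Proof.
move=> ij; have pb s := @laurent_pole k O n z s.
have sb a f : laurent f -> laurent (fscale a f).
  by move=> fb; rewrite fscaleE; apply: laurentM => //; exact: laurent_cst.
apply: (zeta_inj (z := z) zU (j := i)).
- exact: laurentM.
- by apply: (sb); apply: laurentD => //; apply: (sb).
have zb : laurent (zeta z i) := in_A_laurent (in_A_zeta z i).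
rewrite zeta_poleE// fmul_scaler//; last by apply: laurentD => //; exact: sb.
rewrite fmulDr//; last exact: sb.
rewrite fmul_scaler// zeta_pole// /zeta fmulDl//; last 2 first.
- exact: laurent_z.
- exact: laurent_cst.
rewrite z_pole fmul_cst; apply/funext => p; apply/funext => m.
rewrite /fadd /fscale; set A := pole_fun z j p m; set C := cst _ _ _.
have -> : C + -1 * (C + z j * A + - z i * A) = (z i - z j) * A by ring.
by rewrite mulrA mulVr ?zU// mul1r.
Qed.

Lemma phi_phi p q : p != q -> exists a b c, fmul (phi q) (phi p) =
  fadd (fscale a (phi q)) (fadd (fscale b (phi p)) (fscale c (cst 1))).
Proof.
case: p q => [j|] [i|] //= pq.
- have ij : i != j by apply: contraNneq pq => ->.
  exists (z i - z j)^-1, (- (z i - z j)^-1), 0; rewrite pole_pole//.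
  by apply/funext => p; apply/funext => m; rewrite /fadd /fscale; ring.
- exists 0, (z j), 1; rewrite z_pole.
  by apply/funext => p; apply/funext => m; rewrite /fadd /fscale; ring.
- exists (z i), 0, 1; rewrite fmulC z_pole.
  by apply/funext => p; apply/funext => m; rewrite /fadd /fscale; ring.
Qed.

(** By [phi_phi] the product of two distinct generators is a combination of each of them and 1, so
    the case s + 1 reduces to the product of [phi q] with the s-th power of [phi p]. *)
Lemma pfrac_phi_pow q p s : pfrac (fmul (phi q) (fpow (phi p) s)).
Proof.
have [->|pq] := eqVneq p q; first exact: (Pfrac_pow q s.+1).
elim: s => [|s IH].
  by exact: (Pfrac_pow q 1).
have [a [b [c E]]] := phi_phi pq.
have qb := laurent_phi q; have pb := laurent_phi p; have sb := laurent_phi_pow p s.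
have cb x := laurent_cst (n := n) (O := O) x.
have -> : fmul (phi q) (fpow (phi p) s.+1) =
    fadd (fscale a (fmul (phi q) (fpow (phi p) s)))
      (fadd (fscale b (fpow (phi p) s.+1)) (fscale c (fpow (phi p) s))).
  rewrite /= -(fmulA qb pb sb) E !fscaleE !fmulDl//; last 4 first.
  - exact: laurentM.
  - exact: laurentM.
  - exact: laurentM.
  - by apply: laurentD; exact: laurentM.
  by rewrite !(fmulA (cb _))// fmul1.
apply: Pfrac_add; first exact: Pfrac_scale.
by apply: Pfrac_add; apply: Pfrac_scale; [exact: (Pfrac_pow p s.+1)|exact: Pfrac_pow].
Qed.

Lemma pfrac_mul_phi q f : pfrac f -> pfrac (fmul (phi q) f).
Proof.
have qb := laurent_phi q.
elim=> [p s|f1 f2 p1 IH1 p2 IH2|a f' p1 IH]; first exact: pfrac_phi_pow.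
  by rewrite fmulDr//; [exact: Pfrac_add|exact: pfrac_laurent|exact: pfrac_laurent].
by rewrite fmul_scaler//; [exact: Pfrac_scale|exact: pfrac_laurent].
Qed.

Lemma pfrac_mul f h : in_A z f -> pfrac h -> pfrac (fmul f h).
Proof.
move=> fA; elim: fA h => [a||j|f1 f2 A1 IH1 A2 IH2|f1 f2 A1 IH1 A2 IH2] h ph.
- by rewrite -fscaleE; exact: Pfrac_scale.
- exact: (pfrac_mul_phi None).
- exact: (pfrac_mul_phi (Some j)).
- have := fmulDl (in_A_laurent A1) (in_A_laurent A2) (pfrac_laurent ph).
  by rewrite /fadd => ->; apply: Pfrac_add; [exact: IH1|exact: IH2].
- have := fmulA (in_A_laurent A1) (in_A_laurent A2) (pfrac_laurent ph).
  by rewrite {2}/fmul => ->; apply: IH1; exact: IH2.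
Qed.

Lemma in_A_pfrac f : in_A z f -> pfrac f.
Proof.
move=> fA; rewrite -(fmul1 f) fmulC; apply: pfrac_mul => //.
exact: (Pfrac_pow None 0).
Qed.

End PartialFractions.

Arguments phi : simpl never.
Arguments fpow : simpl never.
Lemma big_option (C : nmodType) (I : finType) (P : pred (option I)) (F : option I -> C) :
  \sum_(q | P q) F q = (if P None then F None else 0) + \sum_(i | P (Some i)) F (Some i).
Proof.
rewrite big_mkcond [in RHS]big_mkcond (bigD1 None)//=; congr (_ + _).
rewrite (reindex_omap Some id) => [|[i|]]//.
by apply: eq_bigl => i; rewrite eqxx.
Qed.

(** * Vertical fields on primary vectors *)

Section AntisymmetricSums.
Variables (k : numFieldType) (O : comUnitAlgType k) (C : lmodType O).
Variables (I : finType) (P : pred I) (c : I -> I -> C).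
Hypothesis c_sym : forall i j, c i j = c j i.

Lemma double_eq0 (x : C) : x + x = 0 -> x = 0.
Proof.
move=> xx; have : (2^-1%:A : O) *: (x + x) = 0 by rewrite xx scaler0.
rewrite -mulr2n -scaler_nat scalerA -scalerAl mul1r -[2%:R]/(2%:R).
by rewrite -(scaler_nat 2 (1 : O)) scalerA mulVf ?pnatr_eq0// !scale1r.
Qed.

(* [h] accounts for multiples of the relations [\sum_i c i j = 0]. *)
Lemma symmetric_sum0 (A : I -> I -> O) (h : I -> O) :
  (forall j, P j -> h j *: \sum_(i | P i) c i j = 0) ->
  (forall i j, P i -> P j -> A i j + A j i = h i + h j) ->
  \sum_(i | P i) \sum_(j | P j) A i j *: c i j = 0.
Proof.
move=> hc Ah; apply: double_eq0; rewrite [X in _ + X]exchange_big -big_split/=.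
transitivity (\sum_(i | P i) \sum_(j | P j) (h i *: c j i + h j *: c i j)).
  apply: eq_bigr => i Pi; rewrite -big_split/=; apply: eq_bigr => j Pj.
  by rewrite (c_sym j i) -!scalerDl Ah.
transitivity (\sum_(i | P i) (\sum_(j | P j) h i *: c j i) +
              \sum_(j | P j) (\sum_(i | P i) h j *: c i j)).
  rewrite [X in _ = _ + X]exchange_big -big_split/=; apply: eq_bigr => i Pi.
  by rewrite -big_split.
by rewrite !big1 ?addr0// => j Pj; rewrite -scaler_sumr hc.
Qed.

End AntisymmetricSums.

Section Primary.
Variables (k : numClosedFieldType) (g : lieAlgebra k) (B : g -> g -> k).
Variables (X : (\dim {:g}).-tuple g) (hc : k) (l n : nat).
Variables (O : comUnitAlgType k) (z : 'I_n -> O) (W C : lmodType O).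
Hypothesis zU : forall i j, i != j -> z i - z j \is a GRing.unit.
Variable M : option 'I_n -> g -> int -> W -> W.
Hypothesis affM : forall p, affine_action B l (M p).
Hypothesis commM : forall p q x y m r u, p != q ->
  M p x m (M q y r u) = M q y r (M p x m u).
Variable blk : W -> C.
Hypothesis blk_linear : linear blk.
Hypothesis blk0 : forall x f u, in_A z f -> blk (lact M x f u) = 0.

Let blkD : {morph blk : u v / u + v} := linear_mapD blk_linear.
Let blkZ : forall a u, blk (a *: u) = a *: blk u := linear_mapZ blk_linear.
Let blk00 : blk 0 = 0 := linear_map0 blk_linear.

Lemma blk_sum (I : Type) (r : seq I) (Q : pred I) (F : I -> W) :
  blk (\sum_(i <- r | Q i) F i) = \sum_(i <- r | Q i) blk (F i).
Proof. exact: (big_morph blk blkD blk00). Qed.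

(** The relation used is the one for x and the s-th power of [phi p]. Any other point sees only its
    constant term, since u is killed there by positive modes. For s = 0 the function is 1 and this
    is invariance under g. *)
Lemma move_pole p s x u :
  (forall q m, q != p -> 0 < m -> M q x m u = 0) ->
  blk (M p x (- s%:Z) u) =
  - \sum_(q | q != p) phi z p q 0 ^+ s *: blk (M q x 0 u).
Proof.
move=> H; have := blk0 x u (in_A_phi_pow z p s).
rewrite /lact (bigD1 p)//= blkD => /eqP; rewrite addr_eq0 => /eqP.
rewrite [loop (M p) _ _ _](@isum1 _ (- s%:Z)) => [|m ms]; last first.
  by rewrite phi_self (negPf ms) scale0r.
rewrite phi_self eqxx scale1r => ->; rewrite blk_sum; congr (- _); apply: eq_bigr => q qp.
have pq : p != q by rewrite eq_sym.
have [F1 F2 _] := phi_pow_jet z s pq.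
rewrite /loop (@isum1 _ 0) => [|m m0]; first by rewrite F2 blkZ.
have [h|h] := ltP m 0; first by rewrite F1 ?scale0r.
by rewrite H ?scaler0// lt_neqAle eq_sym m0.
Qed.

Section Vector.
Variable u : W.
Hypothesis u_pos : forall p x m, 0 < m -> M p x m u = 0.
Hypothesis u_inf : forall x, M None x 0 u = 0.

Definition cas (q q' : option 'I_n) : C :=
  \sum_i blk (M q (tnth X i) 0 (M q' (tnth X i) 0 u)).

Lemma casC q q' : cas q q' = cas q' q.
Proof.
have [->//|qq'] := eqVneq q q'.
by apply: eq_bigr => i _; rewrite commM.
Qed.

Lemma cas_inf q : cas q None = 0.
Proof.
by apply: big1 => i _; rewrite u_inf (act0r (affM q)) blk00.
Qed.

Lemma cas_inf' q : cas None q = 0. Proof. by rewrite casC cas_inf. Qed.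

Lemma pos_zero_mode p q x y m : 0 < m -> M p x m (M q y 0 u) = 0.
Proof.
move=> m0; have [<-|pq] := eqVneq p q; last by rewrite commM// u_pos// (act0r (affM q)).
rewrite (act_commD (affM p)) !u_pos ?addr0// (act0r (affM p)) add0r.
by rewrite gt_eqF// mulr0 !mul0r !scale0r.
Qed.

Lemma move_zero_mode p q x y s :
  blk (M p x (- s%:Z) (M q y 0 u)) =
  - \sum_(r | r != p) phi z p r 0 ^+ s *: blk (M r x 0 (M q y 0 u)).
Proof. by apply: move_pole => r m rp m0; exact: pos_zero_mode. Qed.

(** The outcome, up to sign, of moving X_i(-t) away from p in X_i(-t) X_i(0) u and summing over i;
    [gas] is the outcome for X_i(-s) X_i(-t) u, where both modes leave p. *)
Definition kas p t : C := \sum_(q | q != p) phi z p q 0 ^+ t *: cas q p.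

Lemma move_kas p t :
  \sum_i blk (M p (tnth X i) (- t%:Z) (M p (tnth X i) 0 u)) = - kas p t.
Proof.
under eq_bigr => i _ do rewrite move_zero_mode.
rewrite sumrN exchange_big; congr (- _); apply: eq_bigr => q _.
by rewrite -scaler_sumr.
Qed.

Definition gas p s t : C :=
  \sum_(q | q != p) \sum_(q' | q' != p)
    (phi z p q 0 ^+ s * phi z p q' 0 ^+ t) *: cas q q'.

Lemma gasC p s t : gas p s t = gas p t s.
Proof.
rewrite /gas exchange_big; apply: eq_bigr => q _; apply: eq_bigr => q' _.
by rewrite casC mulrC.
Qed.

(** The outer mode leaves p first and then commutes past the inner one, which is moved in turn; the
    two signs cancel. *)
Lemma move_gas p s t :
  \sum_i blk (M p (tnth X i) (- s%:Z) (M p (tnth X i) (- t%:Z) u)) = gas p s t.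
Proof.
have E i : blk (M p (tnth X i) (- s%:Z) (M p (tnth X i) (- t%:Z) u)) =
    \sum_(q | q != p) \sum_(q' | q' != p) (phi z p q 0 ^+ s * phi z p q' 0 ^+ t) *:
       blk (M q' (tnth X i) 0 (M q (tnth X i) 0 u)).
  rewrite move_pole => [|q m qp m0]; last first.
    by rewrite commM// u_pos// (act0r (affM p)).
  rewrite -sumrN; apply: eq_bigr => q qp.
  rewrite commM// move_zero_mode scalerN opprK scaler_sumr.
  by apply: eq_bigr => q' _; rewrite scalerA.
under eq_bigr => i _ do rewrite E.
rewrite exchange_big; apply: eq_bigr => q _.
rewrite exchange_big; apply: eq_bigr => q' _.
by rewrite casC -scaler_sumr.
Qed.

Lemma quad_high p N : 2 <= N -> quad (M p) X N u = 0.
Proof.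
move=> N2; apply: isum0 => r; apply: (nord_bound (affM p) X (b := 1)).
  by move=> x m m1; apply: u_pos; lia.
by lia.
Qed.

Lemma quad_zero p : blk (quad (M p) X 1 u) = cas p p.
Proof.
rewrite /quad (@isum1 _ 0) => [|r r0]; last first.
  apply: (nord_bound (affM p) X (b := 1)) => [x m m1|]; first by apply: u_pos; lia.
  by lia.
rewrite /nord blk_sum; apply: eq_bigr => i _.
by rewrite /normal_order lexx.
Qed.

(** Only pairs of nonpositive modes of total degree -t - 1 survive on u. Both extreme pairs are
    ordered with the zero mode on the right, hence twice [kas]; the t pairs in between consist of
    two negative modes. *)
Lemma quad_low p t : blk (quad (M p) X (- t%:Z) u) =
  - (kas p t.+1 + kas p t.+1) + \sum_(0 <= s < t) gas p s.+1 (t - s).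
Proof.
pose r := [seq - s%:Z | s <- iota 0 t.+2].
have ur : uniq r by rewrite map_inj_uniq ?iota_uniq// => a b /oppr_inj [].
rewrite /quad (@isumE _ r) => [|m mr]; last first.
  apply: (nord_bound (affM p) X (b := 1)) => [x m' m1|]; first by apply: u_pos; lia.
  have [|m0] := leP 1 m; first by rewrite orbT.
  rewrite orbF; have [//|h] := leP 1 (- t%:Z - m - 1).
  case/negP: mr; apply/mapP; exists (absz m); last by lia.
  by rewrite mem_iota; lia.
rewrite undup_id// blk_sum /r big_map -[iota _ _]/(index_iota 0 t.+2).
rewrite big_nat_recl//= big_nat_recr//=.
have E0 : blk (nord (M p) X (- t%:Z) (- 0%N%:Z) u) = - kas p t.+1.
  rewrite -move_kas /nord blk_sum; apply: eq_bigr => i _; rewrite /normal_order ifT; last by lia.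
  by congr (blk (M p _ _ (M p _ _ u))); lia.
have E1 : blk (nord (M p) X (- t%:Z) (- t.+1%:Z) u) = - kas p t.+1.
  rewrite -move_kas /nord blk_sum; apply: eq_bigr => i _; rewrite /normal_order ifF; last by lia.
  by congr (blk (M p _ _ (M p _ _ u))); lia.
rewrite E0 E1 addrCA -opprD addrC; congr (_ + _).
rewrite !big_nat; apply: eq_bigr => s /andP[_ st].
rewrite /nord blk_sum -(move_gas p).
have [le|lt] := leP (- t%:Z - - s.+1%:Z - 1) (- s.+1%:Z).
  rewrite move_gas gasC -move_gas; apply: eq_bigr => i _; rewrite /normal_order le.
  by congr (blk (M p _ _ (M p _ _ u))); lia.
apply: eq_bigr => i _; rewrite /normal_order leNgt lt /=.
by congr (blk (M p _ _ (M p _ _ u))); lia.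
Qed.

(* The field a d/dz; at infinity d/dz = - t^2 d/dt, whence the shift by 2. *)
Definition vf (a : family_coef O n) : family_coef O n :=
  fun p m => if p is Some i then a p m else - a p (m - 2).

Lemma laurent_vf a : laurent a -> laurent (vf a).
Proof.
move=> ab [i|]; first exact: ab.
by have [b H] := ab None; exists (b + 2) => m h /=; rewrite H ?oppr0//; lia.
Qed.

Definition vfsum a : C := \sum_p blk (sug (M p) X (vf a p) u).

Lemma vfsumD a b : laurent a -> laurent b -> vfsum (fadd a b) = vfsum a + vfsum b.
Proof.
move=> ab bb; rewrite /vfsum -big_split; apply: eq_bigr => p _ /=.
have -> : vf (fadd a b) p = fun m => vf a p m + vf b p m.
  by apply/funext => m; case: p => [i|] //=; rewrite opprD.
by rewrite (sug_coefD (affM p)) ?blkD//; exact: laurent_vf.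
Qed.

Lemma vfsumZ c a : laurent a -> vfsum (fscale c a) = c *: vfsum a.
Proof.
move=> ab; rewrite /vfsum scaler_sumr; apply: eq_bigr => p _ /=.
have -> : vf (fscale c a) p = fun m => c * vf a p m.
  by apply/funext => m; case: p => [i|] //=; rewrite mulrN.
by rewrite (sug_coefZ (affM p)) ?blkZ//; exact: laurent_vf.
Qed.

Lemma sug_regular q e : (forall m, m < 0 -> e m = 0) ->
  blk (sug (M q) X e u) = - (e 0 *: (kas q 1 + kas q 1)) + e 1 *: cas q q.
Proof.
move=> e0; rewrite /sug (@isumE _ [:: 0; 1]) => [|m].
  rewrite /= big_cons big_seq1 blkD !blkZ quad_zero -scalerN.
  have := quad_low q 0; rewrite big_nil addr0 => E.
  by congr (_ *: _ + _); rewrite -E.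
rewrite !inE negb_or => /andP[m0 m1].
have [h|h] := ltP m 0; first by rewrite e0 ?scale0r.
by rewrite quad_high ?scaler0//; lia.
Qed.

Lemma sug_delta q e (N : int) (a : O) : e = (fun m => if m == N then a else 0) ->
  blk (sug (M q) X e u) = a *: blk (quad (M q) X N u).
Proof.
move=> ->; rewrite /sug (@isum1 _ N) ?eqxx ?blkZ// => m /negPf ->.
by rewrite scale0r.
Qed.

Let c i j := cas (Some i) (Some j).
(** This is (z_j - z_i)^-1 for i != j, and 0 for i = j. *)
Let v i j := phi z (Some i) (Some j) 0.

Lemma v_self i : v i i = 0.
Proof. by rewrite /v /phi /= eqxx. Qed.

Lemma v_opp i j : v i j = - v j i.
Proof.
have [->|ij] := eqVneq i j; first by rewrite v_self oppr0.
rewrite /v /phi /= eq_sym (negPf ij) !expr0 !mul1r !expr1 -invrN; congr (_^-1).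
by rewrite opprB.
Qed.

Lemma kas_pole i : kas (Some i) 1 = \sum_j v i j *: c i j.
Proof.
rewrite /kas big_option/= cas_inf' scaler0 add0r.
rewrite [RHS](bigD1 i)//= v_self scale0r add0r.
by apply: eq_big => [j|j _]; rewrite ?expr1 ?(casC (Some j)).
Qed.

Lemma kas_pole_pow j t : kas (Some j) t = \sum_(i | i != j) v j i ^+ t *: c i j.
Proof. by rewrite /kas big_option/= cas_inf' scaler0 add0r; apply: eq_bigl. Qed.

Lemma gas_pole j s t : gas (Some j) s t =
  \sum_(i | i != j) \sum_(i' | i' != j) (v j i ^+ s * v j i' ^+ t) *: c i i'.
Proof.
rewrite /gas big_option/= big1 ?add0r => [|q _]; last by rewrite cas_inf' scaler0.
apply: eq_big => [i|i _]; first by [].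
rewrite big_option/= cas_inf scaler0 add0r.
by apply: eq_bigl.
Qed.

Lemma kas_inf t : kas None t = 0.
Proof. by apply: big1 => q _; rewrite cas_inf scaler0. Qed.

Lemma gas_inf s t : gas None s t =
  \sum_i \sum_j (z i ^+ s * z j ^+ t) *: c i j.
Proof.
rewrite /gas big_option/= add0r.
apply: eq_bigr => i _; rewrite big_option/= add0r.
by apply: eq_bigr => j _.
Qed.

(** The case s = 0 of [move_zero_mode] based at infinity, where u is killed by g. *)
Lemma cas_invariant i : \sum_j c j i = 0.
Proof.
have E : \sum_j c j i = \sum_r - blk (M None (tnth X r) (- 0%N%:Z) (M (Some i) (tnth X r) 0 u)).
  rewrite /c /cas exchange_big; apply: eq_bigr => r _.
  rewrite move_zero_mode opprK big_option/= add0r.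
  by apply: eq_bigr => j _; rewrite expr0 scale1r.
rewrite E big1// => r _; rewrite oppr0 commM// u_inf (act0r (affM _)) blk00.
by rewrite oppr0.
Qed.

Lemma dbl_scale (a : O) (x : C) : a *: (x + x) = (2 * a) *: x.
Proof. by rewrite scalerDr -scalerDl; congr (_ *: _); ring. Qed.

(** For a = (z_i - z_j)^-1, b = (z_i' - z_j)^-1 and t = (z_i' - z_i)^-1 the hypothesis is the
    partial fraction identity. It matches the differences of powers coming from [kas] with the sums
    coming from [gas]. *)
Lemma subrXX_unit (a b t : O) m : (a - b) * t = a * b ->
  (a ^+ m - b ^+ m) * t = \sum_(0 <= r < m) a ^+ r.+1 * b ^+ (m - r).
Proof.
move=> E; rewrite subrXX mulrAC E mulr_sumr [RHS]big_nat_rev/= add0n big_mkord.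
apply: eq_bigr => r _; have rm := ltn_ord r.
rewrite (_ : (m - (m - r.+1) = r.+1)%N); last by lia.
rewrite (_ : (m.-1 - r = m - r.+1)%N); last by lia.
by rewrite exprS (exprS b); ring.
Qed.

Lemma vfsum_pole j s : vfsum (fpow (phi z (Some j)) s) = 0.
Proof.
have reg q : q != Some j -> [/\ fregular (fpow (phi z (Some j)) s) q,
  fpow (phi z (Some j)) s q 0 = phi z (Some j) q 0 ^+ s &
  fpow (phi z (Some j)) s q 1 = s%:R * phi z (Some j) q 0 ^+ s.-1 * phi z (Some j) q 1].
  by move=> qj; apply: phi_pow_jet; rewrite eq_sym.
rewrite /vfsum big_option/=.
have [r0 _ _] := reg None isT.
rewrite (@sug_regular None) => [|m m0]; last by rewrite /= r0 ?oppr0//; lia.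
rewrite /= !r0// oppr0 !scale0r oppr0 addr0 add0r.
rewrite (bigD1 j)//= (@sug_delta (Some j) _ (- s%:Z) 1); last first.
  by apply/funext => m; exact: (phi_self z (Some j)).
rewrite scale1r quad_low kas_pole_pow.
(* The terms of A come from the pairs of negative modes at z_j, from the constant term of the field
   at z_i, and from its linear term times the Casimir element at z_i. The multiples of [c i j] given
   by [kas] at z_j cancel the terms i' = j of [kas] at z_i. *)
pose A i i' : O := \sum_(0 <= r < s) v j i ^+ r.+1 * v j i' ^+ (s - r)
  - 2 * v j i ^+ s * v i i' + (if i == i' then s%:R * v j i ^+ s.-1 * (- v j i ^+ 2) else 0).
transitivity (\sum_(i | i != j) \sum_(i' | i' != j) A i i' *: c i i').
  under [X in _ + X + _]eq_bigr => r _ do rewrite gas_pole.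
  rewrite exchange_big -big_split -sumrN -!big_split/=; apply: eq_bigr => i ij.
  have ji : Some i != Some j by apply: contraNneq ij => -[->].
  have [R0 R1 R2] := reg (Some i) ji.
  rewrite (@sug_regular (Some i)) => [|m m0]; last by rewrite /= R0.
  rewrite [vf _ _ 0]R1 [vf _ _ 1]R2 kas_pole -/(v j i) dbl_scale.
  rewrite (bigD1 j)//= scalerDr opprD.
  have -> : phi z (Some j) (Some i) 1 = - v j i ^+ 2.
    by rewrite /v /phi /= (negPf ij) !expr1 !expr0 mul1r mulN1r.
  rewrite scalerA (_ : 2 * v j i ^+ s * v i j = - (v j i ^+ s.+1 + v j i ^+ s.+1)); last first.
    by rewrite (v_opp i j) exprS; ring.
  rewrite scaleNr [(_ + _) *: c i j]scalerDl exchange_big/= -/(c i i).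
  have -> : \sum_(i' | i' != j) A i i' *: c i i' =
    \sum_(i' | i' != j) \sum_(0 <= r < s) (v j i ^+ r.+1 * v j i' ^+ (s - r)) *: c i i'
    - 2 * v j i ^+ s *: (\sum_(i' | i' != j) v i i' *: c i i')
    + (s%:R * v j i ^+ s.-1 * (- v j i ^+ 2)) *: c i i.
    rewrite scaler_sumr -sumrN [X in _ = _ + X](_ : _ = \sum_(i' | i' != j)
       (if i == i' then s%:R * v j i ^+ s.-1 * (- v j i ^+ 2) else 0) *: c i i').
      rewrite -!big_split; apply: eq_bigr => i' _ /=.
      by rewrite /A !scalerDl scaleNr scaler_suml scalerA.
    rewrite (bigD1 i)//= eqxx big1 ?addr0// => i' /andP[_ ii'].
    by rewrite eq_sym (negPf ii') scale0r.
  set T1 := \sum_(i' | i' != j) v i i' *: c i i'.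
  set T2 := \sum_(i' | i' != j) \sum_(0 <= r < s) _.
  set T3 := _ *: c i i; set T4 := _ *: c i j; set T5 := _ *: T1.
  zmod.
(* Here A is antisymmetric by itself, so h = 0. *)
apply: (@symmetric_sum0 k O C _ _ c _ A (fun _ => 0)) => [i i'|i' _|i i' ij i'j].
- exact: casC.
- by rewrite scale0r.
rewrite addr0 /A (eq_sym i').
have [<-|ii'] := eqVneq i i'.
  rewrite v_self mulr0 subr0; have -> : \sum_(0 <= r < s) v j i ^+ r.+1 * v j i ^+ (s - r) =
     s%:R * v j i ^+ s.+1.
    rewrite (eq_big_nat _ _ (F2 := fun=> v j i ^+ s.+1)) => [|r /andP[_ rs]].
      by rewrite sumr_const_nat subn0 mulr_natl.
    by rewrite -exprD; congr (_ ^+ _); lia.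
  case: s {reg A r0} => [|s']; first by ring.
  by rewrite /= exprS exprS; ring.
rewrite !addr0 (v_opp i' i).
have E : (v j i - v j i') * v i i' = v j i * v j i'.
  have U1 := zU ij; have U2 := zU i'j; have U3 : z i' - z i \is a GRing.unit by rewrite zU// eq_sym.
  rewrite /v /phi /= (negPf ij) (negPf i'j) eq_sym (negPf ii') !expr0 !mul1r !expr1.
  apply: (mulIr U3); rewrite -mulrA mulVr// mulr1.
  apply: (mulIr U1); apply: (mulIr U2).
  have -> : ((z i - z j)^-1 - (z i' - z j)^-1) * (z i - z j) * (z i' - z j) =
    ((z i - z j)^-1 * (z i - z j)) * (z i' - z j) - ((z i' - z j)^-1 * (z i' - z j)) * (z i - z j).
    by ring.
  have -> : (z i - z j)^-1 * (z i' - z j)^-1 * (z i' - z i) * (z i - z j) * (z i' - z j) =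
    ((z i - z j)^-1 * (z i - z j)) * ((z i' - z j)^-1 * (z i' - z j)) * (z i' - z i) by ring.
  by rewrite !mulVr//; ring.
have S1 := subrXX_unit s E.
have S2 : \sum_(0 <= r < s) v j i' ^+ r.+1 * v j i ^+ (s - r) =
  \sum_(0 <= r < s) v j i ^+ r.+1 * v j i' ^+ (s - r).
  rewrite big_nat_rev/= add0n !big_nat; apply: eq_bigr => r /andP[_ rs].
  rewrite mulrC; congr (_ ^+ _ * _ ^+ _); lia.
by rewrite S2 -S1; ring.
Qed.

Lemma vfsum_inf s : vfsum (fpow (phi z None) s) = 0.
Proof.
have reg i : [/\ fregular (fpow (phi z None) s) (Some i),
  fpow (phi z None) s (Some i) 0 = z i ^+ s &
  fpow (phi z None) s (Some i) 1 = s%:R * z i ^+ s.-1].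
  have [] := phi_pow_jet z s (p := None) (q := Some i) isT.
  by rewrite /phi /= mulr1.
have Einf : blk (sug (M None) X (vf (fpow (phi z None) s) None) u) =
    - \sum_(0 <= r < s.-2) gas None r.+1 (s.-2 - r).
  rewrite (@sug_delta None _ (2 - s%:Z) (-1)); last first.
    apply/funext => m; rewrite /vf /= phi_self.
    rewrite (_ : (m - 2 == - s%:Z) = (m == 2 - s%:Z)); last by apply/eqP/eqP; lia.
    by case: ifP; rewrite ?oppr0.
  (* For s = 0 and s = 1 the operators at infinity are [quad 2] and [quad 1], which vanish on u;
     from s = 2 on [quad_low] applies with t = s - 2, and its [kas] terms are zero. *)
  rewrite scaleN1r; congr (- _); case: s {reg} => [|[|s]].
  - by rewrite quad_high// blk00 big_nil.
  - by rewrite quad_zero cas_inf big_nil.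
  - rewrite (_ : 2 - s.+2%:Z = - s%:Z); last by lia.
    by rewrite quad_low kas_inf addr0 oppr0 add0r.
rewrite /vfsum big_option/= Einf.
pose A i i' : O := - (2 * z i ^+ s * v i i') - \sum_(0 <= r < s.-2) z i ^+ r.+1 * z i' ^+ (s.-2 - r)
  + (if i == i' then s%:R * z i ^+ s.-1 else 0).
transitivity (\sum_i \sum_i' A i i' *: c i i').
  under [X in - X + _]eq_bigr => r _ do rewrite gas_inf.
  rewrite exchange_big -sumrN -!big_split/=; apply: eq_bigr => i _.
  have [R0 R1 R2] := reg i.
  rewrite (@sug_regular (Some i)) => [|m m0]; last by rewrite /= R0.
  rewrite [vf _ _ 0]R1 [vf _ _ 1]R2 kas_pole dbl_scale exchange_big/= -/(c i i).
  have -> : \sum_i' A i i' *: c i i' =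
    - (2 * z i ^+ s *: (\sum_i' v i i' *: c i i'))
    - \sum_i' \sum_(0 <= r < s.-2) (z i ^+ r.+1 * z i' ^+ (s.-2 - r)) *: c i i'
    + (s%:R * z i ^+ s.-1) *: c i i.
    rewrite scaler_sumr -!sumrN [X in _ = _ + X](_ : _ = \sum_i'
       (if i == i' then s%:R * z i ^+ s.-1 else 0) *: c i i').
      rewrite -!big_split; apply: eq_bigr => i' _ /=.
      by rewrite /A !scalerDl !scaleNr scaler_suml scalerA.
    rewrite (bigD1 i)//= eqxx big1 ?addr0// => i' ii'.
    by rewrite eq_sym (negPf ii') scale0r.
  set T1 := _ *: \sum_i' v i i' *: c i i'.
  set T2 := \sum_i' \sum_(0 <= r < s.-2) _.
  set T3 := _ *: c i i.
  zmod.
(* Here A i i' + A i' i is 0 for s = 0, 2 for s = 1, and 2 (z_i^(s-1) + z_i'^(s-1)) for s >= 2,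
   which dictates h; these terms are multiples of the relations [cas_invariant]. *)
apply: (@symmetric_sum0 k O C _ _ c _ A
  (fun i => match s with 0 => 0 | 1 => 1 | _ => 2 * z i ^+ s.-1 end)).
- by move=> i i'; exact: casC.
- by move=> i' _; rewrite cas_invariant scaler0.
move=> i i' _ _; rewrite /A (eq_sym i').
have [<-|ii'] := eqVneq i i'.
  rewrite v_self mulr0 oppr0 add0r.
  have -> : \sum_(0 <= r < s.-2) z i ^+ r.+1 * z i ^+ (s.-2 - r) = s.-2%:R * z i ^+ s.-1.
    rewrite (eq_big_nat _ _ (F2 := fun=> z i ^+ s.-1)) => [|r /andP[_ rs]].
      by rewrite sumr_const_nat subn0 mulr_natl.
    by rewrite -exprD; congr (_ ^+ _); lia.
  case: s {reg Einf A} => [|[|s]] /=; ring.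
rewrite !addr0 (v_opp i' i).
have E : (z i - z i') * v i i' = -1.
  rewrite /v /phi /= eq_sym (negPf ii') expr0 mul1r expr1.
  by rewrite -opprB mulNr divrr// zU// eq_sym.
have S2 : \sum_(0 <= r < s.-2) z i' ^+ r.+1 * z i ^+ (s.-2 - r) =
  \sum_(0 <= r < s.-2) z i ^+ r.+1 * z i' ^+ (s.-2 - r).
  rewrite big_nat_rev/= add0n !big_nat; apply: eq_bigr => r /andP[_ rs].
  rewrite mulrC; congr (_ ^+ _ * _ ^+ _); lia.
rewrite S2.
have -> : forall Q, - (2 * z i ^+ s * v i i') - Q + (- (2 * z i' ^+ s * - v i i') - Q) =
    - (2 * ((z i ^+ s - z i' ^+ s) * v i i')) - 2 * Q by move=> Q; ring.
rewrite subrXX mulrAC E; case: s {reg Einf A S2} => [|[|s]] /=.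
- by rewrite big_ord0 big_nil; ring.
- by rewrite big_ord1 big_nil; ring.
have -> : \sum_(r < s.+2) z i ^+ (s.+1 - r) * z i' ^+ r =
    z i ^+ s.+1 + (\sum_(0 <= r < s) z i ^+ r.+1 * z i' ^+ (s - r) + z i' ^+ s.+1).
  rewrite big_ord_recl big_ord_recr/= subn0 expr0 mulr1 /bump /= add1n subnn mul1r.
  congr (_ + (_ + _)); rewrite [RHS]big_nat_rev/= add0n big_mkord.
  apply: eq_bigr => r _; have rs := ltn_ord r.
  by rewrite add1n; congr (_ ^+ _ * _ ^+ _); lia.
ring.
Qed.

Lemma vfsum_pfrac a : pfrac z a -> vfsum a = 0.
Proof.
elim=> [[j|] s|f h pf IH1 ph IH2|b f pf IH].
- exact: vfsum_pole.
- exact: vfsum_inf.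
- rewrite vfsumD; [|exact: (pfrac_laurent pf)|exact: (pfrac_laurent ph)].
  by rewrite IH1 IH2 addr0.
- by rewrite vfsumZ ?IH ?scaler0//; exact: (pfrac_laurent pf).
Qed.

Lemma tsug_vf a : in_A z a -> blk (tsug X hc l M (vf a) u) = 0.
Proof.
move=> aA; rewrite /tsug blkZ blk_sum -/(vfsum a) vfsum_pfrac ?scaler0//.
exact: in_A_pfrac.
Qed.

(** The vertical field is the constant -Y z_i at each z_i, so only [quad 0] occurs, and its two
    equal [kas] terms cancel the 2 in the normalization. *)
Lemma tsug_lift0 (Y : O -> O) :
  blk (tsug X hc l M (lift0_field z Y) u) =
  - ((l%:R + hc)^-1%:A *: \sum_i \sum_(j | j != i)
       (Y (z i) / (z j - z i)) *: cas (Some i) (Some j)).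
Proof.
rewrite /tsug blkZ blk_sum big_option/=.
rewrite (_ : sug (M None) X _ u = 0) ?blk00 ?add0r; last first.
  by apply: isum0 => m; rewrite scale0r.
have E i : blk (sug (M (Some i)) X (lift0_field z Y (Some i)) u) =
    (2 : O) *: \sum_(j | j != i) (Y (z i) / (z j - z i)) *: cas (Some i) (Some j).
  rewrite (@sug_delta (Some i) _ 0 (- Y (z i)))//.
  have := quad_low (Some i) 0; rewrite big_nil addr0 oppr0 => ->.
  rewrite kas_pole (bigD1 i)//= v_self scale0r add0r scalerN scaleNr opprK dbl_scale.
  rewrite -scalerA; congr (_ *: _); rewrite scaler_sumr; apply: eq_bigr => j ji.
  rewrite scalerA; congr (_ *: _); congr (_ * _).
  by rewrite /v /phi /= (negPf ji) expr0 mul1r expr1.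
under eq_bigr => i _ do rewrite E.
rewrite -scaler_sumr scalerA -scaleNr; congr (_ *: _).
rewrite scaleNr mulNr -scalerAl mul1r; congr (- _).
have -> : (2 : O) = (2 : k)%:A by rewrite scaler_nat.
rewrite scalerA; congr (_ *: _).
by rewrite invfM mulrAC mulVf ?mul1r// pnatr_eq0.
Qed.

End Vector.
End Primary.

(** * The level is not critical *)

Section MatrixFacts.
Variable k : numClosedFieldType.

(** After Schur triangularization the trace is the sum of the squares of the diagonal entries, which
    are eigenvalues. *)
Lemma trace_sq_int_ge0 d (A : 'M[k]_d) :
  (forall a, eigenvalue A a -> exists m : int, a = m%:~R) -> 0 <= \tr (A *m A).
Proof.
move=> Aint; case: d A Aint => [|d] A Aint.
  by rewrite /mxtrace big_ord0.
have [P Pu] := Schur A (ltn0Sn d); rewrite /similar_to; set T := conjmx P A => Ttrig.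
have Punit : P \in unitmx by exact: unitarymx_unit.
have PT : P *m A = T *m P by rewrite /T conjumx// mulmxKV.
have -> : \tr (A *m A) = \tr (T *m T).
  have -> : T = P *m A *m invmx P by rewrite /T conjumx.
  by rewrite !mulmxA mulmxKV// [RHS]mxtrace_mulC !mulmxA mulVmx// mul1mx.
have Tint i : exists m : int, T i i = m%:~R.
  apply: Aint; have : eigenvalue T (T i i).
    rewrite eigenvalue_root_char char_poly_trig//.
    rewrite -(big_map (fun i => T i i) xpredT (fun r => 'X - r%:P)) root_prod_XsubC.
    by apply: map_f; exact: mem_index_enum.
  move=> /eigenvalueP[v vT v0]; apply/eigenvalueP; exists (v *m P).
    by rewrite -mulmxA PT mulmxA vT scalemxAl.
  by apply: contra_neq v0 => vP0; rewrite -(mulmxK Punit v) vP0 mul0mx.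
have /is_trig_mxP Tz := Ttrig.
apply: sumr_ge0 => i _; rewrite mxE (bigD1 i)//= big1 ?addr0.
  have [m ->] := Tint i; by rewrite -intrM ler0z -expr2 sqr_ge0.
move=> j ji; have [ij|ji'] := ltnP i j; first by rewrite Tz ?mul0r.
by rewrite [T j i]Tz ?mulr0// ltn_neqAle ji' andbT.
Qed.

Lemma nilpotent_mx d (A : 'M[k]_d) : (forall a, eigenvalue A a -> a = 0) ->
  exists m, forall v : 'rV_d, iter m (mulmx^~ A) v = 0.
Proof.
case: d A => [|d] A A0; first by exists 0%N => v; apply/rowP => -[].
have [rs E] := closed_field_poly_normal (char_poly A).
rewrite (monicP (char_poly_monic A)) scale1r in E.
have rs0 r : r \in rs -> r = 0.
  by move=> rrs; apply: A0; rewrite eigenvalue_root_char E root_prod_XsubC.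
have := Cayley_Hamilton A; rewrite E big_seq (eq_bigr (fun=> 'X)); last first.
  by move=> r /rs0 ->; rewrite subr0.
rewrite -big_seq big_const_seq count_predT -Monoid.iteropE rmorphXn/= horner_mx_X => An0.
exists (size rs) => v.
have -> : iter (size rs) (mulmx^~ A) v = v *m A ^+ size rs.
  elim: (size rs) => [|m IH]; first by rewrite expr0 mulmx1.
  by rewrite iterS IH exprSr mulmxA.
by rewrite An0 mulmx0.
Qed.

(* The powers of N are eigenvectors of [P |-> P A - A P] for distinct eigenvalues. *)
Lemma shift_nilpotent_mx d (A N : 'M[k]_d) (a : k) : a != 0 ->
  N *m A - A *m N = a *: N -> exists m, forall v : 'rV_d, iter m (mulmx^~ N) v = 0.
Proof.
move=> a0 AN; case: d A N AN => [|d] A N AN.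
  by exists 0%N => v; apply/rowP => -[].
have comm m : N ^+ m *m A - A *m N ^+ m = (m%:R * a) *: N ^+ m.
  elim: m => [|m IH]; first by rewrite mul0r scale0r mulmx1 mul1mx subrr.
  have -> : N ^+ m.+1 *m A - A *m N ^+ m.+1 =
      N *m (N ^+ m *m A - A *m N ^+ m) + (N *m A - A *m N) *m N ^+ m.
    rewrite exprS -mulmxE mulmxBr mulmxBl !mulmxA.
    by rewrite addrA subrK.
  rewrite IH AN -scalemxAr -scalemxAl -scalerDl mulmxE -exprS.
  by congr (_ *: _); rewrite -addn1 natrD; ring.
pose T := lin_mx (mulmxr A) - lin_mx (mulmx A) : 'M[k]_(d.+1 * d.+1).
have TE (P : 'M_d.+1) : mxvec P *m T = mxvec (P *m A - A *m P).
  by rewrite mulmxBr !mul_vec_lin linearB.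
suff [m Nm] : exists m, N ^+ m = 0.
  exists m => v; have -> : iter m (mulmx^~ N) v = v *m N ^+ m.
    elim: m {Nm} => [|m IH]; first by rewrite expr0 mulmx1.
    by rewrite iterS IH exprSr mulmxA.
  by rewrite Nm mulmx0.
apply: contrapT => Nn; have N0 m : N ^+ m != 0.
  by apply/eqP => Nm; apply: Nn; exists m.
(* There is one more eigenvalue here than the dimension of the space of matrices on which T acts. *)
pose rs := [seq m%:R * a | m <- iota 0 (d.+1 * d.+1).+1].
have : (size rs < size (char_poly T))%N.
  apply: max_poly_roots.
  - by apply: monic_neq0; exact: char_poly_monic.
  - apply/allP => _ /mapP[m _ ->]; rewrite -eigenvalue_root_char.
    apply/eigenvalueP; exists (mxvec (N ^+ m)).
      by rewrite TE comm linearZ.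
    by rewrite mxvec_eq0 N0.
  - rewrite map_inj_uniq ?iota_uniq// => m m' /(mulIf a0) /eqP.
    by rewrite eqr_nat => /eqP.
by rewrite size_char_poly size_map size_iota ltnn.
Qed.

End MatrixFacts.

Section IntegralWeights.
Variables (k : numClosedFieldType) (W : lmodType k) (E F H : W -> W).
Hypotheses (El : linear E) (Fl : linear F) (Hl : linear H).
Hypothesis EF : forall v, E (F v) = F (E v) + H v.
Hypothesis HE : forall v, H (E v) = E (H v) + 2 *: E v.
Hypothesis Enil : exists m, forall v, iter m E v = 0.

Let iter_lin m : linear (iter m E).
Proof. by elim: m => [|m IH] a u v //; rewrite !iterS IH El. Qed.

Let H_iter a v m : H v = a *: v -> H (iter m E v) = (a + (2 * m)%:R) *: iter m E v.
Proof.
move=> Hv; elim: m => [|m IH]; first by rewrite addr0.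
rewrite iterS HE IH (linear_mapZ El) -scalerDl; congr (_ *: _).
by rewrite mulnS natrD; ring.
Qed.

(** The sl2 identity E^n F = F E^n + n (H - n + 1) E^(n-1); for n = 0 the truncated predecessor is
    multiplied by 0. *)
Let iter_F n u : iter n E (F u) =
  F (iter n E u) + n%:R *: (H (iter n.-1 E u) - (n.-1)%:R *: iter n.-1 E u).
Proof.
elim: n => [|n IH]; first by rewrite scale0r addr0.
rewrite iterS IH (linear_mapD El) (linear_mapZ El) EF -iterS -addrA; congr (_ + _).
case: n IH => [|n] IH /=.
  by rewrite scale0r addr0 scale1r scale0r subr0.
have Esub x y : E (x - y) = E x - E y.
  by rewrite (linear_mapD El) -[- y]scaleN1r (linear_mapZ El) scaleN1r.
set w := iter n E u; rewrite Esub (linear_mapZ El).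
have EH : E (H w) = H (E w) - 2 *: E w by rewrite HE addrK.
have lin (p q : k) (x y : W) : p * (q + 2) = (1 + p) * (q + 1) ->
    x + p *: (x - 2 *: y - q *: y) = (1 + p) *: (x - (q + 1) *: y).
  move=> pq; rewrite -addrA -opprD -scalerDl !scalerBr !scalerA -pq scalerDl scale1r.
  by rewrite addrA [2 + q]addrC.
rewrite EH lin; last by rewrite mulrS; ring.
by rewrite natr1 -mulrS.
Qed.

(* Jacobson: if w = E^i u is killed by E and not in the image of E^(i+1), then
   E^(i+1) F u = (i+1)(H - i) w forces the weight of w to be i. *)
Lemma eigenvalue_int a v : v != 0 -> H v = a *: v -> exists m : int, a = m%:~R.
Proof.
move=> v0 Hv; have [N EN] := Enil.
have exP : exists m, iter m E v == 0 by exists N; rewrite EN.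
case: (ex_minnP exP) => -[|m]; first by rewrite /= (negPf v0).
move=> /eqP Em min_m; set w := iter m E v.
have w0 : w != 0.
  by apply/negP => w0; have := min_m m w0; rewrite ltnn.
have Hw := H_iter m Hv; rewrite -/w in Hw; set mu := a + _ in Hw.
have exQ : exists i, `[< ~ exists u, w = iter i E u >].
  exists N; apply/asboolP => -[u wu]; move: w0; rewrite wu EN eqxx //.
case: (ex_minnP exQ) => -[|i] /asboolP Qi min_i.
  by case: Qi; exists w.
have [u wu] : exists u, w = iter i E u.
  by apply: contrapT => nu; have := min_i i (asboolT nu); rewrite ltnn.
have Ew : E w = 0 by rewrite -[E w]/(iter m.+1 E v).
have := iter_F i.+1 u; rewrite /= -wu Ew (linear_map0 Fl) add0r Hw.
rewrite -scalerBl scalerA => EFu.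
suff mui : mu = i%:R.
  exists (i%:Z - (2 * m)%:Z); rewrite intrB -!pmulrn -mui /mu addrK.
  by [].
apply/eqP; rewrite -subr_eq0; apply: contrapT => /negP mui.
case: Qi; exists (((i.+1)%:R * (mu - i%:R))^-1 *: F u).
rewrite (linear_mapZ (iter_lin i.+1)) iterS EFu scalerA mulVf ?scale1r//.
by rewrite mulf_neq0// pnatr_eq0.
Qed.

End IntegralWeights.

Section CriticalLevel.
Variables (k : numClosedFieldType) (g : lieAlgebra k) (B : g -> g -> k).
Variables (X : (\dim {:g}).-tuple g) (hc : k) (l : nat).
Hypotheses (invB : invariant_form B) (orthX : orthonormal_basis B X).
Hypothesis coxX : dual_coxeter X hc.
Local Notation d := (\dim {:g}).

Definition coords (y : g) : 'rV[k]_d := \row_j B y (tnth X j).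
Definition of_coords (v : 'rV[k]_d) : g := \sum_j v 0 j *: tnth X j.
(** Coordinates are row vectors, so ad x is multiplication by [admx x] on the right, and the order
    of the products in [admx_lie] is reversed. *)
Definition admx (x : g) : 'M[k]_d :=
  \matrix_(i, j) B (lie x (tnth X i)) (tnth X j).

Lemma of_coordsK v : coords (of_coords v) = v.
Proof.
apply/rowP => j; rewrite mxE (form_suml invB) (bigD1 j)//= (form_scalel invB).
have [_ o] := orthX; rewrite o eqxx mulr1 big1 ?addr0// => i ij.
by rewrite (form_scalel invB) o (negPf ij) mulr0.
Qed.

Lemma coordsK y : of_coords (coords y) = y.
Proof.
rewrite [RHS](orthonormal_sum invB orthX); apply: eq_bigr => j _.
by rewrite mxE.
Qed.

Lemma coords_inj : injective coords.
Proof. exact: can_inj coordsK. Qed.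

Lemma coordsZ a y : coords (a *: y) = a *: coords y.
Proof. by apply/rowP => j; rewrite !mxE (form_scalel invB). Qed.

Lemma coords0 : coords 0 = 0.
Proof. by apply/rowP => j; rewrite !mxE (form0l invB). Qed.

Lemma coords_lie x y : coords (lie x y) = coords y *m admx x.
Proof.
apply/rowP => j; rewrite !mxE {1}(orthonormal_sum invB orthX y).
have -> : lie x (\sum_i B y (tnth X i) *: tnth X i) =
    \sum_i B y (tnth X i) *: lie x (tnth X i).
  rewrite (big_morph (lie x) (fun a b => lie_addr invB orthX a b x) (lie0r invB orthX x)).
  by apply: eq_bigr => i _; rewrite (lie_scaler invB orthX).
rewrite (form_suml invB); apply: eq_bigr => i _.
by rewrite (form_scalel invB) !mxE.
Qed.

Lemma coords_iter m x y :
  coords (iter m (lie x) y) = iter m (mulmx^~ (admx x)) (coords y).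
Proof. by elim: m => [|m IH] //; rewrite !iterS coords_lie IH. Qed.

Lemma form_coords x y : B x y = (coords x *m (coords y)^T) 0 0.
Proof.
rewrite !mxE {1}(orthonormal_sum invB orthX x) (form_suml invB).
by apply: eq_bigr => i _; rewrite (form_scalel invB) !mxE (formC invB y).
Qed.

Lemma admx_tr x : (admx x)^T = - admx x.
Proof.
apply/matrixP => i j; rewrite !mxE (lieC invB orthX x (tnth X j)).
by rewrite (form_oppl invB) (form_lie invB) (formC invB).
Qed.

Lemma row_coords i (A : 'M[k]_d) : row i A = coords (tnth X i) *m A.
Proof.
rewrite rowE; congr (_ *m _); apply/rowP => j; rewrite !mxE eqxx.
by have [_ ->] := orthX; rewrite eq_sym.
Qed.

Lemma admx_lie x y : admx (lie x y) = admx y *m admx x - admx x *m admx y.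
Proof.
apply/row_matrixP => i.
rewrite !row_coords -coords_lie (lie_jacobi invB orthX) mulmxBr !mulmxA -!coords_lie.
by apply/rowP => j; rewrite !mxE (form_addl invB) (form_oppl invB).
Qed.

(** The left side is the Killing form. Invariance turns each diagonal entry B([y, [x, X_i]], X_i)
    into B(x, [X_i, [X_i, y]]), and the sum over i is the Casimir eigenvalue. *)
Lemma trace_form x y : \tr (admx x *m admx y) = 2 * hc * B x y.
Proof.
rewrite -(form_scaler invB) -coxX (formC invB) (form_suml invB).
apply: eq_bigr => i _.
have -> : (admx x *m admx y) i i = row i (admx x *m admx y) 0 i by rewrite [RHS]mxE.
rewrite row_coords mulmxA -!coords_lie mxE.
rewrite (lieC invB orthX y) (form_oppl invB) (form_lie invB) (form_lie invB).
rewrite (lieC invB orthX y) (lie_oppr invB orthX).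
by rewrite [RHS](formC invB) (formC invB x) (form_oppl invB) opprK (formC invB).
Qed.

(** If ad x has an eigenvalue a != 0, an eigenvector v serves, because [ad x, ad v] = a ad v and
    [shift_nilpotent_mx] applies. Otherwise x itself serves. *)
Lemma ad_nilpotent_exists : (exists x y : g, lie x y != 0) ->
  exists2 e : g, e != 0 & ad_nilpotent e.
Proof.
move=> [x [y xy]].
have nilE e : (exists m, forall v : 'rV_d, iter m (mulmx^~ (admx e)) v = 0) -> ad_nilpotent e.
  by move=> [m Hm]; exists m => w; apply: coords_inj; rewrite coords_iter Hm coords0.
have [nil|] := pselect (forall a, eigenvalue (admx x) a -> a = 0).
  exists x; last exact/nilE/nilpotent_mx.
  by apply: contra_neq xy => ->; rewrite lie0l.
move=> /existsNP[a /not_implyP[/eigenvalueP[v va v0] /eqP a0]].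
have E : lie x (of_coords v) = a *: of_coords v.
  by apply: coords_inj; rewrite coords_lie coordsZ of_coordsK.
exists (of_coords v).
  by apply: contra_neq v0 => E0; rewrite -[v]of_coordsK E0 coords0.
apply/nilE; apply: (@shift_nilpotent_mx _ _ (admx x) _ a a0).
rewrite -admx_lie E; apply/matrixP => i j; rewrite !mxE.
by rewrite lie_scalel (form_scalel invB).
Qed.

(* Since [ad e ^ 2] is self-adjoint for B, its image is the orthogonal of its kernel. *)
Lemma square_image e :
  (forall z, lie e (lie e z) = 0 -> B z e = 0) -> exists y, lie e (lie e y) = e.
Proof.
move=> He; pose A := admx e *m admx e.
have AT : A^T = A by rewrite trmx_mul admx_tr mulNmx mulmxN opprK.
have : (coords e <= A)%MS.
  rewrite submxE; apply/eqP/rowP => j; rewrite [RHS]mxE.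
  pose w := col j (cokermx A).
  have Aw : A *m w = 0 by rewrite /w colE mulmxA mulmx_coker mul0mx.
  have E : (coords e *m cokermx A) 0 j = (w^T *m (coords e)^T) 0 0.
    by rewrite -trmx_mul [RHS]mxE !mxE; apply: eq_bigr => i _; rewrite !mxE.
  rewrite E -[w^T]of_coordsK -form_coords He//.
  apply: coords_inj; rewrite !coords_lie of_coordsK -mulmxA -/A coords0.
  by rewrite -AT -trmx_mul Aw trmx0.
move=> /submxP[u ue]; exists (of_coords u); apply: coords_inj.
by rewrite !coords_lie of_coordsK -mulmxA.
Qed.

Section Vacuum.
Variable Hv : hwModule B l (trivial_gmodule g).
Hypothesis l_gt0 : (0 < l)%N.

Let v0 : Hv := hw_emb Hv (1 : k^o).

Lemma mode0r x m : mode x m (0 : Hv) = 0.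
Proof. by have := modeDr (-1) x m (0 : Hv) 0; rewrite scaler0 addr0 scaleN1r addNr. Qed.

Lemma modeZ a x m (u : Hv) : mode x m (a *: u) = a *: mode x m u.
Proof. by rewrite -[a *: u]addr0 modeDr mode0r addr0. Qed.

Lemma mode_scalel a x m (u : Hv) : mode (a *: x) m u = a *: mode x m u.
Proof.
have m0 : mode 0 m u = 0 by have := modeDl (-1) 0 0 m u; rewrite scaler0 addr0 scaleN1r addNr.
by rewrite -[a *: x]addr0 modeDl m0 addr0.
Qed.

Lemma hw_emb0 : hw_emb Hv (0 : k^o) = 0.
Proof.
by have := hw_emb_linear Hv (-1) (0 : k^o) 0; rewrite scaler0 addr0 scaleN1r addNr.
Qed.

Let v0_neq0 : v0 != 0.
Proof.
rewrite -hw_emb0; apply/eqP => /hw_emb_inj /eqP; exact/negP/oner_neq0.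
Qed.

Let v0_pos x m : 0 < m -> mode x m v0 = 0.
Proof. by apply: (hw_emb_im v0).1; exists (1 : k^o). Qed.

Let v0_zero x : mode x 0 v0 = 0.
Proof. by rewrite -(hw_emb_act Hv x (1 : k^o)) hw_emb0. Qed.

Let P (e : g) s := iter s (mode e (-1)) v0.

Let mode_pair f e (w : Hv) : mode f 1 (mode e (-1) w) =
  mode e (-1) (mode f 1 w) + mode (lie f e) 0 w + (l%:R * B f e) *: w.
Proof.
have := modeJ f e 1 (-1) w => /(canRL (subrK _)) ->.
rewrite addrC addrA; congr (_ + _ *: _).
by rewrite [RHS]mulrC -[RHS]mul1r -[1 * (_ * _)]mul1r !mulrA.
Qed.

Let zero_P e f c s : lie (lie f e) e = c *: e ->
  mode (lie f e) 0 (P e s) = (s%:R * c) *: P e s.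
Proof.
move=> Hc; elim: s => [|s IH]; first by rewrite v0_zero mul0r scale0r.
have := modeJ (lie f e) e 0 (-1) (P e s).
rewrite Hc mode_scalel !mul0r scale0r addr0 IH modeZ add0r => /(canRL (subrK _)).
rewrite /P iterS => ->; rewrite -scalerDl mulrS; congr (_ *: _); ring.
Qed.

(** Each time f(1) passes an e(-1), the zero mode of [f, e] and the central term contribute j c + l
    B(f, e); the sum over j <= s is an arithmetic progression. *)
Let one_P e f c s : lie (lie f e) e = c *: e ->
  mode f 1 (P e s.+1) = (s.+1%:R * (l%:R * B f e + s%:R * (c / 2))) *: P e s.
Proof.
move=> Hc; have N2 : (2 : k) != 0 by rewrite pnatr_eq0.
have step s' : mode f 1 (P e s'.+1) = mode e (-1) (mode f 1 (P e s')) +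
    (s'%:R * c + l%:R * B f e) *: P e s'.
  by rewrite -[P e s'.+1]/(mode e (-1) (P e s')) mode_pair (zero_P _ Hc) -addrA -scalerDl.
elim: s => [|s IH].
  by rewrite step /= v0_pos// mode0r add0r; congr (_ *: _); ring.
rewrite step IH modeZ -[mode e (-1) (P e s)]/(P e s.+1) -scalerDl; congr (_ *: _).
by rewrite !mulrS; field.
Qed.

(** By integrability some e(-1)^s v0 is the last nonzero vector of its string, so the coefficient in
    [one_P] vanishes; s depends on e alone and serves all f and c. It is positive, as e(-1) v0 = 0
    would give l B(f, e) = 0 for every f. *)
Lemma vacuum_string e : e != 0 -> ad_nilpotent e -> exists2 s : nat, (0 < s)%N &
  forall f c, lie (lie f e) e = c *: e -> l%:R * B f e + s%:R * (c / 2) = 0.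
Proof.
move=> e0 enil; have [r Pr] := hw_integrable (-1) v0 enil.
have exr : exists r, P e r == 0 by exists r; apply/eqP.
case: (ex_minnP exr) => -[|s]; first by rewrite /P /= (negPf v0_neq0).
move=> /eqP Ps min_s; have Ps0 : P e s != 0.
  by apply/negP => h; have := min_s s h; rewrite ltnn.
have key f c : lie (lie f e) e = c *: e -> l%:R * B f e + s%:R * (c / 2) = 0.
  move=> Hc; have := one_P s Hc; rewrite Ps mode0r => /esym/eqP.
  by rewrite scaler_eq0 (negPf Ps0) orbF mulf_eq0 pnatr_eq0/= => /eqP.
exists s => //; rewrite lt0n; apply: contra e0 => /eqP s0.
apply/eqP; apply: (form_nondegenerate invB orthX) => f.
rewrite (formC invB f 0) (form0l invB).
have := mode_pair f e v0; rewrite v0_zero addr0 [mode f 1 v0]v0_pos//.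
move: Ps; rewrite s0 /P /= => ->; rewrite !mode0r add0r => /esym/eqP.
rewrite scaler_eq0 (negPf v0_neq0) orbF mulf_eq0 pnatr_eq0 (gtn_eqF l_gt0)/=.
by move=> /eqP.
Qed.

End Vacuum.

Lemma critical_level_neq0 (Hv : hwModule B l (trivial_gmodule g)) :
  (0 < l)%N -> (exists x y : g, lie x y != 0) -> l%:R + hc != 0.
Proof.
move=> l0 /ad_nilpotent_exists[e e0 enil]; apply/eqP => lhc.
have hcE : hc = - l%:R by apply/eqP; rewrite -addr_eq0 addrC lhc.
have [s s0 key] := vacuum_string Hv l0 e0 enil.
have lnz : (l%:R : k) != 0 by rewrite pnatr_eq0 -lt0n.
(* The string equation with c = 0 says that every z with [e, [e, z]] = 0 is orthogonal to e. *)
have [y ey] : exists y, lie e (lie e y) = e.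
  apply: square_image => z ez; have := key z 0.
  rewrite (lieC invB orthX z) -(scaleN1r (lie e z)) lie_scalel (lieC invB orthX _ e) ez.
  rewrite oppr0 scaler0 scale0r mul0r mulr0 addr0 => /(_ erefl)/eqP.
  by rewrite mulf_eq0 (negPf lnz) => /eqP.
(* The factor -2 yields [h, e] = 2 e. As [f, e] = -h, the string equation for f has c = -2 and reads
   l B(f, e) = s. *)
pose f := -2 *: y; pose h := lie e f.
have he : lie h e = 2 *: e.
  rewrite /h /f (lie_scaler invB orthX) lie_scalel (lieC invB orthX _ e) ey.
  by rewrite scalerN scaleNr opprK.
have := key f (-2); rewrite (lieC invB orthX f e) -/h -(scaleN1r h).
rewrite lie_scalel he scalerA mulN1r => /(_ erefl) lBs.
have Bhh : B h h = 2 * B f e.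
  rewrite {2}/h -(form_lie invB) he (form_scalel invB).
  by rewrite (formC invB e).
have : 0 <= \tr (admx h *m admx h).
  apply: trace_sq_int_ge0 => a /eigenvalueP[v va v_n0].
  have hv : lie h (of_coords v) = a *: of_coords v.
    by apply: coords_inj; rewrite coords_lie coordsZ of_coordsK.
  have lin x : linear (lie x : g -> g) by move=> b u w; rewrite (lieDr invB orthX).
  have ef w : lie e (lie f w) = lie f (lie e w) + lie h w.
    by rewrite /h (lie_jacobi invB orthX) addrC subrK.
  have hew w : lie h (lie e w) = lie e (lie h w) + 2 *: lie e w.
    have := lie_jacobi invB orthX h e w; rewrite he lie_scalel => ->.
    by rewrite addrC subrK.
  apply: (@eigenvalue_int k g (lie e) (lie f) (lie h) (lin e) (lin f) ef hew enil a _ _ hv).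
  by apply: contra_neq v_n0 => E0; rewrite -[v]of_coordsK E0 coords0.
(* The trace is 2 hc B(h, h) = - 4 s, which is negative. *)
rewrite trace_form hcE Bhh.
have -> : 2 * - l%:R * (2 * B f e) = - (4 * (l%:R * B f e)) by ring.
have -> : l%:R * B f e = s%:R.
  by apply/eqP; rewrite -subr_eq0 -[X in _ == X]lBs; apply/eqP; field.
by rewrite oppr_ge0 lt_geF// mulr_gt0// ltr0n.
Qed.

End CriticalLevel.

(** * Surjectivity *)

Section Depth.
Variables (k : numClosedFieldType) (g : lieAlgebra k) (B : g -> g -> k).
Variables (l n : nat).
Variables (O : comUnitAlgType k) (z : 'I_n -> O) (W C : lmodType O).
Variable M : option 'I_n -> g -> int -> W -> W.
Hypothesis affM : forall p, affine_action B l (M p).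
Hypothesis commM : forall p q x y m r u, p != q ->
  M p x m (M q y r u) = M q y r (M p x m u).
Variable Z : W -> Prop.
Hypothesis Z0 : Z 0.
Hypothesis Z_linear : forall a u v, Z u -> Z v -> Z (a *: u + v).
Hypothesis Z_zero : forall p x u, Z u -> Z (M p x 0 u).
Hypothesis Z_pos : forall p x m u, Z u -> 0 < m -> M p x m u = 0.

(** The vectors obtained from [Z] by creation operators of total degree at most d, where x(-m-1)
    counts m + 1. The inequality in [Depth_mode] makes this monotone in d. *)
Inductive depth : nat -> W -> Prop :=
| Depth_base d u : Z u -> depth d u
| Depth_linear d a u v : depth d u -> depth d v -> depth d (a *: u + v)
| Depth_mode d d' p x m u : depth d u -> (d + m.+1 <= d')%N ->
    depth d' (M p x (- m.+1%:Z) u).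

Lemma depth0 d : depth d 0. Proof. exact: Depth_base. Qed.

Lemma depth_le d d' u : (d <= d')%N -> depth d u -> depth d' u.
Proof.
move=> dd' du; elim: du d' dd' => {d u} [d u Zu|d a u v _ IHu _ IHv|d d1 p x m u du _ le] d' dd'.
- exact: Depth_base.
- by apply: Depth_linear; [exact: IHu|exact: IHv].
- exact: Depth_mode du (leq_trans le dd').
Qed.

Lemma depthD d u v : depth d u -> depth d v -> depth d (u + v).
Proof. by move=> du dv; rewrite -[u]scale1r; exact: Depth_linear. Qed.

Lemma depthZ d a u : depth d u -> depth d (a *: u).
Proof. by move=> du; rewrite -[a *: u]addr0; apply: Depth_linear => //; exact: depth0. Qed.

(** A nonnegative mode is commuted to the right until it reaches [Z]. Its bracket with y(-m-1) has
    degree r - m - 1, so it is again a nonnegative mode or a creation operator counting at most m +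
    1. *)
Lemma depth_nonneg d u : depth d u -> forall p x (r : nat), depth d (M p x r u).
Proof.
elim=> {d u} [d u Zu|d a u v _ IHu _ IHv|d d' q y m u du IH le] p x r.
- case: r => [|r]; first exact/Depth_base/Z_zero.
  by rewrite Z_pos//; exact: depth0.
- by rewrite (act_linr (affM p)); exact: Depth_linear.
have dd' : (d <= d')%N by apply: leq_trans le; exact: leq_addr.
have [<-|pq] := eqVneq p q; last first.
  by rewrite commM//; exact: Depth_mode (IH p x r) le.
rewrite (act_commD (affM p)); apply: depthD; last exact/depthZ/(depth_le dd').
apply: depthD; first exact: Depth_mode (IH p x r) le.
have [h|h] := leP 0 (r%:Z - m.+1%:Z).
  rewrite -(gez0_abs h); exact/(depth_le dd')/IH.
have -> : r%:Z - m.+1%:Z = - (m - r).+1%:Z by lia.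
by apply: Depth_mode du _; apply: leq_trans le; rewrite leq_add2l ltnS leq_subr.
Qed.

Definition reached u := exists d, depth d u.

Lemma reached_linear a u v : reached u -> reached v -> reached (a *: u + v).
Proof.
move=> [d du] [d' dv]; exists (d + d')%N; apply: Depth_linear.
  by apply: depth_le du; exact: leq_addr.
by apply: depth_le dv; exact: leq_addl.
Qed.

Lemma reached_mode p x m u : reached u -> reached (M p x m u).
Proof.
move=> [d du]; case: m => m; first by exists d; exact: depth_nonneg.
by exists (d + m.+1)%N; rewrite NegzE; exact: Depth_mode du (leqnn _).
Qed.

Variable blk : W -> C.
Hypothesis blk_linear : linear blk.
Hypothesis blk0 : forall x f u, in_A z f -> blk (lact M x f u) = 0.

Definition covered u := exists2 v, Z v & blk u = blk v.

Lemma covered0 : covered 0. Proof. by exists 0. Qed.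

Lemma covered_linear a u v : covered u -> covered v -> covered (a *: u + v).
Proof.
move=> [u' Zu E] [v' Zv E']; exists (a *: u' + v'); first exact: Z_linear.
by rewrite !blk_linear E E'.
Qed.

Lemma covered_sum (I : Type) (s : seq I) (Q : pred I) (F : I -> W) :
  (forall i, Q i -> covered (F i)) -> covered (\sum_(i <- s | Q i) F i).
Proof.
move=> H; elim/big_rec: _ => [|i u Qi cu]; first exact: covered0.
by rewrite -[F i]scale1r; apply: covered_linear => //; exact: H.
Qed.

(** Away from p the traded function has no pole, so only nonnegative modes act there on u, whose
    depth is strictly below D; they preserve this smaller depth by [depth_nonneg]. *)
Lemma depth_covered d u : depth d u -> covered u.
Proof.
elim/ltn_ind: d u => D IHD u; move: (leqnn D).
suff H d : depth d u -> (d <= D)%N -> covered u by move=> h1 h2; exact: H h2 h1.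
elim=> {d u} [d u Zu _|d a u v _ IHu _ IHv dD|d d' p x m u du _ le d'D].
- by exists u.
- by apply: covered_linear; [exact: IHu|exact: IHv].
have dD : (d < D)%N by apply: leq_trans d'D; apply: leq_trans le; rewrite addnS ltnS leq_addr.
have := blk0 x u (in_A_phi_pow z p m.+1); rewrite /lact (bigD1 p)//=.
rewrite [loop (M p) _ _ _](@isum1 _ (- m.+1%:Z)) => [|r rm]; last first.
  by rewrite phi_self (negPf rm) scale0r.
rewrite phi_self eqxx scale1r (linear_mapD blk_linear) => /eqP.
rewrite addr_eq0 -(scaleN1r (blk _)) -(linear_mapZ blk_linear) => /eqP E.
suff [v Zv E'] : covered (-1 *: \sum_(q | q != p) loop (M q) x (fpow (phi z p) m.+1 q) u).
  by exists v; rewrite // E E'.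
rewrite -[_ *: _]addr0; apply: covered_linear; last exact: covered0.
apply: covered_sum => q qp.
have pq : p != q by rewrite eq_sym.
have [f0 _ _] := phi_pow_jet z m.+1 pq.
have fb : lbounded (fpow (phi z p) m.+1 q) by exact: laurent_phi_pow.
have [s Hs] := loop_fin (affM q) x u fb.
rewrite /loop (isumE Hs); apply: covered_sum => -[r|r] _; last first.
  by rewrite f0 ?scale0r//; exact: covered0.
rewrite -[_ *: _]addr0; apply: covered_linear; last exact: covered0.
by apply: (IHD d dD); exact: depth_nonneg.
Qed.

End Depth.

(** * The inclusion of the degree zero parts *)

Section Inclusion.
Variables (k : numClosedFieldType) (g : lieAlgebra k) (B : g -> g -> k).
Variables (l n : nat) (V : 'I_n -> gmodule g).
Variable H : forall p, hwModule B l (pointed_reps V p).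
Variable O : comUnitAlgType k.
Local Notation HO := (HO H O).
Local Notation VO := (VO V O).
Local Notation famH := (fun p => H p : lmodType k).
Local Notation famV := (fun i => V i : lmodType k).

Lemma hw_emb_zero p : hw_emb (H p) 0 = 0.
Proof.
by have := hw_emb_linear (H p) (-1) 0 0; rewrite scaler0 addr0 scaleN1r addNr.
Qed.

Lemma hw_embZ p a v : hw_emb (H p) (a *: v) = a *: hw_emb (H p) v.
Proof. by rewrite -[a *: v]addr0 hw_emb_linear hw_emb_zero addr0. Qed.

Definition emb_family (v : forall i, V i) : forall p, famH p :=
  fun p => hw_emb (H p) (ext_vec v p).

Lemma emb_family_with (v : forall i, famV i) i (x : famV i) :
  emb_family (dfwith v x) = dfwith (emb_family v) (hw_emb (H (Some i)) x : famH (Some i)).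
Proof.
apply: functional_extensionality_dep => p; rewrite /emb_family.
have [->|pi] := eqVneq p (Some i); first by rewrite dfwith_in /= dfwith_in.
rewrite dfwith_out 1?eq_sym//; case: p pi => [j|] //= ji.
by rewrite dfwith_out// eq_sym; apply: contraNneq ji => ->.
Qed.

Lemma emb_multilinear :
  multilinear (O := O) (E := famV) (W := tensor O famH) (fun v => pure O (emb_family v)).
Proof.
move=> v i a x y; rewrite !emb_family_with (hw_emb_linear (H (Some i))).
exact: pure_multilinear.
Qed.

Lemma incl_linear : linear (Defs.incl H (O := O) : VO -> HO).
Proof. exact: (tlift_linear emb_multilinear). Qed.

Lemma incl_pure v : Defs.incl H (pure O v : VO) = pure O (emb_family v) :> HO.
Proof. exact: (tlift_pure emb_multilinear). Qed.

Lemma incl_zero_mode i x (u : VO) :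
  mode_at (Some i) x 0 (Defs.incl H u : HO) = Defs.incl H (factor i (gact x : V i -> V i) u).
Proof.
have gl : linear (gact x : V i -> V i) by move=> a v w; exact: gactDr.
have fl : linear (factor i (gact x : V i -> V i) : VO -> VO).
  exact: (factor_linear (E := famV) gl).
have ml := @mode_at_linear _ _ _ _ _ _ H O (Some i) x 0.
move: u; apply: (tensor_linear_ext (E := famV) (W := HO)).
- exact: (linear_compose ml incl_linear).
- exact: (@linear_compose O VO VO HO _ _ incl_linear fl).
move=> v; rewrite incl_pure mode_at_pure (factor_pure O (E := famV) gl) incl_pure.
by rewrite emb_family_with; congr (pure O (dfwith _ _)); rewrite (hw_emb_act (H (Some i))).
Qed.

Lemma incl_infinity x (u : VO) : mode_at None x 0 (Defs.incl H u : HO) = 0.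
Proof.
have ml := @mode_at_linear _ _ _ _ _ _ H O None x 0.
move: u; apply: (tensor_linear_ext (E := famV) (W := HO) (G := fun=> 0)).
- exact: (linear_compose ml incl_linear).
- by move=> a u v; rewrite scaler0 addr0.
move=> v; rewrite incl_pure mode_at_pure.
rewrite -(hw_emb_act (H None) x (1 : k^o)) hw_emb_zero; exact: pure_zero.
Qed.

Lemma incl_pos p x m (u : VO) : 0 < m -> mode_at p x m (Defs.incl H u : HO) = 0.
Proof.
move=> m0; have ml := @mode_at_linear _ _ _ _ _ _ H O p x m.
move: u; apply: (tensor_linear_ext (E := famV) (W := HO) (G := fun=> 0)).
- exact: (linear_compose ml incl_linear).
- by move=> a u v; rewrite scaler0 addr0.
move=> v; rewrite incl_pure mode_at_pure.
have -> : mode x m (emb_family v p) = 0.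
  by apply: (hw_emb_im (emb_family v p)).1 => //; exists (ext_vec v p).
exact: pure_zero.
Qed.

Lemma incl_tderiv (Y : O -> O) (u : VO) : derivation Y ->
  tderiv Y (Defs.incl H u : HO) = Defs.incl H (tderiv Y u).
Proof.
move=> derY; elim/tensor_ind: u => [|a v t IH].
  rewrite (tderiv0 famV derY) (linear_map0 incl_linear).
  exact: (tderiv0 famH derY).
rewrite (incl_linear a (pure O v) t) (tderivD (E := famH) derY) IH.
rewrite (tderivD (E := famV) derY) (tderiv_pure (E := famV) derY).
rewrite (incl_linear (Y a) (pure O v)) !incl_pure.
by rewrite (tderiv_pure (E := famH) derY).
Qed.

Hypothesis V_irr : forall i, irreducible (V i).

Lemma pointed_nonzero p : exists v : pointed_reps V p, v != 0.
Proof.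
case: p => [i|]; last by exists (1 : k^o); exact: oner_neq0.
have [d0 _] := V_irr i; apply: contrapT => nv; move/negP: d0; apply.
rewrite dimv_eq0; apply/eqP/vspaceP => v; rewrite memvf memv0.
by have [//|v0] := eqVneq v 0; case: nv; exists v.
Qed.

Section Generation.
Variable R : HO -> Prop.
Hypothesis R_linear : forall a u v, R u -> R v -> R (a *: u + v).
Hypothesis R_mode : forall p x m u, R u -> R (mode_at p x m u).
Hypothesis R_incl : forall u : VO, R (Defs.incl H u).

Let R0 : R 0.
Proof. by rewrite -(linear_map0 incl_linear); exact: R_incl. Qed.

(** Induction on a list s containing all points where the factor may lie outside the degree zero
    part; irreducibility is used for one factor at a time. *)
Let R_pure (s : seq (option 'I_n)) : forall w : forall p, famH p,
  (forall p, p \notin s -> exists v, w p = hw_emb (H p) v) -> R (pure O w).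
Proof.
elim: s => [|p s IH] w ws.
  have wv p : {v | w p = hw_emb (H p) v} by apply: cid; exact: ws.
  pose v i : V i := projT1 (wv (Some i)).
  pose c : k := projT1 (wv None).
  (* At infinity the vector is a multiple of the vacuum. The scalar is to be pulled out of the
     tensor; the summand 0 gives the shape required by [pure_multilinear]. *)
  have -> : w = dfwith (emb_family v)
      (c *: (hw_emb (H None) (1 : k^o) : famH None) + 0 : famH None).
    apply: functional_extensionality_dep => p.
    have [->|pN] := eqVneq p None.
      rewrite dfwith_in (projT2 (wv None)) addr0 -hw_embZ; congr (hw_emb _ _).
      by rewrite -[LHS]mulr1.
    rewrite dfwith_out 1?eq_sym//; case: p pN => [i|] // _.
    exact: (projT2 (wv (Some i))).
  rewrite (pure_multilinear O (E := famH)) (pure_zero O (E := famH)).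
  have -> : dfwith (emb_family v) (hw_emb (H None) (1 : k^o) : famH None) = emb_family v.
    exact: (dfwith_same (emb_family v) None).
  by apply: R_linear => //; have := R_incl (pure O v); rewrite incl_pure.
(* This set is stable under linear combinations and modes, and it is not zero, since by induction it
   contains the degree zero part. *)
pose P (h : H p) := forall w' : forall p, famH p,
  (forall q, q \notin s -> q != p -> exists v, w' q = hw_emb (H q) v) ->
  R (pure O (dfwith w' (h : famH p))).
have [] := @hw_irreducible _ _ _ _ _ (H p) P.
- by move=> w' _; rewrite (pure_zero O (E := famH)); exact: R0.
- move=> a h h' Ph Ph' w' w's; rewrite (pure_multilinear O (E := famH)).
  by apply: R_linear; [exact: Ph|exact: Ph'].
- move=> x m h Ph w' w's.
  have := @mode_at_pure _ _ _ _ _ _ H O p x m (dfwith w' (h : famH p)).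
  rewrite dfwith_in dfwith_twice => <-.
  by apply: R_mode; exact: Ph.
- move=> P0; have [v v0] := pointed_nonzero p; case/eqP: v0.
  apply: (@hw_emb_inj _ _ _ _ _ (H p)); rewrite hw_emb_zero; apply: P0 => w' w's.
  apply: IH => q qs; have [->|qp] := eqVneq q p; first by exists v; rewrite dfwith_in.
  by rewrite dfwith_out 1?eq_sym//; exact: w's.
move=> Pall; rewrite -(dfwith_same w p); apply: Pall => q qs qp; apply: ws.
by rewrite inE negb_or qp.
Qed.

Lemma incl_generates u : R u.
Proof.
move: u; apply: (@tensor_ind _ _ _ famH) => [|a v t Rt]; first exact: R0.
by apply: R_linear => //; apply: (R_pure (s := enum {: option 'I_n})) => p; rewrite mem_enum.
Qed.

End Generation.
End Inclusion.

(** * Flatness *)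

Section PairSums.
Variables (U : zmodType) (n : nat).

Lemma sum_pairs (F : 'I_n -> 'I_n -> U) :
  \sum_i \sum_(j | j != i) F i j = \sum_(i < n) \sum_(j < n | (i < j)%N) (F i j + F j i).
Proof.
have E (i : 'I_n) : \sum_(j | j != i) F i j =
    \sum_(j < n | (i < j)%N) F i j + \sum_(j < n | (j < i)%N) F i j.
  rewrite (bigID (fun j : 'I_n => (i < j)%N))/=; congr (_ + _).
    by apply: eq_bigl => j; rewrite -val_eqE/=; case: ltngtP.
  by apply: eq_bigl => j; rewrite -val_eqE/=; case: ltngtP.
under eq_bigr => i _ do rewrite E.
rewrite big_split/= [X in _ + X](exchange_big_dep predT)//= -big_split/=.
by apply: eq_bigr => i _; rewrite -big_split.
Qed.

Lemma sum_cycle (F : 'I_n -> 'I_n -> 'I_n -> U) :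
  \sum_i \sum_j \sum_m F i j m = \sum_i \sum_j \sum_m F j m i.
Proof.
rewrite [RHS]exchange_big; apply: eq_bigr => i _.
by rewrite exchange_big.
Qed.

Lemma sum_two (F : 'I_n -> U) (i j : 'I_n) : i != j ->
  \sum_m F m = F i + F j + \sum_(m | (m != i) && (m != j)) F m.
Proof.
move=> ij; rewrite (bigD1 i)//= (bigD1 j)/= 1?eq_sym//.
by rewrite addrA.
Qed.

End PairSums.

Section KnizhnikZamolodchikov.
Variables (k : numClosedFieldType) (g : lieAlgebra k) (B : g -> g -> k).
Variables (X : (\dim {:g}).-tuple g) (n : nat).
Hypotheses (invB : invariant_form B) (orthX : orthonormal_basis B X).
Variables (O : comUnitAlgType k) (z : 'I_n -> O) (W : lmodType O).
Hypothesis zU : forall i j, i != j -> z i - z j \is a GRing.unit.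
Variable A : 'I_n -> g -> W -> W.
Hypothesis A_linear : forall i x, linear (A i x).
Hypothesis A_linl : forall i a x y u, A i (a *: x + y) u = a%:A *: A i x u + A i y u.
Hypothesis A_lie : forall i x y u, A i x (A i y u) = A i y (A i x u) + A i (lie x y) u.
Hypothesis A_comm : forall i j x y u, i != j -> A i x (A j y u) = A j y (A i x u).

Let AD i x := linear_mapD (A_linear i x).
Let A0 i x := linear_map0 (A_linear i x).

Let A_sum i x (I : finType) (F : I -> W) : A i x (\sum_r F r) = \sum_r A i x (F r).
Proof. exact: (big_morph (A i x) (AD i x) (A0 i x)). Qed.

Definition casop i j u : W := \sum_r A i (tnth X r) (A j (tnth X r) u).

Lemma casop_linear i j : linear (casop i j).
Proof.
move=> a u v; rewrite /casop scaler_sumr -big_split; apply: eq_bigr => r _.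
by rewrite !A_linear.
Qed.

Lemma casopD i j : {morph casop i j : u v / u + v}.
Proof. exact: linear_mapD (casop_linear i j). Qed.

Lemma casopZ i j a u : casop i j (a *: u) = a *: casop i j u.
Proof. exact: linear_mapZ (casop_linear i j) a u. Qed.

Lemma casop_sum i j (I : finType) (P : pred I) (F : I -> W) :
  casop i j (\sum_(r | P r) F r) = \sum_(r | P r) casop i j (F r).
Proof.
exact: (big_morph _ (casopD i j) (linear_map0 (casop_linear i j))).
Qed.

Lemma casopC i j u : casop i j u = casop j i u.
Proof.
have [->//|ij] := eqVneq i j.
by apply: eq_bigr => r _; rewrite A_comm.
Qed.

Lemma casop_far i j m y u : m != i -> m != j ->
  casop i j (A m y u) = A m y (casop i j u).
Proof.
move=> mi mj; rewrite /casop A_sum; apply: eq_bigr => r _.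
by rewrite (A_comm _ _ _ mi) (A_comm _ _ _ mj).
Qed.

Lemma casop_invariant i j y u : i != j ->
  casop i j (A i y u + A j y u) = A i y (casop i j u) + A j y (casop i j u).
Proof.
move=> ij; have inv := casimir_invariant invB orthX (O := O) (W := W)
  (Phi := fun x w => A i x (A j w u)) _ _ y.
rewrite casopD {1 2}/casop.
have -> : \sum_r A i (tnth X r) (A j (tnth X r) (A i y u)) =
    A i y (casop i j u) + \sum_r A i (lie (tnth X r) y) (A j (tnth X r) u).
  rewrite /casop A_sum -big_split; apply: eq_bigr => r _ /=.
  by rewrite -(A_comm y (tnth X r) u ij) A_lie.
have -> : \sum_r A i (tnth X r) (A j (tnth X r) (A j y u)) =
    A j y (casop i j u) + \sum_r A i (tnth X r) (A j (lie (tnth X r) y) u).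
  rewrite /casop A_sum -big_split; apply: eq_bigr => r _ /=.
  by rewrite A_lie AD (A_comm _ _ _ ij).
rewrite inv => [|a x x' w|a x x' w].
- set S := \sum_r A i (tnth X r) (A j (lie (tnth X r) y) u).
  by rewrite addrACA addNr addr0.
- by rewrite A_linl.
- by rewrite A_linl A_linear.
Qed.

(** The operator c_im + c_jm is the sum over r of X_r at i plus X_r at j, times X_r at m; both
    factors commute with c_ij, by [casop_invariant] and [casop_far]. *)
Lemma casop_braid i j m u : i != j -> m != i -> m != j ->
  casop i j (casop i m u + casop j m u) =
  casop i m (casop i j u) + casop j m (casop i j u).
Proof.
move=> ij mi mj; rewrite /casop -!big_split -/(casop i j _) casop_sum.
apply: eq_bigr => r _; rewrite casop_invariant// casop_far//.
Qed.

Lemma casop_disjoint i j p q u : p != i -> p != j -> q != i -> q != j ->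
  casop i j (casop p q u) = casop p q (casop i j u).
Proof.
move=> pi pj qi qj; rewrite [casop p q _]/casop casop_sum.
by apply: eq_bigr => r _; rewrite !casop_far.
Qed.

(** The commutator [c_ij, c_jm]. By the braid relations it is cyclic and changes sign under
    transpositions, so a triple carries a single operator up to sign. The value 0 on triples with
    repetitions lets sums run over all indices. *)
Definition tau (i j m : 'I_n) u : W :=
  if [&& i != j, m != i & m != j]
  then casop i j (casop j m u) - casop j m (casop i j u) else 0.

Lemma tau_cycle i j m u : tau j m i u = tau i j m u.
Proof.
rewrite /tau (eq_sym j m) (eq_sym i j) (eq_sym i m).
have [ji|ij] := eqVneq j i; first by rewrite !(andbF, andFb).
have [mi|mi] := eqVneq m i; first by rewrite !(andbF, andFb).
have [mj|mj] := eqVneq m j; first by rewrite !(andbF, andFb).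
have jm : j != m by rewrite eq_sym.
have im : i != m by rewrite eq_sym.
have ij' : i != j by rewrite eq_sym.
have := casop_braid u jm ij' im.
rewrite casopD !(casopC j i) => /eqP.
rewrite -subr_eq0 => /eqP E /=.
apply/eqP; rewrite -subr_eq0; apply/eqP; rewrite -[RHS]E; zmod.
Qed.

Lemma tau_swap i j m u : tau j i m u = - tau i j m u.
Proof.
rewrite /tau (eq_sym j i) [(m != j) && _]andbC.
case: and3P => [[ij mi mj]|_]; last by rewrite oppr0.
have := casop_braid u ij mi mj; rewrite casopD => /eqP.
rewrite -subr_eq0 => /eqP E.
apply/eqP; rewrite -subr_eq0; apply/eqP; rewrite -[RHS]E !(casopC j i).
zmod.
Qed.

Definition fullop (a : 'I_n -> 'I_n -> O) u : W :=
  \sum_i \sum_j a i j *: casop i j u.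

Definition comm i j p q u : W := casop i j (casop p q u) - casop p q (casop i j u).

Lemma fullop_comm a b u : fullop a (fullop b u) - fullop b (fullop a u) =
  \sum_i \sum_j a i j *: \sum_p \sum_q b p q *: comm i j p q u.
Proof.
have -> : fullop a (fullop b u) =
    \sum_i \sum_j a i j *: \sum_p \sum_q b p q *: casop i j (casop p q u).
  apply: eq_bigr => i _; apply: eq_bigr => j _; congr (_ *: _).
  rewrite casop_sum; apply: eq_bigr => p _; rewrite casop_sum.
  by apply: eq_bigr => q _; rewrite casopZ.
have -> : fullop b (fullop a u) =
    \sum_i \sum_j a i j *: \sum_p \sum_q b p q *: casop p q (casop i j u).
  rewrite /fullop (eq_bigr (fun p => \sum_q \sum_i \sum_j
    (a i j * b p q) *: casop p q (casop i j u))) => [|p _]; last first.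
    apply: eq_bigr => q _; rewrite casop_sum scaler_sumr; apply: eq_bigr => i _.
    rewrite casop_sum scaler_sumr; apply: eq_bigr => j _.
    by rewrite casopZ scalerA mulrC.
  under eq_bigr => p _ do rewrite exchange_big.
  rewrite exchange_big; apply: eq_bigr => i _.
  rewrite (eq_bigr (fun p => \sum_j \sum_q (a i j * b p q) *: casop p q (casop i j u))) => [|p _].
    rewrite exchange_big; apply: eq_bigr => j _; rewrite scaler_sumr.
    by apply: eq_bigr => p _; rewrite scaler_sumr; apply: eq_bigr => q _; rewrite scalerA.
  by rewrite exchange_big.
rewrite -sumrB; apply: eq_bigr => i _; rewrite -sumrB; apply: eq_bigr => j _.
rewrite -scalerBr -sumrB; congr (_ *: _); apply: eq_bigr => p _.
by rewrite -sumrB; apply: eq_bigr => q _; rewrite -scalerBr.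
Qed.

Lemma comm_self i j u : comm i j i j u = 0.
Proof. exact: subrr. Qed.

Lemma comm_swap i j p q u : comm i j q p u = comm i j p q u.
Proof. by rewrite /comm !(casopC q p). Qed.

Lemma comm_tau i j m u : i != j -> m != i -> m != j -> comm i j j m u = tau i j m u.
Proof. by move=> ij mi mj; rewrite /tau ij mi mj. Qed.

Lemma comm_tau' i j m u : i != j -> m != i -> m != j -> comm i j i m u = - tau i j m u.
Proof.
move=> ij mi mj; rewrite -tau_swap /tau eq_sym ij mi mj /comm.
by rewrite !(casopC j i).
Qed.

(** Only pairs {p, q} sharing exactly one index with {i, j} contribute, each in both orders, hence
    the factor 2. *)
Lemma pair_comm_sum (b : 'I_n -> 'I_n -> O) i j u : i != j ->
  (forall p, b p p = 0) -> (forall p q, b p q = b q p) ->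
  \sum_p \sum_q b p q *: comm i j p q u =
  2%:R *: \sum_m (b j m - b i m) *: tau i j m u.
Proof.
move=> ij b0 bC.
have tau0 m : (m == i) || (m == j) -> tau i j m u = 0.
  by rewrite /tau -negb_or orbC => ->; rewrite andbF.
rewrite (sum_two _ ij) (sum_two (fun q => b i q *: comm i j i q u) ij).
rewrite (sum_two (fun q => b j q *: comm i j j q u) ij) !b0 !scale0r.
rewrite (comm_swap i j i j) !comm_self !scaler0 !addr0 !add0r.
rewrite [X in _ + X](eq_bigr (fun p =>
  b i p *: comm i j i p u + b j p *: comm i j j p u)); last first.
  move=> p /andP[pi pj]; rewrite (sum_two _ ij) big1 ?addr0 => [|q /andP[qi qj]].
    by rewrite !(bC p) !(comm_swap i j _ p).
  by rewrite /comm casop_disjoint// subrr scaler0.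
rewrite big_split/= [RHS](_ : _ = 2%:R *: (\sum_(m | (m != i) && (m != j))
    (b i m *: comm i j i m u + b j m *: comm i j j m u))).
  by rewrite big_split/= scaler_nat mulr2n.
congr (_ *: _); rewrite (sum_two _ ij) !tau0 ?eqxx ?orbT// !scaler0 !add0r.
apply: eq_bigr => m /andP[mi mj].
by rewrite comm_tau// comm_tau'// scalerN scalerBl addrC.
Qed.

(** The cyclic sum of the 2-forms w_ij w_jm, evaluated on the two vector fields that a and b stand
    for. *)
Definition arnold (a b : 'I_n -> 'I_n -> O) := forall i j m,
  i != j -> m != i -> m != j ->
  (a i j * b j m - b i j * a j m) + (a j m * b m i - b j m * a m i) +
  (a m i * b i j - b m i * a i j) = 0.

Lemma fullop_commute a b u :
  (forall p, a p p = 0) -> (forall p, b p p = 0) ->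
  (forall p q, a p q = a q p) -> (forall p q, b p q = b q p) -> arnold a b ->
  fullop a (fullop b u) = fullop b (fullop a u).
Proof.
move=> a0 b0 aC bC ab; apply/eqP; rewrite -subr_eq0; apply/eqP.
rewrite fullop_comm.
pose F i j m := (a i j * (b j m - b i m)) *: tau i j m u.
have -> : \sum_i \sum_j a i j *: \sum_p \sum_q b p q *: comm i j p q u =
    2%:R *: \sum_i \sum_j \sum_m F i j m.
  rewrite scaler_sumr; apply: eq_bigr => i _; rewrite scaler_sumr; apply: eq_bigr => j _.
  have [ij|ij] := eqVneq i j.
    by rewrite {1}ij a0 scale0r big1 ?scaler0// => m _; rewrite /F ij a0 mul0r scale0r.
  rewrite pair_comm_sum// !scalerA mulrC -scalerA; congr (_ *: _).
  by rewrite scaler_sumr; apply: eq_bigr => m _; rewrite scalerA.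
set Q := \sum_i _.
(* As [tau] is cyclic, adding the three rotations of the sum puts the expression of Arnold's
   identity in front of a single [tau]. *)
have Q3 : Q + Q + Q = 0.
  have Q1 : Q = \sum_i \sum_j \sum_m F j m i by exact: sum_cycle.
  have Q2 : Q = \sum_i \sum_j \sum_m F m i j by rewrite Q1 sum_cycle.
  rewrite {2}Q1 {2}Q2 /Q -!big_split/=.
  apply: big1 => i _; rewrite -!big_split/=; apply: big1 => j _.
  rewrite -!big_split/=; apply: big1 => m _.
  rewrite /F (tau_cycle i j m) -(tau_cycle m i j) -!scalerDl /=.
  rewrite {1}/tau; case: and3P => [[ij mi mj]|_]; last by rewrite scaler0.
  have E : a i j * (b j m - b i m) + a j m * (b m i - b j i) + a m i * (b i j - b m j) = 0.
    by rewrite -[RHS](ab i j m ij mi mj) (bC i m) (bC j i) (bC m j); ring.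
  by rewrite E scale0r.
have Q0 : Q = 0.
  have : (3^-1%:A : O) *: (Q + Q + Q) = 0 by rewrite Q3 scaler0.
  rewrite -{1}[Q]scale1r -{2}[Q]scale1r -{3}[Q]scale1r -!scalerDl scalerA.
  rewrite -scalerAl mul1r -[1 + 1 + 1](_ : 3%:R%:A = _); last first.
    by rewrite !scaler_nat; rewrite -natr1 -natr1.
  by rewrite scalerA mulVf ?pnatr_eq0// !scale1r.
by rewrite Q0 scaler0.
Qed.

Definition dlog (Y : O -> O) i j : O := Y (z i - z j) / (z i - z j).

Definition pairop (a : 'I_n -> 'I_n -> O) u : W :=
  \sum_(i < n) \sum_(j < n | (i < j)%N) a i j *: casop i j u.

Lemma pairop_fullop a u : (forall p, a p p = 0) -> (forall p q, a p q = a q p) ->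
  pairop a u = (2^-1%:A : O) *: fullop a u.
Proof.
move=> a0 aC; have -> : fullop a u = (2%:A : O) *: pairop a u.
  rewrite scaler_nat scaler_nat mulr2n.
  have -> : fullop a u = \sum_i \sum_(j | j != i) a i j *: casop i j u.
    apply: eq_bigr => i _; rewrite (bigD1 i)//= a0 scale0r add0r.
    by [].
  rewrite sum_pairs /pairop -big_split; apply: eq_bigr => i _.
  rewrite -big_split; apply: eq_bigr => j _ /=.
  by rewrite (aC j) (casopC j).
by rewrite scalerA -scalerAl mul1r scalerA mulVf ?pnatr_eq0// !scale1r.
Qed.

Section Forms.
Variable Y : O -> O.
Hypothesis derY : derivation Y.

Lemma dlog_diag p : dlog Y p p = 0.
Proof. by rewrite /dlog subrr (deriv0 derY) mul0r. Qed.

Lemma dlog_sym p q : dlog Y p q = dlog Y q p.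
Proof. by rewrite /dlog -(opprB (z q)) (derivN derY) invrN mulrNN. Qed.

Lemma kz_forms_sum u :
  \sum_(i < n) \sum_(j < n | j != i) (Y (z i) / (z j - z i)) *: casop i j u =
  - pairop (dlog Y) u.
Proof.
rewrite sum_pairs /pairop -sumrN; apply: eq_bigr => i _.
rewrite -sumrN; apply: eq_bigr => j _.
rewrite (casopC j) -scalerDl -scaleNr; congr (_ *: _).
rewrite /dlog (derivB derY) -(opprB (z i)) invrN; ring.
Qed.

End Forms.

(** The three differences z_i - z_j, z_j - z_m, z_m - z_i add up to 0. Hence the three numerators
    are the same determinant, and the products of two of the inverses add up to 0. *)
Lemma dlog_arnold Y Y' : derivation Y -> derivation Y' ->
  arnold (dlog Y) (dlog Y').
Proof.
move=> dY dY' i j m ij mi mj; have [YD _ _] := dY; have [YD' _ _] := dY'.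
have Ex : (z i - z j)^-1 * (z i - z j) = 1 by rewrite mulVr ?zU.
have Ey : (z j - z m)^-1 * (z j - z m) = 1 by rewrite mulVr ?zU// eq_sym.
have Ew : (z m - z i)^-1 * (z m - z i) = 1 by rewrite mulVr ?zU.
rewrite /dlog !(derivB dY) !(derivB dY').
move: Ex Ey Ew; set x := (z i - z j)^-1; set y := (z j - z m)^-1.
set w := (z m - z i)^-1 => Ex Ey Ew.
have E : x * y + y * w + w * x = 0.
  transitivity (x * y * (w * (z m - z i)) + (x * (z i - z j)) * y * w
                + (y * (z j - z m)) * w * x); last by ring.
  by rewrite Ex Ey Ew; ring.
transitivity (((Y (z i) - Y (z j)) * (Y' (z j) - Y' (z m)) -
  (Y' (z i) - Y' (z j)) * (Y (z j) - Y (z m))) * (x * y + y * w + w * x)); first by ring.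
by rewrite E mulr0.
Qed.

(** Cartan's formula for the closedness of d(z_i - z_j) / (z_i - z_j). *)
Lemma dlog_closed Y Y' i j : derivation Y -> derivation Y' ->
  Y (dlog Y' i j) - Y' (dlog Y i j) = dlog (fun f => Y (Y' f) - Y' (Y f)) i j.
Proof.
move=> dY dY'; have [ij|ij] := eqVneq i j.
  rewrite ij /dlog subrr !(deriv0 dY, deriv0 dY') !mul0r.
  by rewrite !(deriv0 dY, deriv0 dY') subrr mul0r.
rewrite /dlog; set x := z i - z j; have xU : x \is a GRing.unit by exact: zU.
have YV Z (dZ : derivation Z) : Z x^-1 = - (Z x * x^-1 * x^-1).
  have [_ _ ZM] := dZ; have := ZM x^-1 x; rewrite mulVr// (deriv1 dZ) => /esym/eqP.
  rewrite addr_eq0 => /eqP E; rewrite -[LHS]mulr1 -(divrr xU) mulrA E; ring.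
have [_ _ YM] := dY; have [_ _ YM'] := dY'.
rewrite YM YM' (YV Y dY) (YV Y' dY'); ring.
Qed.

Section Flatness.
Variable D : (O -> O) -> W -> W.
Hypothesis DD : forall Y, derivation Y -> {morph D Y : u v / u + v}.
Hypothesis DZ : forall Y a u, derivation Y -> D Y (a *: u) = Y a *: u + a *: D Y u.
Hypothesis DA : forall Y i x u, derivation Y -> D Y (A i x u) = A i x (D Y u).

Lemma D_fullop Y a u : derivation Y ->
  D Y (fullop a u) = fullop (fun i j => Y (a i j)) u + fullop a (D Y u).
Proof.
move=> dY; have D0 : D Y 0 = 0 by apply: (addrI (D Y 0)); rewrite -(DD dY) !addr0.
have Dsum (I : finType) (F : I -> W) : D Y (\sum_r F r) = \sum_r D Y (F r).
  exact: (big_morph (D Y) (DD dY) D0).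
rewrite /fullop Dsum -big_split; apply: eq_bigr => i _ /=.
rewrite Dsum -big_split; apply: eq_bigr => j _ /=.
rewrite DZ//; congr (_ + _ *: _); rewrite /casop Dsum; apply: eq_bigr => r _.
by rewrite !DA.
Qed.

Lemma fullop_linear a : linear (fullop a).
Proof.
move=> c u v; rewrite /fullop scaler_sumr -big_split; apply: eq_bigr => i _ /=.
rewrite scaler_sumr -big_split; apply: eq_bigr => j _ /=.
by rewrite casop_linear scalerDr !scalerA mulrC.
Qed.

Lemma fullopB a b u : fullop a u - fullop b u = fullop (fun i j => a i j - b i j) u.
Proof.
rewrite /fullop -sumrB; apply: eq_bigr => i _; rewrite -sumrB.
by apply: eq_bigr => j _; rewrite scalerBl.
Qed.

(** The sign is positive because [kz] subtracts a form whose second expression is negative. *)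
Definition kzop (c : k) Y u : W := D Y u + (c%:A : O) *: pairop (dlog Y) u.

(** The derivatives of the form combine by closedness, the quadratic terms cancel by
    [fullop_commute], and the mixed terms are symmetric in Y and Y'. *)
Lemma kz_flat c Y Y' u : derivation Y -> derivation Y' ->
  D (fun f => Y (Y' f) - Y' (Y f)) u = D Y (D Y' u) - D Y' (D Y u) ->
  kzop c Y (kzop c Y' u) - kzop c Y' (kzop c Y u) =
  kzop c (fun f => Y (Y' f) - Y' (Y f)) u.
Proof.
move=> dY dY' E.
pose s : O := c%:A * 2^-1%:A.
have KE Z v : derivation Z -> kzop c Z v = D Z v + s *: fullop (dlog Z) v.
  move=> dZ; rewrite /kzop pairop_fullop ?scalerA//.
    by move=> p; exact: dlog_diag.
  by move=> p q; exact: dlog_sym.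
have dYY' := derivation_bracket dY dY'.
have Ys Z : derivation Z -> Z s = 0.
  move=> dZ; have [_ _ ZM] := dZ; rewrite /s ZM !(deriv_cst dZ).
  by rewrite mul0r mulr0 addr0.
have fD a := linear_mapD (fullop_linear a).
have fZ a := linear_mapZ (fullop_linear a).
have step Z Z' : derivation Z -> derivation Z' ->
    kzop c Z (kzop c Z' u) = D Z (D Z' u) +
      s *: fullop (fun i j => Z (dlog Z' i j)) u +
      (s *: fullop (dlog Z') (D Z u) + s *: fullop (dlog Z) (D Z' u)) +
      (s * s) *: fullop (dlog Z) (fullop (dlog Z') u).
  move=> dZ dZ'; rewrite (KE Z)// (KE Z')// (DD dZ) (DZ _ _ dZ) (Ys _ dZ) scale0r add0r.
  rewrite D_fullop// fD fZ !scalerDr scalerA.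
  set a1 := D Z _; set a2 := s *: _; set a3 := s *: _; set a4 := s *: _; set a5 := (s * s) *: _.
  by rewrite !addrA.
rewrite !step// KE// E.
have -> : fullop (dlog (fun f => Y (Y' f) - Y' (Y f))) u =
    fullop (fun i j => Y (dlog Y' i j)) u - fullop (fun i j => Y' (dlog Y i j)) u.
  rewrite fullopB /fullop; apply: eq_bigr => i _; apply: eq_bigr => j _.
  by rewrite dlog_closed.
have -> : fullop (dlog Y) (fullop (dlog Y') u) = fullop (dlog Y') (fullop (dlog Y) u).
  apply: fullop_commute.
  - exact: dlog_diag.
  - exact: dlog_diag.
  - exact: dlog_sym.
  - exact: dlog_sym.
  - exact: dlog_arnold.
rewrite scalerBr.
set a1 := D Y _; set a2 := D Y' _; set a3 := s *: _; set a4 := s *: _; set a5 := s *: _.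
set a6 := s *: _; set a7 := _ *: _.
zmod.
Qed.

End Flatness.
End KnizhnikZamolodchikov.

(** * The WZW connection *)

Section Assembly.
Variables (k : numClosedFieldType) (g : lieAlgebra k) (B : g -> g -> k).
Variables (X : (\dim {:g}).-tuple g) (hc : k) (l n : nat).
Variable V : 'I_n -> gmodule g.
Variable H : forall p, hwModule B l (pointed_reps V p).
Variables (O : comUnitAlgType k) (z : 'I_n -> O).
Hypothesis zU : forall i j, i != j -> z i - z j \is a GRing.unit.
Hypotheses (invB : invariant_form B) (orthX : orthonormal_basis B X).
Hypothesis coxX : dual_coxeter X hc.
Hypothesis levX : l%:R + hc != 0.
Hypothesis V_irr : forall i, irreducible (V i).
Local Notation HO := (HO H O).
Local Notation VO := (VO V O).
Local Notation C := (conf_blocks H z).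
Local Notation blk := (@block k g B l n V H O z).
Local Notation M := (fun p => @mode_at k g B l n V H O p).
Local Notation famV := (fun i => V i : lmodType k).

Let affM p : affine_action (O := O) (W := HO) B l (M p) := @mode_at_affine k g B l n V H O p.
Let commM p q x y m r (u : HO) : p != q ->
  M p x m (M q y r u) = M q y r (M p x m u).
Proof. exact: mode_at_commute. Qed.

Lemma block_linear : linear (blk : HO -> C).
Proof. exact: span_proj_linear. Qed.

Lemma block_lact x f (u : HO) : in_A z f -> blk (lact M x f u) = 0.
Proof.
move=> fA; rewrite -(linear_map0 block_linear).
apply/span_projE; rewrite subr0; exists [:: (1, lact M x f u)].
  by move=> y; rewrite inE => /eqP ->; exact: CoinvRel.
by rewrite big_seq1 scale1r.
Qed.

Lemma natural_map_linear : linear (natural_map H z : VO -> C).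
Proof. exact: (linear_compose block_linear (@incl_linear k g B l n V H O)). Qed.

Lemma natural_map_surjective b : exists u : VO, natural_map H z u = b.
Proof.
have [w <-] : exists w : HO, blk w = b.
  by exists (repr (b : Quotient.quot _)); exact: span_proj_repr.
pose Z (w : HO) := exists u : VO, w = Defs.incl H u.
have il := @incl_linear k g B l n V H O.
have Z0 : Z 0 by exists 0; rewrite (linear_map0 il).
have Zl a u v : Z u -> Z v -> Z (a *: u + v).
  by move=> [u' ->] [v' ->]; exists (a *: u' + v'); rewrite il.
have Zz p x u : Z u -> Z (M p x 0 u).
  move=> [u' ->]; case: p => [i|]; first by rewrite incl_zero_mode; eexists.
  by rewrite incl_infinity.
have Zp p x m u : Z u -> 0 < m -> M p x m u = 0.
  by move=> [u' ->]; exact: incl_pos.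
have [d dw] : reached M Z w.
  apply: (@incl_generates k g B l n V H O V_irr (reached M Z)).
  - exact: reached_linear.
  - exact: (reached_mode affM commM Z0 Zz Zp).
  - by move=> u; exists 0%N; apply: Depth_base; exists u.
have [_ [u ->] E] := depth_covered affM commM Z0 Zl Zz Zp block_linear block_lact dw.
by exists u.
Qed.

Section Derivation.
Variable Y : O -> O.
Hypothesis derY : derivation Y.

Lemma wzw_exists d : laurent d -> (forall f, in_A z f -> in_A z (vder Y d f)) ->
  exists nabla : C -> C, wzw_covariant X hc Y d nabla.
Proof.
move=> db stab.
have [] := @nabla_op_descends k g B X hc l n O z HO M affM commM invB orthX coxX levX
  Y (tderiv Y) derY _ _ _ d db (@coinv_rel k g B l n V H O z) _ (@in_A_laurent k O n z) stab.
- exact: tderivD.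
- by move=> a u; exact: tderivZ.
- move=> p x m u; apply: (tderiv_factor derY (E := fun p => H p : lmodType k)).
  exact: mode_linear.
- move=> u; split => [[x f v fA]|[x [f [v [fA ->]]]]]; first by exists x, f, v.
  exact: CoinvRel.
move=> nabla E; exact: (ex_intro _ nabla E).
Qed.

Lemma casimir_mode i j (u : VO) :
  \sum_r M (Some i) (tnth X r) 0 (M (Some j) (tnth X r) 0 (Defs.incl H u : HO)) =
  Defs.incl H (casimir X i j u).
Proof.
have il := @incl_linear k g B l n V H O.
rewrite /casimir (big_morph (@Defs.incl k g B l n V H O) (linear_mapD il) (linear_map0 il)).
by apply: eq_bigr => r _; rewrite !incl_zero_mode.
Qed.

Lemma nabla_lift0_natural nabla (u : VO) :
  wzw_covariant X hc Y (lift0_field z Y) nabla ->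
  nabla (natural_map H z u) = natural_map H z (kz X hc l z Y u).
Proof.
move=> E; rewrite /natural_map E (incl_tderiv H u derY) (linear_mapD block_linear).
have nl := natural_map_linear.
have -> : blk (Defs.incl H (kz X hc l z Y u)) =
    natural_map H z (tderiv Y u) - natural_map H z (kz_form X hc l z Y u).
  exact: (linear_mapB nl (tderiv Y u) (kz_form X hc l z Y u)).
congr (_ + _).
have := @tsug_lift0 k g B X hc l n O z HO C M affM commM blk block_linear block_lact
  (Defs.incl H u) (fun p x m h => @incl_pos k g B l n V H O p x m u h)
  (fun x => incl_infinity H x u) Y.
move=> ->; congr (- _); rewrite /kz_form (linear_mapZ nl); congr (_ *: _).
rewrite (big_morph (natural_map H z : VO -> C) (linear_mapD nl) (linear_map0 nl)).
apply: eq_bigr => i _.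
rewrite (big_morph (natural_map H z : VO -> C) (linear_mapD nl) (linear_map0 nl)).
apply: eq_bigr => j _; rewrite (linear_mapZ nl); congr (_ *: _).
rewrite /natural_map -casimir_mode /cas.
by rewrite (big_morph (blk : HO -> C) (linear_mapD block_linear) (linear_map0 block_linear)).
Qed.

(** Any lift differs from the one annihilating z by the vertical field (D z) d/dz. *)
Lemma lift_field_decomposition (D : family_coef O n -> family_coef O n) :
  lift_field z Y D = fun p m => lift0_field z Y p m + vf (D (z_fun z)) p m.
Proof.
apply/funext => p; apply/funext => m; case: p => [i|] /=.
  by rewrite addrC.
by rewrite add0r.
Qed.

(** By surjectivity it suffices to compare on the image of the degree zero parts, where T((D z)
    d/dz) vanishes by [tsug_vf]. *)
Lemma wzw_unique D nabla nabla0 : lifts z Y D ->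
  wzw_covariant X hc Y (lift_field z Y D) nabla ->
  wzw_covariant X hc Y (lift0_field z Y) nabla0 ->
  forall b : C, nabla b = nabla0 b.
Proof.
move=> liftD E E0 b; have [u <-] := natural_map_surjective b.
pose w : HO := Defs.incl H u.
have DA : in_A z (D (z_fun z)) by apply: (lifts_stable liftD); exact: A_z.
have bD := linear_mapD block_linear.
have S1 : blk (tsug X hc l M (vf (D (z_fun z))) w) = 0.
  exact: (@tsug_vf k g B X hc l n O z HO C zU M affM commM blk block_linear block_lact
    w (fun p x m h => @incl_pos k g B l n V H O p x m u h) (fun x => incl_infinity H x u) _ DA).
have S2 : tsug X hc l M (lift_field z Y D) w =
    tsug X hc l M (lift0_field z Y) w + tsug X hc l M (vf (D (z_fun z))) w.
  rewrite lift_field_decomposition.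
  exact: (tsug_coefD X hc affM w (laurent_lift0 z Y) (laurent_vf (in_A_laurent DA))).
have S3 : blk (tsug X hc l M (lift_field z Y D) w) = blk (tsug X hc l M (lift0_field z Y) w).
  exact: etrans (congr1 blk S2) (etrans (bD _ _) (etrans (congr1 (+%R _) S1) (addr0 _))).
have S4 := congr1 (+%R (blk (tderiv Y w))) S3.
exact: etrans (E w) (etrans (bD _ _) (etrans S4 (esym (etrans (E0 w) (bD _ _))))).
Qed.

Lemma wzw_kz_connection : exists nablaKZ : C -> C,
  [/\ forall u : VO,
        nablaKZ (natural_map H z u) = natural_map H z (kz X hc l z Y u),
      exists D, lifts z Y D &
      forall D, lifts z Y D -> exists d nabla,
        [/\ vertical_part z Y D d, wzw_covariant X hc Y d nabla &
            exists a : O, forall b : C, nabla b = nablaKZ b + a *: b]].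
Proof.
have [nablaKZ E0] := wzw_exists (laurent_lift0 z Y) (lift0_stable zU derY).
exists nablaKZ; split.
- by move=> u; exact: nabla_lift0_natural.
- by exists (vder Y (lift0_field z Y)); exact: lifts0.
move=> D liftD; have vD := vder_lift zU derY liftD.
have [nabla E] : exists nabla : C -> C, wzw_covariant X hc Y (lift_field z Y D) nabla.
  apply: wzw_exists; first exact: laurent_lift.
  by move=> f fA; rewrite -vD//; exact: (lifts_stable liftD).
exists (lift_field z Y D), nabla; split=> //.
  by split; [exact: laurent_lift|exact: vD].
by exists 0 => b; rewrite scale0r addr0; exact: wzw_unique E E0 b.
Qed.

End Derivation.

Let A i x : VO -> VO := factor i (gact x : V i -> V i).

Let act_lin i x : linear (gact x : V i -> V i).
Proof. by move=> a u v; exact: gactDr. Qed.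

Let A_linear i x : linear (A i x).
Proof. exact: (factor_linear (E := famV) (@act_lin i x)). Qed.

Let A_linl i a x y u : A i (a *: x + y) u = a%:A *: A i x u + A i y u.
Proof.
rewrite /A -(factor_lincomb (E := famV) a (@act_lin i x) (@act_lin i y)).
by apply: (factor_ext (E := famV)) => v; exact: gactDl.
Qed.

Let A_lie i x y u : A i x (A i y u) = A i y (A i x u) + A i (lie x y) u.
Proof.
have l2 := linear_compose (@act_lin i y) (@act_lin i x).
have E1 := factor_compose (E := famV) (@act_lin i x) (@act_lin i y) u.
have E2 := factor_compose (E := famV) (@act_lin i y) (@act_lin i x) u.
have E3 := factor_lincomb (E := famV) 1 l2 (@act_lin i (lie x y)) u.
rewrite scale1r scale1r in E3.
apply: etrans (esym E1) (etrans _ (etrans E3 (congr1 (+%R^~ _) E2))).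
by apply: (factor_ext (E := famV)) => v; rewrite scale1r gactJ addrC subrK.
Qed.

Let A_comm i j x y u : i != j -> A i x (A j y u) = A j y (A i x u).
Proof. by move=> ij; apply: (factor_commute (E := famV)) => //; exact: act_lin. Qed.

Lemma kz_form_eq Y (u : VO) : derivation Y -> kz_form X hc l z Y u = kz_form' X hc l z Y u.
Proof.
move=> derY; have E := kz_forms_sum X z A_comm derY u.
exact: etrans (congr1 ( *:%R _) E) (scalerN _ _).
Qed.

Lemma kz_kzop Y (u : VO) : derivation Y ->
  kz X hc l z Y u = kzop X z A (fun Z => tderiv Z) (l%:R + hc)^-1 Y u.
Proof.
move=> derY; have E := kz_form_eq u derY.
exact: etrans (congr1 (fun t => tderiv Y u - t) E) (congr1 (+%R (tderiv Y u)) (opprK _)).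
Qed.

Lemma kz_flatness Y Y' (u : VO) : derivation Y -> derivation Y' ->
  kz X hc l z Y (kz X hc l z Y' u) - kz X hc l z Y' (kz X hc l z Y u) =
  kz X hc l z (fun f => Y (Y' f) - Y' (Y f)) u.
Proof.
move=> dY dY'; have dYY' := derivation_bracket dY dY'.
have F := @kz_flat k g B X n invB orthX O z VO zU A A_linear A_linl A_lie A_comm
  (fun Z => tderiv Z) (fun Z dZ => tderivD (E := famV) dZ)
  (fun Z a u dZ => tderivZ (E := famV) dZ a u)
  (fun Z i x u dZ => tderiv_factor (E := famV) dZ u (@act_lin i x))
  (l%:R + hc)^-1 Y Y' u dY dY' (tderiv_bracket (E := famV) u dY dY').
have E1 := kz_kzop (kz X hc l z Y' u) dY; rewrite (kz_kzop u dY') in E1.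
have E2 := kz_kzop (kz X hc l z Y u) dY'; rewrite (kz_kzop u dY) in E2.
rewrite (kz_kzop u dY') (kz_kzop u dY) E1 E2.
exact: etrans F (esym (kz_kzop u dYY')).
Qed.

End Assembly.

Theorem mainTheorem5 (R : realType) (n l : nat) (g : lieAlgebra R[i])
  (B : g -> g -> R[i]) (X : (\dim {:g}).-tuple g) (hc : R[i])
  (V : 'I_n -> gmodule g)
  (H : forall p : option 'I_n, hwModule B l (pointed_reps V p))
  (U : conf_open R[i] n) :
  simple_lie g -> normalized_form B -> orthonormal_basis B X ->
  dual_coxeter X hc -> (0 < l)%N ->
  (forall i, irreducible (V i)) -> (forall i, level_le l (V i)) ->
  [/\ (* the natural map is surjective *)
      forall b : conf_blocks H (zcoord U),
        exists u : VO V (regfun U), natural_map H (zcoord U) u = b,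
      (* the two expressions of the connection form agree *)
      forall Y : regfun U -> regfun U, derivation Y ->
        forall u : VO V (regfun U),
          kz_form X hc l (zcoord U) Y u = kz_form' X hc l (zcoord U) Y u,
      (* the connection descends to conformal blocks, where it is the
         WZW-connection, as a connection on the projectivization *)
      forall Y : regfun U -> regfun U, derivation Y ->
        exists nablaKZ : conf_blocks H (zcoord U) -> conf_blocks H (zcoord U),
          [/\ forall u : VO V (regfun U),
                nablaKZ (natural_map H (zcoord U) u) =
                natural_map H (zcoord U) (kz X hc l (zcoord U) Y u),
              exists D, lifts (zcoord U) Y D &
              forall D, lifts (zcoord U) Y D ->
                exists d nabla,
                  [/\ vertical_part (zcoord U) Y D d,
                      wzw_covariant X hc Y d nabla &
                      exists a : regfun U, forall b : conf_blocks H (zcoord U),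
                        nabla b = nablaKZ b + a *: b]] &
      (* the connection is flat *)
      forall Y Y' : regfun U -> regfun U, derivation Y -> derivation Y' ->
        forall u : VO V (regfun U),
          kz X hc l (zcoord U) Y (kz X hc l (zcoord U) Y' u) -
          kz X hc l (zcoord U) Y' (kz X hc l (zcoord U) Y u) =
          kz X hc l (zcoord U) (fun f => Y (Y' f) - Y' (Y f)) u].
Proof.
move=> [nonabelian _] [invB _] orthX coxX l_gt0 V_irr _.
have zU := zcoordB_unit U.
(* The trivial representation at infinity supplies the vacuum module. *)
have levX := critical_level_neq0 invB orthX coxX (H None) l_gt0 nonabelian.
split.
- by move=> b; exact: natural_map_surjective.
- by move=> Y derY u; exact: (kz_form_eq X hc l (zcoord U) u derY).
- by move=> Y derY; exact: wzw_kz_connection.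
- by move=> Y Y' derY derY' u; exact: (kz_flatness hc l zU invB orthX u derY derY').
Qed.
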